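(* Let $\Omega\subset\mathbb{R}^d$ be compact and satisfy an interior cone condition, let $k\ge1$, and let $X_n=\{x_1,\dots,x_n\}$ be an i.i.d. sample of size $n$ from a nicely behaving distribution on $\Omega$. Let $f:\mathbb{R}^d\to\mathbb{R}$ be $k$ times continuously differentiable, let $F_n=(f(x_1),\dots,f(x_n))$, and let $s_{F_n,X_n}^{\mathrm{MLS}}$ be the degree $k-1$ MLS approximation built from $X_n$ and $F_n$ with bandwidth $h_n$, where $h_n$ is the fill distance of $X_n$. Let $Q=\sum_{|\alpha|\le m}q_\alpha\partial^\alpha$ be a linear differential operator with constant real coefficients of order $m<k$. Then for every $\hat x\in\Omega$ there are positive constants $\mathcal{K},C_{M_Q},c_\mu$, independent of $n$, such that $$P\Big(\big|Q s_{F_n,X_n}^{\mathrm{MLS}}(\hat x)-Qf(\hat x)\big|\ge\mathcal{K}\,h_n^{\,k-m}\Big)\le\frac{C_{M_Q}}{n^{c_\mu}},$$ and in particular $$\lim_{n\to\infty}P\Big(\big|Q s_{F_n,X_n}^{\mathrm{MLS}}(\hat x)-Qf(\hat x)\big|\ge\mathcal{K}\,h_n^{\,k-m}\Big)=0.$$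
   Context: Interior cone condition: there exist an angle $\vartheta\in(0,\pi/2)$ and a radius $r>0$ such that for every $x\in\Omega$ there is a unit vector $\xi(x)$ for which the cone $\{x+\lambda y: y\in\mathbb{R}^d,\ \|y\|_2=1,\ y^T\xi(x)\ge\cos\vartheta,\ \lambda\in[0,r]\}$ is contained in $\Omega$. Nicely behaving distribution: a probability distribution on $\Omega$ with a density $p$, $p(x)>0$ for all $x\in\Omega$, for which there are constants $0<\underline{c}\le\bar{c}<\infty$ such that $p$ lies between $\underline{c}$ and $\bar c$ times the uniform probability density on $\Omega$. Fill distance: $h_n=\sup_{x\in\Omega}\min_{1\le i\le n}\|x-x_i\|$. Weight: fix $s>0$ and $\Phi\in\mathcal{C}^k(\mathbb{R}^d)$, nonnegative, supported in the ball $B(0,s)$ and positive in its interior; put $\theta_h(x)=\Phi(x/h)$ with $h=h_n$. MLS approximation: $\Pi_{k-1}^d$ is the space of polynomials on $\mathbb{R}^d$ of total degree at most $k-1$. For $\xi\in\mathbb{R}^d$ let $p_\xi^*=\operatorname{argmin}_{p\in\Pi_{k-1}^d}\sum_{i=1}^n(p(x_i)-f(x_i))^2\,\theta_h(\xi-x_i)$, and define $s_{F_n,X_n}^{\mathrm{MLS}}(\xi)=p_\xi^*(\xi)$. Derivatives of $s_{F_n,X_n}^{\mathrm{MLS}}$ are derivatives of the function $\xi\mapsto p_\xi^*(\xi)$. Outcomes for which the minimizer is not unique in a neighbourhood of $\hat x$ (so that the derivatives at $\hat x$ are not defined) are counted as belonging to the event whose probability is bounded above. The order of $Q$ is the largest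 $|\alpha|$ with $q_\alpha\ne0$. *)

(* Defs.v *)
(* Only the canonical structures, coercions and hints of [mpoly] are imported:
   its notations clash with those of MathComp-Analysis. *)
From HB Require Import structures.
From mathcomp Require Import all_boot all_order all_algebra.
From mathcomp Require Import all_classical all_reals all_analysis.
From mathcomp Require Export (canonicals,coercions,hints) mpoly.

Set Implicit Arguments.
Unset Strict Implicit.
Unset Printing Implicit Defensive.

Import Order.TTheory GRing.Theory Num.Theory.
Import numFieldNormedType.Exports.

Local Open Scope classical_set_scope.
Local Open Scope ring_scope.

Section euclidean.
Context {R : realType} {d : nat}.
Implicit Types x y : 'rV[R]_d.

Definition dotrv x y : R := \sum_(j < d) x 0 j * y 0 j.

(* The library norm on ['rV[R]_d] is the sup norm; only its topology, which is
   the Euclidean one, is used in this development. *)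
Definition norm2 x : R := Num.sqrt (\sum_(j < d) x 0 j ^+ 2).

Definition cone (x xi : 'rV[R]_d) (vartheta r : R) : set 'rV[R]_d :=
  [set z | exists y lambda,
    [/\ norm2 y = 1, cos vartheta <= dotrv y xi, 0 <= lambda <= r
      & z = x + lambda *: y]].

Definition interior_cone_condition (Omega : set 'rV[R]_d) : Prop :=
  exists vartheta r : R, [/\ 0 < vartheta < pi / 2, 0 < r &
    forall x, Omega x ->
      exists2 xi, norm2 xi = 1 & cone x xi vartheta r `<=` Omega].

End euclidean.

(* The sigma-algebra on ['rV[T]_d] generated by the coordinate maps; for
   [T := R] it is the Borel sigma-algebra of R^d. *)
Definition measure_rV_display : measure_display -> measure_display.
Proof. exact. Qed.

Section measurable_rV.
Context {disp : measure_display} {T : measurableType disp} (d : nat).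

Definition rV_cylinders : set (set 'rV[T]_d) :=
  [set A | exists i B, measurable B /\ A = [set v : 'rV[T]_d | B (v 0 i)]].

HB.instance Definition _ := @isMeasurable.Build (measure_rV_display disp)
  'rV[T]_d <<s rV_cylinders >> (@sigma_algebra0 _ _ _) (@sigma_algebraC _ _)
  (@sigma_algebra_bigcup _ _ _).

End measurable_rV.

Section measurable_rV_theory.
Context {disp : measure_display} {T : measurableType disp}.

Lemma measurable_rV_coord d (i : 'I_d) :
  measurable_fun [set: 'rV[T]_d] (fun v : 'rV[T]_d => v 0 i).
Proof.
move=> _ Y mY; rewrite setTI; apply: sub_sigma_algebra.
by exists i, Y.
Qed.

Lemma measurable_fun_rV disp' (T' : measurableType disp') d
    (f : T' -> 'rV[T]_d) :
  (forall i, measurable_fun [set: T'] (fun t => f t 0 i)) ->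
  measurable_fun [set: T'] f.
Proof.
move=> mf; apply: (@measurability _ _ _ _ setT f (@rV_cylinders _ T d)) => //.
move=> _ [_ [i [B [mB ->]]] <-].
exact: mf.
Qed.

Definition consrv d (p : T * 'rV[T]_d) : 'rV[T]_d.+1 :=
  \row_i (if unlift ord0 i is Some j then p.2 0 j else p.1).

Definition unconsrv d (v : 'rV[T]_d.+1) : T * 'rV[T]_d :=
  (v 0 ord0, \row_j v 0 (lift ord0 j)).

Lemma consrv0 d (p : T * 'rV[T]_d) : consrv p 0 ord0 = p.1.
Proof. by rewrite mxE unlift_none. Qed.

Lemma consrvS d (p : T * 'rV[T]_d) j : consrv p 0 (lift ord0 j) = p.2 0 j.
Proof. by rewrite mxE liftK. Qed.

Lemma consrvK d : cancel (@consrv d) (@unconsrv d).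
Proof.
move=> p; rewrite /unconsrv consrv0 [RHS]surjective_pairing; congr pair.
by apply/rowP => j; rewrite mxE consrvS.
Qed.

Lemma unconsrvK d : cancel (@unconsrv d) (@consrv d).
Proof.
move=> v; apply/rowP => i; have [j ->|->] := unliftP ord0 i.
  by rewrite consrvS mxE.
by rewrite consrv0.
Qed.

Lemma measurable_consrv d : measurable_fun setT (@consrv d).
Proof.
apply: measurable_fun_rV => i; have [j ->|->] := unliftP ord0 i.
  under eq_fun do rewrite consrvS.
  exact: (measurableT_comp (measurable_rV_coord j) measurable_snd).
by under eq_fun do rewrite consrv0; exact: measurable_fst.
Qed.

Lemma measurable_unconsrv d : measurable_fun setT (@unconsrv d).
Proof.
apply/measurable_fun_pairP; split => /=.
  exact: measurable_rV_coord.
apply: measurable_fun_rV => j /=; under eq_fun do rewrite mxE.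
exact: measurable_rV_coord.
Qed.

End measurable_rV_theory.

Section lebesgue_rV.
Context {R : realType}.
Local Open Scope ereal_scope.

Section step.
Variables (d : nat) (mu : {sigma_finite_measure set 'rV[R]_d -> \bar R}).

Definition lebesgue_consrv : set 'rV[R]_d.+1 -> \bar R :=
  pushforward (@lebesgue_measure R \x mu) (@consrv _ R d).

Let lebesgue_consrv0 : lebesgue_consrv set0 = 0.
Proof. by rewrite /lebesgue_consrv /pushforward preimage_set0 measure0. Qed.

Let lebesgue_consrv_ge0 A : 0 <= lebesgue_consrv A.
Proof. exact: (measure_ge0 (@lebesgue_measure R \x mu)). Qed.

Let measurable_consrv_preimage A :
  measurable A -> measurable (@consrv _ R d @^-1` A).
Proof. by move=> mA; rewrite -[X in measurable X]setTI; exact: measurable_consrv. Qed.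

Let lebesgue_consrv_sigma_additive : semi_sigma_additive lebesgue_consrv.
Proof.
move=> F mF tF mUF; rewrite /lebesgue_consrv /pushforward preimage_bigcup.
apply: (measure_semi_sigma_additive (s := @lebesgue_measure R \x mu)).
- by move=> n; exact: measurable_consrv_preimage.
- apply/trivIsetP => /= i j _ _ ij; rewrite -preimage_setI.
  by move/trivIsetP : tF => /(_ _ _ _ _ ij) ->//; rewrite preimage_set0.
- by rewrite -preimage_bigcup; exact: measurable_consrv_preimage.
Qed.

HB.instance Definition _ := isMeasure.Build _ _ _ lebesgue_consrv
  lebesgue_consrv0 lebesgue_consrv_ge0 lebesgue_consrv_sigma_additive.

Let sigma_finite_lebesgue_consrv : sigma_finite setT lebesgue_consrv.
Proof.
have /sigma_finiteP[F [TF ndF Foo]] := sigma_finiteT (@lebesgue_measure R).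
have /sigma_finiteP[G [TG ndG Goo]] := sigma_finiteT mu.
exists (fun i => @unconsrv _ R d @^-1` (F i `*` G i)).
  apply/esym; rewrite -subTset => v _.
  have : (\bigcup_i F i) (unconsrv (v : 'rV[R]_d.+1)).1 by rewrite -TF.
  have : (\bigcup_i G i) (unconsrv v).2 by rewrite -TG.
  move=> [k _ Gk] [n _ Fn]; exists (maxn n k) => //; split => /=.
  - by move: Fn; exact/subsetPset/ndF/leq_maxl.
  - by move: Gk; exact/subsetPset/ndG/leq_maxr.
move=> i; have [mF Fi] := Foo i; have [mG Gi] := Goo i; split.
  rewrite -[X in measurable X]setTI; apply: measurable_unconsrv => //.
  exact: measurableX.
rewrite /lebesgue_consrv /pushforward -comp_preimage.
rewrite (_ : _ \o _ = id) ?preimage_id; last first.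
  by apply/funext => p; rewrite /= consrvK.
by rewrite product_measure1E// lte_mul_pinfty// ge0_fin_numE.
Qed.

HB.instance Definition _ := Measure_isSigmaFinite.Build _ _ _
  lebesgue_consrv sigma_finite_lebesgue_consrv.

End step.

(* Lebesgue measure on R^d: the d-fold product of the Lebesgue measure on R,
   transported along R * R^d ~ R^(d+1) at each step. *)
Fixpoint lebesgue_rV (d : nat) : {sigma_finite_measure set 'rV[R]_d -> \bar R} :=
  if d is d'.+1 return {sigma_finite_measure set 'rV[R]_d -> \bar R}
  then lebesgue_consrv (lebesgue_rV d')
  else \d_(0%R : 'rV[R]_0).

End lebesgue_rV.

Lemma lebesgue_rV_box (R : realType) d (a b : 'rV[R]_d) :
  (forall j, a 0 j <= b 0 j) ->
  lebesgue_rV d [set x : 'rV[R]_d | forall j, a 0 j <= x 0 j <= b 0 j] =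
  (\prod_(j < d) (b 0 j - a 0 j))%:E.
Proof.
elim: d => [|d IH] in a b *; move=> ab.
  by rewrite big_ord0 /= diracE mem_set// => -[].
pose A : set R := `[a 0 ord0, b 0 ord0]%classic.
pose a' : 'rV[R]_d := \row_j a 0 (lift ord0 j).
pose b' : 'rV[R]_d := \row_j b 0 (lift ord0 j).
pose B := [set x : 'rV[R]_d | forall j, a' 0 j <= x 0 j <= b' 0 j].
have mB : measurable B.
  rewrite (_ : B = \bigcap_(j in [set: 'I_d])
      (fun x : 'rV[R]_d => x 0 j) @^-1` `[a' 0 j, b' 0 j]%classic).
    apply: fin_bigcap_measurable => // j _; rewrite -[X in measurable X]setTI.
    by apply: measurable_rV_coord => //; exact: measurable_itv.
  apply/seteqP; split => x /= Bx j; first by move=> _; rewrite set_itvcc; exact: Bx.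
  by have := Bx j I; rewrite set_itvcc.
rewrite /= /lebesgue_consrv /pushforward (_ : _ @^-1` _ = A `*` B); last first.
  apply/seteqP; split => [p /= ABp|p [/= Ap Bp] j].
    split; first by have := ABp ord0; rewrite consrv0 /A set_itvcc.
    by move=> j; have := ABp (lift ord0 j); rewrite consrvS !mxE.
  have [i ->|->] := unliftP ord0 j.
    by rewrite consrvS; have := Bp i; rewrite !mxE.
  by rewrite consrv0; move: Ap; rewrite /A set_itvcc.
rewrite product_measure1E//; last exact: measurable_itv.
rewrite IH => [|j]; last by rewrite !mxE.
rewrite big_ord_recl EFinM; congr (_ * _)%E.
  rewrite [LHS]lebesgue_measure_itv /= lte_fin.
  have := ab ord0; rewrite le_eqVlt => /orP[/eqP ->|->] //.
  by rewrite ltxx subrr.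
by congr EFin; apply: eq_bigr => j _; rewrite !mxE.
Qed.

Section random_sample.
Context {R : realType} {d : nat}.

Definition uniform_density (Omega : set 'rV[R]_d) (x : 'rV[R]_d) : R :=
  \1_Omega x / fine (lebesgue_rV d Omega).

(* The two-sided bound is imposed on all of R^d, so that the density vanishes
   outside [Omega]: this is what makes [mu] a distribution on [Omega]. *)
Definition nicely_behaving (Omega : set 'rV[R]_d)
    (mu : probability 'rV[R]_d R) : Prop :=
  exists p : 'rV[R]_d -> R, [/\ measurable_fun setT p,
    forall A, measurable A ->
      mu A = (\int[lebesgue_rV d]_(x in A) (p x)%:E)%E,
    forall x, Omega x -> 0 < p x &
    exists cl cu : R, 0 < cl <= cu /\
      forall x, cl * uniform_density Omega x <= p x <=
                cu * uniform_density Omega x].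

Context {disp : measure_display} {T : measurableType disp}
  (P : probability T R).

Definition mutually_independent n (X : 'I_n -> {RV P >-> 'rV[R]_d}) : Prop :=
  forall A : 'I_n -> set 'rV[R]_d, (forall i, measurable (A i)) ->
    P (\bigcap_(i in [set: 'I_n]) X i @^-1` A i) =
    (\prod_(i < n) P (X i @^-1` A i))%E.

Definition iid_sample (mu : probability 'rV[R]_d R) n
    (X : 'I_n -> {RV P >-> 'rV[R]_d}) : Prop :=
  mutually_independent X /\
  forall i A, measurable A -> distribution P (X i) A = mu A.

End random_sample.

(* [inf] is a minimum here, the index set being finite; it is 0 for [n = 0]. *)
Definition fill_distance {R : realType} {d : nat} (Omega : set 'rV[R]_d) n
    (X : 'I_n -> 'rV[R]_d) : R :=
  sup [set inf [set norm2 (x - X i) | i in [set: 'I_n]] | x in Omega].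

Section differential_operators.
Context {R : realType} {d : nat}.
Implicit Type g : 'rV[R]_d -> R.

Definition partial (i : 'I_d) g : 'rV[R]_d -> R := 'D_(delta_mx 0 i) g.

Definition mpartial (alpha : mpoly.multinom d) g : 'rV[R]_d -> R :=
  foldr (fun i => iter (alpha i) (partial i)) g (enum 'I_d).

Fixpoint Ck (k : nat) g : Prop :=
  continuous g /\
  if k is k'.+1 then
    forall i, (forall x, derivable g x (delta_mx 0 i)) /\ Ck k' (partial i g)
  else True.

(* [mpoly.bmultinom d m.+1] is the finite type of multi-indices of length at
   most [m]. *)
Definition diffop (m : nat) (q : mpoly.multinom d -> R) g (x : 'rV[R]_d) : R :=
  \sum_(alpha : mpoly.bmultinom d m.+1) q alpha * mpartial alpha g x.

Definition has_order (m : nat) (q : mpoly.multinom d -> R) : Prop :=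
  (exists alpha, mpoly.mdeg alpha = m /\ q alpha != 0) /\
  (forall alpha, q alpha != 0 -> (mpoly.mdeg alpha <= m)%N).

End differential_operators.

Section moving_least_squares.
Context {R : realType} {d : nat}.

Definition mls_weight (k : nat) (s : R) (Phi : 'rV[R]_d -> R) : Prop :=
  [/\ Ck k Phi, forall x, 0 <= Phi x,
    closure [set x | Phi x != 0] `<=` [set x | norm2 x <= s] &
    forall x, norm2 x < s -> 0 < Phi x].

Variables (k : nat) (Phi f : 'rV[R]_d -> R) (h : R) (n : nat)
  (X : 'I_n -> 'rV[R]_d).

Definition mls_loss (xi : 'rV[R]_d) (p : mpoly.mpoly d R) : R :=
  \sum_(i < n) (mpoly.meval (X i 0) p - f (X i)) ^+ 2 *
               Phi (h^-1 *: (xi - X i)).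

(* [mpoly.msize p] is 1 plus the total degree of [p], and 0 if [p = 0]. *)
Definition mls_minimizer (xi : 'rV[R]_d) (p : mpoly.mpoly d R) : Prop :=
  (mpoly.msize p <= k)%N /\
  forall p', (mpoly.msize p' <= k)%N -> mls_loss xi p <= mls_loss xi p'.

Definition mls (xi : 'rV[R]_d) : R :=
  mpoly.meval (xi 0) (xget 0 [set p | mls_minimizer xi p]).

Definition mls_defined_near (xhat : 'rV[R]_d) : Prop :=
  \forall xi \near xhat, exists! p, mls_minimizer xi p.

End moving_least_squares.

(* The samples [X] for which the error of order [k - m] is exceeded at [xhat],
   including those for which the derivatives at [xhat] of the approximation
   are not defined.  This set need not be known to be measurable, whence the use
   of the outer measure [mu_ext P], which extends [P], for its probability. *)
Definition mls_failure {R : realType} {d : nat} (Omega : set 'rV[R]_d)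
    (k m : nat) (Phi f : 'rV[R]_d -> R) (q : mpoly.multinom d -> R)
    (xhat : 'rV[R]_d) (K : R) n (X : 'I_n -> 'rV[R]_d) : Prop :=
  let h := fill_distance Omega X in
  ~ mls_defined_near k Phi f h X xhat \/
  K * h ^+ (k - m) <=
    `|diffop m q (mls k Phi f h X) xhat - diffop m q f xhat|.

(* Main.v *)
(* With L = ln n and tau ^ d = L / n, the fill distance h is comparable to tau
   outside an event of probability O(n ^ -c).  It is at most a multiple of tau
   because every cell of a grid of mesh A tau contained in Omega is hit (union
   bound), and at least a multiple of tau because, among about n / L disjoint
   cells of radius c0 tau, the number of those that are missed is positive (second
   moment method).  Moreover, by Chernoff bounds, the ball carrying the weights
   around xhat contains at most C1 L points, while each of k ^ d small cells in the
   cone at xhat, chosen so that a polynomial of degree < k is controlled by its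
   values at one arbitrary point per cell, contains at least c1 L of them.  So the
   support of the weight catches about ln n points, however small s is.

   On the complement, the Gram matrix G of the weighted least squares problem, in
   the monomials in (x - xhat) / t with t comparable to h, is bounded below by a
   multiple of L, and its derivatives of order j are bounded by a multiple of
   L / t ^ j.  If T is the Taylor polynomial of f at xhat, the coefficients e of
   p_xi - T solve G e = eps, where eps is made of the residuals f - T and has
   derivatives O(L t ^ (k - j)); differentiating this system, the derivatives of e
   are O(t ^ (k - j)), whence the bound on Q s - Q f = Q (s - T) at xhat. *)
Require Import Defs.
From mathcomp Require Import all_boot all_order all_algebra perm.
From mathcomp Require Import all_classical all_reals all_analysis.
From mathcomp Require Import measurable_realfun.
From mathcomp Require Import ring lra.

Set Implicit Arguments.
Unset Strict Implicit.
Unset Printing Implicit Defensive.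

Import Order.TTheory GRing.Theory Num.Theory.
Import numFieldNormedType.Exports.
Local Open Scope classical_set_scope.
Local Open Scope ring_scope.

(** * Bounds on iterated partial derivatives *)

(** The fill distance only promises one sample point within [h] of [xhat], while the weight sees
    radius [s * h] with [s] arbitrary, so no deterministic argument bounds the Gram matrix from
    below. What helps is that [h] is a supremum over all of [Omega]: among about n / ln n cells some
    stay empty until the expected count per cell is of order ln n, whereas a fixed ball of that size
    holds about ln n points, up to deviations of probability exponentially small in ln n. Hence the
    lower bound on [h], and a failure rate that is a power of n.

    Since [h] depends on the same sample, independence is only applied to cells and balls fixed
    beforehand at the deterministic scale [t], with t <= h <= C0 * t. The number of active points is
    unbounded, but upper and lower counts are multiples of the same L, and only their ratio enters
    the constants.

    The point [xhat] being fixed, finitely many Chernoff bounds with any positive exponent suffice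
    there; the union bound over a whole grid must instead beat the number of cells, which is the
    purpose of the constant [A]. *)

Section derivative_bounds.
Context {R : realType} {d : nat}.
Local Notation V := 'rV[R]_d.
Implicit Types (g : V -> R) (x : V).

(* Near [x0], the partial derivatives of [g] of each order [i <= j] exist and
   are bounded by [A / tau ^+ i]: the size of a [C^j] function of magnitude [A]
   varying on the length scale [tau]. *)
Fixpoint deriv_bound (tau : R) (x0 : V) (j : nat) (A : R) g : Prop :=
  (\forall x \near x0, `|g x| <= A) /\
  if j is j'.+1 then
    forall i, (\forall x \near x0, derivable g x (delta_mx 0 i)) /\
              deriv_bound tau x0 j' (A / tau) (partial i g)
  else True.

Variables (tau : R) (x0 : V).
Hypothesis tau_gt0 : 0 < tau.
Local Notation DB := (deriv_bound tau x0).

Lemma near_eq_partial (g g' : V -> R) i :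
  (\forall x \near x0, g x = g' x) ->
  \forall x \near x0, partial i g x = partial i g' x.
Proof.
move=> gg'; near=> x; apply: near_eq_derive; near: x; exact: (near_join gg').
Unshelve. all: by end_near. Qed.

Lemma deriv_bound_near j A g g' :
  (\forall x \near x0, g x = g' x) -> DB j A g -> DB j A g'.
Proof.
have near_le B (h h' : V -> R) : (\forall x \near x0, h x = h' x) ->
    (\forall x \near x0, `|h x| <= B) -> \forall x \near x0, `|h' x| <= B.
  by apply: filterS2 => x ->.
elim: j A g g' => [|j IH] A g g' gg' /= [gA Hg]; split => //;
  first exact: near_le gg' gA.
  exact: near_le gg' gA.
move=> i; have [dg Hi] := Hg i; split; last first.
  by apply: IH Hi; exact: near_eq_partial.
near=> x; apply: near_eq_derivable (_ : derivable g x _); last by near: x.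
by near: x; exact: (near_join gg').
Unshelve. all: by end_near. Qed.

Lemma deriv_bound_le j A B g : A <= B -> DB j A g -> DB j B g.
Proof.
elim: j A B g => [|j IH] A B g AB /= [gA Hg]; split => //.
- by apply: filterS gA => x /le_trans; exact.
- by apply: filterS gA => x /le_trans; exact.
- move=> i; have [dg Hi] := Hg i; split => //; apply: IH Hi.
  by rewrite ler_pM2r// invr_gt0.
Qed.

Lemma deriv_bound0 j A g : DB j A g -> \forall x \near x0, `|g x| <= A.
Proof. by case: j => [|j] []. Qed.

Lemma deriv_bound_pred j A g : DB j.+1 A g -> DB j A g.
Proof.
elim: j A g => [|j IH] A g /= [gA Hg]; split => // i.
by have [dg Hi] := Hg i; split => //; exact: IH.
Qed.

Lemma deriv_bound_leq j j' A g : (j <= j')%N -> DB j' A g -> DB j A g.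
Proof.
move=> /subnK <-; elim: (j' - j)%N => [|e IH] //.
by rewrite addSn => /deriv_bound_pred.
Qed.

Lemma deriv_bound_ge0 j A g : DB j A g -> 0 <= A.
Proof. by move=> /deriv_bound0 /nbhs_singleton; exact: le_trans. Qed.

Lemma partial_cst i (c : R) : partial i (cst c : V -> R) = cst 0.
Proof. by apply/funext => x; rewrite /partial derive_cst. Qed.

Lemma deriv_bound_cst j A c : `|c| <= A -> DB j A (cst c).
Proof.
elim: j A c => [|j IH] A c cA /=; split => //; first by near=> x.
  by near=> x.
move=> i; split; first by near=> x; exact: derivable_cst.
rewrite partial_cst; apply: IH.
by rewrite normr0 divr_ge0 // ?(le_trans _ cA)// ltW.
Unshelve. all: by end_near. Qed.

Lemma deriv_boundD j A B g g' :
  DB j A g -> DB j B g' -> DB j (A + B) (fun x => g x + g' x).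
Proof.
have nD C D (h h' : V -> R) : (\forall x \near x0, `|h x| <= C) ->
    (\forall x \near x0, `|h' x| <= D) ->
    \forall x \near x0, `|h x + h' x| <= C + D.
  by apply: filterS2 => x hC hD; rewrite (le_trans (ler_normD _ _))// lerD.
elim: j A B g g' => [|j IH] A B g g' /= [gA Hg] [gB Hg']; split => //;
  try exact: nD.
move=> i; have [dg Hi] := Hg i; have [dg' Hi'] := Hg' i; split.
  by apply: filterS2 dg dg' => x; exact: (@derivableD _ _ _ g g').
rewrite mulrDl; apply: deriv_bound_near (IH _ _ _ _ Hi Hi').
by apply: filterS2 dg dg' => x dx dx'; exact/esym/(@deriveD _ _ _ g g').
Qed.

(** Every differentiation replaces a product by two, each of size [A * B / tau], whence the factor
    [2 ^+ j]. *)
Lemma deriv_boundM j A B g g' :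
  DB j A g -> DB j B g' -> DB j (2 ^+ j * (A * B)) (fun x => g x * g' x).
Proof.
have nM C D (h h' : V -> R) : (\forall x \near x0, `|h x| <= C) ->
    (\forall x \near x0, `|h' x| <= D) ->
    \forall x \near x0, `|h x * h' x| <= C * D.
  by apply: filterS2 => x hC hD; rewrite normrM ler_pM.
elim: j A B g g' => [|j IH] A B g g' H1 H2.
  rewrite expr0 mul1r; split => //=.
  by apply: nM; [exact: deriv_bound0 H1|exact: deriv_bound0 H2].
have A0 := deriv_bound_ge0 H1; have B0 := deriv_bound_ge0 H2.
have H1' := deriv_bound_pred H1; have H2' := deriv_bound_pred H2.
case: H1 => gA Hg; case: H2 => gB Hg'; split.
  have := nM _ _ _ _ gA gB; apply: filterS => x /le_trans; apply.
  by rewrite ler_peMl ?mulr_ge0// exprn_ege1// ler1n.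
move=> i; have [dg Hi] := Hg i; have [dg' Hi'] := Hg' i; split.
  by apply: filterS2 dg dg' => x; exact: (@derivableM _ _ g g').
rewrite (_ : _ / tau = 2 ^+ j * (A * (B / tau)) + 2 ^+ j * (B * (A / tau)));
  last by rewrite exprS; ring.
apply: deriv_bound_near (deriv_boundD (IH _ _ _ _ H1' Hi') (IH _ _ _ _ H2' Hi)).
by apply: filterS2 dg dg' => x dx dx'; exact/esym/(@deriveM _ _ g g').
Qed.

Lemma deriv_boundZ j A c g : DB j A g -> DB j (`|c| * A) (fun x => c * g x).
Proof.
elim: j A g => [|j IH] A g /= [gA Hg].
  split => //; apply: filterS gA => x gx.
  by rewrite normrM ler_wpM2l.
split.
  by apply: filterS gA => x gx; rewrite normrM ler_wpM2l.
move=> i; have [dg Hi] := Hg i; split.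
  by apply: filterS dg => x; exact: (@derivableZ _ _ _ g c).
rewrite -mulrA; apply: deriv_bound_near (IH _ _ Hi).
by near=> x; rewrite /partial; apply/esym/(@deriveZ _ _ _ g c); near: x.
Unshelve. all: by end_near. Qed.

Lemma deriv_boundB j A B g g' :
  DB j A g -> DB j B g' -> DB j (A + B) (fun x => g x - g' x).
Proof.
move=> H1 /(deriv_boundZ (-1)); rewrite normrN1 mul1r => /(deriv_boundD H1).
by under eq_fun do rewrite mulN1r.
Qed.

Lemma deriv_bound_sum (I : Type) (r : seq I) (Q : pred I) j (A : I -> R)
    (u : I -> V -> R) :
  (forall i, Q i -> DB j (A i) (u i)) ->
  DB j (\sum_(i <- r | Q i) A i) (fun x => \sum_(i <- r | Q i) u i x).
Proof.
move=> H; elim: r => [|a r IH].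
  rewrite big_nil (_ : (fun x => _) = cst 0).
    by apply: deriv_bound_cst; rewrite normr0.
  by apply/funext => x; rewrite big_nil.
rewrite big_cons; case: ifPn => Qa.
  rewrite (_ : (fun x => _) =
    (fun x => u a x + \sum_(i <- r | Q i) u i x)).
    by apply: deriv_boundD => //; exact: H.
  by apply/funext => x; rewrite big_cons Qa.
rewrite (_ : (fun x => _) = (fun x => \sum_(i <- r | Q i) u i x))//.
by apply/funext => x; rewrite big_cons (negbTE Qa).
Qed.

Lemma deriv_bound_prod (I : Type) (r : seq I) j (u : I -> V -> R) :
  (forall i, exists A, DB j A (u i)) ->
  exists A, DB j A (fun x => \prod_(i <- r) u i x).
Proof.
move=> H; elim: r => [|a r [A IH]].
  exists 1; rewrite (_ : (fun x => _) = cst 1).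
    by apply: deriv_bound_cst; rewrite normr1.
  by apply/funext => x; rewrite big_nil.
have [B HB] := H a; exists (2 ^+ j * (B * A)).
rewrite (_ : (fun x => _) = (fun x => u a x * \prod_(i <- r) u i x)).
  exact: deriv_boundM.
by apply/funext => x; rewrite big_cons.
Qed.

(** Induction on the order through the derivative - g' / g ^ 2. The bound is left unspecified: the
    lemma serves to differentiate inverse determinants, and the sharp bounds come from
    [linear_solve_bound]. *)
Lemma deriv_boundV j A c g : 0 < c -> (\forall x \near x0, c <= `|g x|) ->
  DB j A g -> exists B, DB j B (fun x => (g x)^-1).
Proof.
move=> c0 cg.
have nV : \forall x \near x0, `|(g x)^-1| <= c^-1.
  apply: filterS cg => x cx; rewrite normfV lef_pV2 ?posrE//.
  exact: lt_le_trans cx.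
elim: j A => [|j IH] A gA; first by exists c^-1.
have [B HB] := IH _ (deriv_bound_pred gA).
case: gA => gA Hg.
(* The final factor [tau] makes [C / tau] the bound that the product rule gives for the
   derivative. *)
pose C := 2 ^+ j * (1 * (2 ^+ j * (B * B)) * (A / tau)) * tau.
have C0 i : DB j (C / tau) (partial i (fun x => (g x)^-1)).
  have [dg Hi] := Hg i.
  have := deriv_boundM (deriv_boundZ (-1) (deriv_boundM HB HB)) Hi.
  rewrite normrN1 /C mulfK ?gt_eqF//; apply: deriv_bound_near; near=> x.
  rewrite /partial (@deriveV _ _ g); last by near: x.
    by rewrite mulN1r expr2 invfM.
  by rewrite -normr_gt0 (lt_le_trans c0)//; near: x.
exists (Num.max c^-1 C); split.
  by apply: filterS nV => x /le_trans; apply; rewrite le_max lexx.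
move=> i; split.
  have [dg Hi] := Hg i.
  near=> x; apply: (@derivableV _ _ g); last by near: x.
  by rewrite -normr_gt0 (lt_le_trans c0)//; near: x.
apply: deriv_bound_le (C0 i); rewrite ler_pM2r ?invr_gt0//.
by rewrite le_max lexx orbT.
Unshelve. all: by end_near. Qed.

Lemma deriv_bound_foldr (w : seq 'I_d) j A g : DB (size w + j) A g ->
  DB j (A / tau ^+ size w) (foldr partial g w).
Proof.
elim: w j A => [|a w IH] j A; first by rewrite expr0 divr1.
rewrite [size _]/= addSnnS => /IH /= [_ /(_ a) [_]].
by rewrite exprSr invfM mulrA.
Qed.

Lemma foldr_partialD (w : seq 'I_d) A B g g' :
  DB (size w) A g -> DB (size w) B g' ->
  \forall x \near x0, foldr partial (fun x => g x + g' x) w x =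
    foldr partial g w x + foldr partial g' w x.
Proof.
elim: w A B => [|a w IH] A B Hg Hg'; first by near=> x.
have /(near_eq_partial a) E := IH _ _ (deriv_bound_pred Hg) (deriv_bound_pred Hg').
have dw C h : DB (size (a :: w)) C h ->
    \forall x \near x0, derivable (foldr partial h w) x (delta_mx 0 a).
  by rewrite [size _]/= -addn1 => /deriv_bound_foldr [_ /(_ a) []].
apply: filterS3 E (dw _ _ Hg) (dw _ _ Hg') => x /= -> dg dg'.
exact: (@deriveD _ _ _ (foldr partial g w) (foldr partial g' w)).
Unshelve. all: by end_near. Qed.

End derivative_bounds.

Section mpartial_bounds.
Context {R : realType} {d : nat}.
Local Notation V := 'rV[R]_d.
Variables (tau : R) (x0 : V).
Hypothesis tau_gt0 : 0 < tau.
Local Notation DB := (deriv_bound tau x0).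

(** The directions of [mpartial] spelled out as one word, so that estimates go by induction on a
    list instead of on nested iterations. *)
Definition mword (alpha : mpoly.multinom d) : seq 'I_d :=
  flatten [seq nseq (alpha i) i | i <- enum 'I_d].

Lemma size_mword alpha : size (mword alpha) = mpoly.mdeg alpha.
Proof.
rewrite size_flatten /shape -map_comp mpoly.mdegE sumnE big_map big_enum /=.
by apply: eq_bigr => i _; rewrite size_nseq.
Qed.

Lemma mpartialE alpha (g : V -> R) :
  mpartial alpha g = foldr partial g (mword alpha).
Proof.
rewrite /mpartial /mword; elim: (enum 'I_d) => //= i l ->.
rewrite foldr_cat; move: (foldr _ g _) => h.
by elim: (alpha i) => //= n ->.
Qed.

Lemma mpartial_near alpha (g g' : V -> R) :
  (\forall x \near x0, g x = g' x) -> mpartial alpha g x0 = mpartial alpha g' x0.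
Proof.
move=> gg'; rewrite !mpartialE.
suff /nbhs_singleton : \forall x \near x0,
  foldr partial g (mword alpha) x = foldr partial g' (mword alpha) x by [].
elim: (mword alpha) => //= a w; exact: near_eq_partial.
Qed.

Lemma mpartial_le alpha j A (g : V -> R) : (mpoly.mdeg alpha <= j)%N ->
  DB j A g -> `|mpartial alpha g x0| <= A / tau ^+ mpoly.mdeg alpha.
Proof.
move=> aj /(deriv_bound_leq aj); rewrite -size_mword -[size _]addn0.
move=> /deriv_bound_foldr /deriv_bound0 /nbhs_singleton.
by rewrite mpartialE addn0.
Qed.

Lemma mpartialD alpha j A B (g g' : V -> R) : (mpoly.mdeg alpha <= j)%N ->
  DB j A g -> DB j B g' ->
  mpartial alpha (fun x => g x + g' x) x0 =
    mpartial alpha g x0 + mpartial alpha g' x0.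
Proof.
move=> aj /(deriv_bound_leq aj) + /(deriv_bound_leq aj); rewrite -size_mword.
move=> Hg Hg'; rewrite !mpartialE.
exact: nbhs_singleton (foldr_partialD Hg Hg').
Qed.

End mpartial_bounds.

(** * One-variable calculus along lines *)

Section line_restriction.
Context {R : realType} {d : nat}.
Local Notation V := 'rV[R]_d.
Implicit Types (g : V -> R) (x v : V).

Lemma is_derive_line g x v (t : R) : derivable g (t *: v + x) v ->
  is_derive t 1 (fun r : R => g (r *: v + x)) ('D_v g (t *: v + x)).
Proof.
have E : (fun h : R => h^-1 *: ((g \o shift (t *: v + x)) (h *: v) -
    g (t *: v + x))) =
  (fun h : R => h^-1 *: (((fun r : R => g (r *: v + x)) \o shift t) (h *: 1) -
    g (t *: v + x))).
  by apply/funext => h /=; rewrite [_%:A]mulr1 scalerDl addrA.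
by move=> dg; split; rewrite ?/derivable ?/derive -E.
Qed.

Lemma derive_line_MVT g x v (t M : R) :
  (forall r : R, `|r| <= `|t| -> derivable g (r *: v + x) v) ->
  (forall r : R, `|r| <= `|t| -> `|'D_v g (r *: v + x)| <= M) ->
  `|g (t *: v + x) - g x| <= M * `|t|.
Proof.
move=> dg gM.
pose phi (r : R) := g (r *: v + x).
have phid (r : R) : `|r| <= `|t| -> is_derive r 1 phi ('D_v g (r *: v + x)).
  by move=> rt; exact/is_derive_line/dg.
have mvt (a b : R) : a <= b -> `|a| <= `|t| -> `|b| <= `|t| ->
    `|phi b - phi a| <= M * (b - a).
  move=> ab at' bt.
  have ct (r : R) : r \in `[a, b]%R -> `|r| <= `|t|.
    rewrite in_itv /= => /andP[ar rb]; move: at' bt; rewrite !ler_norml.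
    by move=> /andP[+ _] /andP[_ +] => /le_trans -> //= /(le_trans rb).
  have [||c cab ->] := @MVT_segment _ phi (fun r => 'D_v g (r *: v + x)) _ _ ab.
  - by move=> r rab; apply/phid/ct; exact: subset_itv_oo_cc.
  - apply: derivable_within_continuous => r rab.
    by have [] := phid _ (ct _ rab).
  - by rewrite normrM (ger0_norm (_ : 0 <= b - a)) ?subr_ge0// ler_wpM2r ?subr_ge0// gM// ct.
have phi0 : phi 0 = g x by rewrite /phi scale0r add0r.
rewrite -phi0; case: (leP 0 t) => t0.
  by have := mvt 0 t t0; rewrite normr0 normr_ge0 lexx subr0 (ger0_norm t0); apply.
have := mvt t 0 (ltW t0); rewrite normr0 normr_ge0 lexx sub0r distrC.
by rewrite (ltr0_norm t0); apply.
Qed.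

(** Only directional derivability is assumed, and it does not compose in general. An affine scaling
    sends lines of direction [v] to lines of direction [v], so the chain rule in one variable is
    enough. *)
Lemma is_derive_affine g (X x v : V) (c : R) : derivable g (c *: (x - X)) v ->
  is_derive x v (fun y => g (c *: (y - X))) (c * 'D_v g (c *: (x - X))).
Proof.
move=> dg.
pose psi (r : R) := g (r *: v + c *: (x - X)).
have dpsi : is_derive (c * 0) 1 psi ('D_v g (c *: (x - X))).
  have := @is_derive_line g (c *: (x - X)) v (c * 0).
  by rewrite mulr0 scale0r add0r; exact.
have dc : is_derive (0 : R) 1 (fun r : R => c * r) c.
  by apply: is_derive_eq; rewrite [_ *: _]mulr1.
have E : (fun r : R => g (c *: (r *: v + x - X))) = psi \o (fun r => c * r).
  by apply/funext => r; rewrite /psi /= -addrA scalerDr scalerA.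
have dcomp : is_derive (0 : R) 1 (fun r : R => g (c *: (r *: v + x - X)))
    (c * 'D_v g (c *: (x - X))).
  rewrite E; split.
    apply/derivable1_diffP/differentiable_comp; apply/derivable1_diffP.
      by case: dc.
    by case: dpsi.
  rewrite -derive1E derive1_comp; [|by case: dc|by case: dpsi].
  rewrite !derive1E mulrC.
  by case: dc => _ ->; case: dpsi => _ ->.
have E2 : (fun h : R => h^-1 *: (((fun y => g (c *: (y - X))) \o shift x)
      (h *: v) - g (c *: (x - X)))) =
  (fun h : R => h^-1 *: (((fun r : R => g (c *: (r *: v + x - X))) \o shift 0)
      (h *: 1) - g (c *: (0 *: v + x - X)))).
  by apply/funext => h /=; rewrite [_%:A]mulr1 addr0 scale0r add0r.
case: dcomp; rewrite /derivable /derive -E2 => d1 d2.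
exact: DeriveDef.
Qed.

End line_restriction.

Section Ck_bounds.
Context {R : realType} {d : nat}.
Local Notation V := 'rV[R]_d.
Implicit Types (g : V -> R).

Lemma continuous_bounded_ball g (x0 : V) (rho : R) : continuous g ->
  exists2 M, 0 <= M & forall x, `|x - x0| <= rho -> `|g x| <= M.
Proof.
move=> cg.
pose B := closed_ball_ (fun x : V => `|x|) x0 rho.
have cB : compact B.
  apply: bounded_closed_compact; last exact: closed_closed_ball_.
  exists (`|x0| + rho); split; first exact: num_real.
  move=> M Mx x /= xB; apply: (le_trans _ (ltW Mx)).
  rewrite -[x](subrK x0) addrC (le_trans (ler_normD _ _))// lerD2l//.
  by rewrite distrC.
have /compact_bounded[M [Mr HM]] : compact (g @` B).
  by apply: continuous_compact => //; exact: continuous_subspaceT.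
exists (`|M| + 1) => // x xB; apply: HM; last first.
  by exists x => //; rewrite /B /closed_ball_ /= distrC.
by rewrite (le_lt_trans (ler_norm _))// ltrDl.
Qed.

(** The bound is uniform over base points in a ball because the weight is expanded at rescaled
    points that depend on the sample and the bandwidth. Enlarging the radius by 1 leaves room for a
    neighbourhood of each base point. *)
Lemma Ck_deriv_bound j g (rho : R) : Ck j g ->
  exists2 M, 0 <= M & forall x0 : V, `|x0| <= rho -> deriv_bound 1 x0 j M g.
Proof.
elim: j g => [|j IH] g /= [cg dg].
all: have [M0 M00 HM0] := continuous_bounded_ball 0 (rho + 1) cg.
all: have near_le x0 (x0rho : `|x0 : V| <= rho) : \forall x \near x0, `|g x| <= M0.
  all: try (near=> x; apply: HM0; rewrite subr0 -[x](subrK x0) addrC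
        (le_trans (ler_normD _ _))// lerD// distrC;
      near: x; apply/nbhs_normP; exists 1 => //= y /= /ltW //).
- by exists M0 => // x0 x0r; split => //; exact: near_le.
- have /choice[M HM] : forall i, exists M, forall x0 : V, `|x0| <= rho ->
      deriv_bound 1 x0 j M (partial i g).
    by move=> i; have [M _ HM] := IH _ (dg i).2; exists M.
  exists (M0 + \sum_i `|M i|); first by rewrite addr_ge0// sumr_ge0.
  move=> x0 x0r; split.
    by apply: filterS (near_le _ x0r) => x /le_trans; apply; rewrite lerDl sumr_ge0.
  move=> i; split; first by near=> x; exact: (dg i).1.
  rewrite divr1; apply: deriv_bound_le (HM i _ x0r) => //.
  rewrite (bigD1 i)//= addrCA (le_trans (ler_norm _))// lerDl addr_ge0//.
  exact: sumr_ge0.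
Unshelve. all: by end_near. Qed.

(** Each derivative of the rescaled function gains a factor [h^-1], which is at most [tau^-1]. *)
Lemma deriv_bound_affine (tau h M : R) (x0 X : V) j g : 0 < tau -> tau <= h ->
  deriv_bound 1 (h^-1 *: (x0 - X)) j M g ->
  deriv_bound tau x0 j M (fun x => g (h^-1 *: (x - X))).
Proof.
move=> tau0 tauh.
have aff (Q : V -> Prop) : (\forall u \near h^-1 *: (x0 - X), Q u) ->
    \forall x \near x0, Q (h^-1 *: (x - X)).
  apply: (_ : {for x0, continuous (fun x : V => h^-1 *: (x - X))}).
  by apply: continuousZl_tmp; apply: (@continuousB _ _ _ id (cst X)) => //; exact: cst_continuous.
elim: j M g => [|j IH] M g H.
  by split => //; apply: (aff (fun u => `|g u| <= M)); exact: deriv_bound0 H.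
have M0 := deriv_bound_ge0 H; case: H => gM dg.
split; first exact: (aff (fun u => `|g u| <= M)).
move=> i; have [di Hi] := dg i.
have {}di : \forall x \near x0, derivable g (h^-1 *: (x - X)) (delta_mx 0 i).
  exact: (aff (fun u => derivable g u _)).
split.
  by apply: filterS di => x /(@is_derive_affine _ _ g X) [].
rewrite divr1 in Hi.
have h0 : 0 < h := lt_le_trans tau0 tauh.
apply: (@deriv_bound_le _ _ _ _ tau0 _ (`|h^-1| * M)).
  by rewrite mulrC ler_wpM2l// gtr0_norm ?invr_gt0// lef_pV2 ?posrE.
have Hc := deriv_boundZ h^-1 (IH _ _ Hi).
apply: (deriv_bound_near _ Hc).
apply: filterS di => x /(@is_derive_affine _ _ g X) [_ E].
by rewrite [RHS]E.
Qed.

End Ck_bounds.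

(** * Taylor expansion *)

Section sup_norm.
Context {R : realType} {d : nat}.
Local Notation V := 'rV[R]_d.
Implicit Types x : V.

Lemma norm_coord x j : `|x 0 j| <= `|x|.
Proof.
rewrite [X in _ <= X]mx_normrE.
exact: (le_bigmax _ (fun ij : 'I_1 * 'I_d => `|x ij.1 ij.2|) (0, j)).
Qed.

Lemma norm_rV_le x (r : R) : 0 <= r -> (forall j, `|x 0 j| <= r) -> `|x| <= r.
Proof.
move=> r0 xr; rewrite [X in X <= _]mx_normrE; apply/bigmax_leP; split => // -[i j] _ /=.
by rewrite ord1.
Qed.

End sup_norm.

Section taylor.
Context {R : realType} {d : nat}.
Local Notation V := 'rV[R]_d.
Implicit Types (g : V -> R).

(* Moving the coordinates of [l] from those of [x0] to those of [x], the last
   one first, only meets iterated derivatives in the order in which [mpartial]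
   takes them, so that no symmetry of second derivatives is needed. *)
Lemma taylor_vanish (l : seq 'I_d) k g (x0 : V) : uniq l -> Ck k g ->
  (forall a : 'I_d -> nat, (\sum_(i <- l) a i < k)%N ->
    foldr (fun i => iter (a i) (partial i)) g l x0 = 0) ->
  exists2 C, 0 <= C & forall x, `|x - x0| <= 1 ->
    (forall i, i \notin l -> x 0 i = x0 0 i) -> `|g x| <= C * `|x - x0| ^+ k.
Proof.
elim/last_ind: l k g => [|l i IHl] k g.
  move=> _ _ g0; case: k g0 => [|k] g0.
    exists `|g x0| => // x _ xx0; rewrite mulr1.
    by rewrite (_ : x = x0)//; apply/rowP => i; exact: xx0.
  exists 0 => // x _ xx0; rewrite mul0r (_ : x = x0).
    by have := g0 (fun=> 0%N); rewrite big_nil /= => ->//; rewrite normr0.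
  by apply/rowP => i; exact: xx0.
rewrite rcons_uniq => /andP[il ul].
elim: k g => [|k IHk] g.
  move=> [cg _] _; have [M M0 HM] := continuous_bounded_ball x0 1 cg.
  by exists M => // x x1 _; rewrite mulr1 HM.
move=> gC g0.
(* As [i] comes last in the list it is differentiated first: raising its exponent by one turns the
   vanishing for [g] below order [k.+1] into vanishing for [partial i g] below order [k]. *)
have [Ci Ci0 HCi] : exists2 C, 0 <= C & forall x, `|x - x0| <= 1 ->
    (forall j, j \notin rcons l i -> x 0 j = x0 0 j) ->
    `|partial i g x| <= C * `|x - x0| ^+ k.
  apply: IHk; first by case: gC => _ /(_ i) [].
  move=> a ak; pose a' j := if j == i then (a i).+1 else a j.
  have a'l : forall j, j \in l -> a' j = a j.
    by move=> j jl; rewrite /a'; case: eqP => // ji; rewrite -ji jl in il.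
  have a'i : a' i = (a i).+1 by rewrite /a' eqxx.
  have := g0 a'; rewrite -!cats1 !foldr_cat /= a'i iterSr => <-.
    congr (_ x0); elim: (l) a'l => //= j l' IH a'l.
    rewrite a'l ?mem_head// IH// => j' j'l; apply: a'l.
    by rewrite inE j'l orbT.
  move: ak; rewrite -!cats1 !big_cat !big_seq1 /= a'i addnS ltnS.
  by rewrite (eq_big_seq _ a'l).
(* Where coordinate [i] is frozen as well, multi-indices with exponent 0 at [i] suffice, and the
   shorter list applies at full order. *)
have [Cl Cl0 HCl] : exists2 C, 0 <= C & forall x, `|x - x0| <= 1 ->
    (forall j, j \notin l -> x 0 j = x0 0 j) ->
    `|g x| <= C * `|x - x0| ^+ k.+1.
  apply: IHl => // a ak; pose a' j := if j == i then 0%N else a j.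
  have a'l : forall j, j \in l -> a' j = a j.
    by move=> j jl; rewrite /a'; case: eqP => // ji; rewrite -ji jl in il.
  have a'i : a' i = 0%N by rewrite /a' eqxx.
  have := g0 a'; rewrite -!cats1 !foldr_cat /= a'i => <-.
    congr (_ x0); elim: (l) a'l => //= j l' IH a'l.
    rewrite a'l ?mem_head// IH// => j' j'l; apply: a'l.
    by rewrite inE j'l orbT.
  by rewrite !big_cat !big_seq1 /= a'i addn0 (eq_big_seq _ a'l).
exists (Ci + Cl); first exact: addr_ge0.
move=> x x1 xx0.
(* The point [x'] shares coordinate [i] with [x0]. The mean value theorem covers the segment from
   [x'] to [x], and the shorter list covers [x']. *)
pose t := x 0 i - x0 0 i; pose x' : V := x - t *: delta_mx 0 i.
have xE : x = t *: delta_mx 0 i + x' by rewrite addrC subrK.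
have x'E (r : R) j : (r *: delta_mx 0 i + x' - x0) 0 j =
    if j == i then r else x 0 j - x0 0 j.
  rewrite !mxE eqxx /=; case: eqP => [->|_] /=; last by rewrite !mulr0; ring.
  by rewrite !mulr1 /t; ring.
have x'le (r : R) : `|r| <= `|t| -> `|r *: delta_mx 0 i + x' - x0| <= `|x - x0|.
  move=> rt; apply: norm_rV_le => // j; rewrite x'E; case: eqP => [_|_].
    by apply: (le_trans rt); have := norm_coord (x - x0) i; rewrite !mxE.
  by have := norm_coord (x - x0) j; rewrite !mxE.
have x'out (r : R) j : j \notin rcons l i ->
    (r *: delta_mx 0 i + x') 0 j = x0 0 j.
  move=> jl; have := x'E r j; case: eqP => [ji|_].
    by rewrite ji mem_rcons mem_head in jl.
  by rewrite xx0// subrr !mxE => /eqP; rewrite subr_eq0 => /eqP.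
have tx : `|t| <= `|x - x0| by have := norm_coord (x - x0) i; rewrite !mxE.
rewrite (_ : g x = (g x - g x') + g x'); last by rewrite subrK.
apply: (le_trans (ler_normD _ _)); rewrite mulrDl lerD//.
  rewrite {1}xE; apply: (le_trans (@derive_line_MVT _ _ _ _ _ _
      (Ci * `|x - x0| ^+ k) _ _)).
  - by move=> r _; case: gC => _ /(_ i) [].
  - move=> r rt; apply: (le_trans (HCi _ _ (x'out r))).
      exact: le_trans (x'le _ rt) x1.
    by rewrite ler_wpM2l// lerXn2r ?nnegrE// x'le.
  - by rewrite exprSr mulrA ler_wpM2l// mulr_ge0.
have x'0 : x' = 0 *: delta_mx 0 i + x' by rewrite scale0r add0r.
apply: (le_trans (HCl _ _ _)).
- by rewrite x'0 (le_trans _ x1)// x'le// normr0.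
- move=> j jl; have [->|ji] := eqVneq j i.
    by rewrite !mxE !eqxx /= mulr1 /t; ring.
  by rewrite x'0 x'out// mem_rcons inE negb_or ji.
- by rewrite ler_wpM2l// lerXn2r ?nnegrE// x'0 x'le// normr0.
Qed.

Lemma taylor_vanish_mpartial k g (x0 : V) : Ck k g ->
  (forall alpha, (mpoly.mdeg alpha < k)%N -> mpartial alpha g x0 = 0) ->
  exists2 C, 0 <= C & forall x, `|x - x0| <= 1 -> `|g x| <= C * `|x - x0| ^+ k.
Proof.
move=> gC g0; have [|C C0 HC] := @taylor_vanish (enum 'I_d) k g x0 (enum_uniq _) gC.
  move=> a ak; pose alpha : mpoly.multinom d := mpoly.Multinom [tuple a i | i < d].
  have aE i : alpha i = a i by rewrite mpoly.multinomE tnth_mktuple.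
  have := g0 alpha; rewrite /mpartial mpoly.mdegE => <-.
    congr (_ x0); elim: (enum _) => //= i l ->; by rewrite aE.
  by under eq_bigr do rewrite aE; rewrite -big_enum.
by exists C => // x x1; apply: HC => // i; rewrite mem_enum.
Qed.

End taylor.

(** * Polynomials in local coordinates *)

Section polynomials.
Context {R : realType} {d : nat}.
Local Notation V := 'rV[R]_d.
Local Notation poly_ := (mpoly.mpoly d R).
Local Notation msize p := (mpoly.mmeasure mpoly.mdeg p).
Implicit Types (p : poly_) (u x : V).

Definition monomial (beta : mpoly.multinom d) u : R :=
  \prod_(i < d) u 0 i ^+ beta i.

Lemma meval_monomial k p u : (msize p <= k)%N ->
  mpoly.meval (u 0) p =
  \sum_(beta : mpoly.bmultinom d k) mpoly.mcoeff beta p * monomial beta u.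
Proof. exact: (@mpoly.mmapE _ _ _ (u 0) idfun p k). Qed.

Lemma mpoly_of_coeff k (c : mpoly.bmultinom d k -> R) : exists p,
  [/\ (msize p <= k)%N, forall beta, mpoly.mcoeff (mpoly.bmnm beta) p = c beta &
      forall u, mpoly.meval (u 0) p = \sum_beta c beta * monomial beta u].
Proof.
pose p : poly_ := \sum_(beta : mpoly.bmultinom d k) c beta *: mpoly.mpolyX R beta.
have pk : (msize p <= k)%N.
  apply: (leq_trans (mpoly.mmeasure_sum _ _ _ _)); apply/bigmax_leqP => b _.
  apply: (leq_trans (mpoly.mmeasureZ_le _ _ _)).
  by rewrite mpoly.mmeasureX mpoly.bmdeg.
have pc beta : mpoly.mcoeff (mpoly.bmnm beta) p = c beta.
  rewrite /p raddf_sum /= (bigD1 beta)//= big1 ?addr0.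
    by rewrite mpoly.mcoeffZ mpoly.mcoeffX eqxx mulr1.
  move=> b bb; rewrite mpoly.mcoeffZ mpoly.mcoeffX -mpoly.bmeqP (negbTE bb).
  by rewrite mulr0.
exists p; split => // u; rewrite (meval_monomial _ pk).
by apply: eq_bigr => b _; rewrite pc.
Qed.

Lemma msize_mul a b p q : (msize p <= a.+1)%N -> (msize q <= b.+1)%N ->
  (msize (p * q) <= (a + b).+1)%N.
Proof.
have [->|p0] := eqVneq p 0; first by rewrite mul0r mpoly.mmeasure0.
have [->|q0] := eqVneq q 0; first by rewrite mulr0 mpoly.mmeasure0.
rewrite mpoly.msizeM// => pa qb.
by have := leq_add pa qb; rewrite addSn addnS; case: (_ + _)%N.
Qed.

Lemma msize_prod_exp (lq : 'I_d -> poly_) (e : 'I_d -> nat) :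
  (forall i, msize (lq i) <= 2)%N ->
  (msize (\prod_i lq i ^+ e i)%R <= (\sum_i e i).+1)%N.
Proof.
move=> lq2; elim/big_ind2 : _ => [|p a q b|i _].
- by rewrite mpoly.mmeasure1.
- exact: msize_mul.
- elim: (e i) => [|n IH]; first by rewrite expr0 mpoly.mmeasure1.
  by rewrite exprS; exact: (@msize_mul 1 n).
Qed.

Lemma meval_affine k p (a : V) (b : R) : (msize p <= k)%N ->
  exists p', (msize p' <= k)%N /\
    forall u, mpoly.meval (u 0) p' = mpoly.meval ((a + b *: u) 0) p.
Proof.
move=> pk.
pose q i : poly_ := mpoly.mpolyC d (a 0 i) + b *: mpoly.mpolyX R (mpoly.mnm1 i).
have q2 i : (msize (q i) <= 2)%N.
  apply: (leq_trans (mpoly.mmeasureD_le _ _ _)); rewrite geq_max.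
  rewrite mpoly.mmeasureC (leq_trans (mpoly.mmeasureZ_le _ _ _)).
    by case: eqP.
  by rewrite mpoly.mmeasureX [mpoly.Measure.sort _ _]mpoly.mdeg1.
pose lq := [tuple q i | i < d].
exists (mpoly.comp_mpoly lq p); split; last first.
  move=> u; rewrite mpoly.comp_mpoly_meval; apply: mpoly.meval_eq => i.
  rewrite tnth_mktuple mpoly.mevalD mpoly.mevalC mpoly.mevalZ mpoly.mevalXU.
  by rewrite !mxE.
rewrite (mpoly.comp_mpolywE _ pk).
apply: (leq_trans (mpoly.mmeasure_sum _ _ _ _)); apply/bigmax_leqP => m _.
apply: (leq_trans (mpoly.mmeasureZ_le _ _ _)).
under eq_bigr do rewrite tnth_mktuple.
apply: leq_trans (msize_prod_exp _ q2) _.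
by rewrite -mpoly.mdegE mpoly.bmdeg.
Qed.

(** In the variable (x - x0) / t the interpolation nodes, and with them all stability constants, no
    longer depend on [t]. *)
Definition local_poly (x0 : V) (t : R) k (c : mpoly.bmultinom d k -> R) x : R :=
  \sum_beta c beta * monomial beta (t^-1 *: (x - x0)).

Lemma local_poly_of_mpoly k p (x0 : V) (t : R) : t != 0 -> (msize p <= k)%N ->
  exists c : mpoly.bmultinom d k -> R,
    forall x, mpoly.meval (x 0) p = local_poly x0 t c x.
Proof.
move=> t0 pk; have [p' [p'k p'E]] := meval_affine x0 t pk.
exists (fun beta => mpoly.mcoeff (mpoly.bmnm beta) p') => x.
rewrite /local_poly -(meval_monomial _ p'k) p'E.
by rewrite scalerA divff// scale1r addrC subrK.
Qed.

Lemma mpoly_of_local_poly k (x0 : V) (t : R) (c : mpoly.bmultinom d k -> R) :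
  exists p, (msize p <= k)%N /\
    forall x, mpoly.meval (x 0) p = local_poly x0 t c x.
Proof.
have [p [pk _ pE]] := mpoly_of_coeff c.
have [p' [p'k p'E]] := meval_affine (- (t^-1 *: x0)) t^-1 pk.
exists p'; split => // x.
by rewrite p'E pE addrC -scalerBr.
Qed.

(* Tensor-product interpolation: with [W r] the inverse of the Vandermonde
   matrix of the nodes [a r], the coefficients of a polynomial are the values at
   the grid of nodes contracted with the tensor product of the [W r]. *)
Lemma grid_norming k (a : 'I_d -> 'I_k -> R) : (forall r, injective (a r)) ->
  exists2 C, 0 <= C & forall (c : mpoly.bmultinom d k -> R) beta,
    `|c beta| <= C * \big[Num.max/0]_(l : {ffun 'I_d -> 'I_k})
      `|\sum_gamma c gamma * monomial gamma (\row_r a r (l r))|.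
Proof.
move=> a_inj.
pose vdm r : 'M[R]_k := Vandermonde k (\row_j a r j).
have vdm_unit r : vdm r \in unitmx.
  rewrite unitmxE det_Vandermonde unitfE; apply/prodf_neq0 => i _.
  apply/prodf_neq0 => j ij; rewrite !mxE subr_eq0.
  by apply: contraTneq ij => /a_inj ->; rewrite ltnn.
pose W r := invmx (vdm r).
have WE r (i j : 'I_k) : \sum_(l < k) W r l j * a r l ^+ i = (i == j)%:R.
  have := mulmxV (vdm_unit r) => /matrixP /(_ i j); rewrite !mxE => <-.
  by apply: eq_bigr => l _; rewrite !mxE mulrC.
(* A total degree below [k] keeps each single exponent below [k], so that it indexes a row of the
   Vandermonde matrix. *)
have bk (beta : mpoly.bmultinom d k) r : (beta r < k)%N.
  apply: leq_ltn_trans (mpoly.bmdeg beta); rewrite mpoly.mdegE (bigD1 r)//=.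
  exact: leq_addr.
pose o (beta : mpoly.bmultinom d k) r := Ordinal (bk beta r).
pose w (beta : mpoly.bmultinom d k) (l : {ffun 'I_d -> 'I_k}) :=
  \prod_r W r (l r) (o beta r).
have wE (beta gamma : mpoly.bmultinom d k) :
    \sum_(l : {ffun 'I_d -> 'I_k}) w beta l * monomial gamma (\row_r a r (l r)) =
    (gamma == beta)%:R.
  transitivity (\prod_r \sum_(l < k) W r l (o beta r) * a r l ^+ gamma r).
    rewrite bigA_distr_bigA /=; apply: eq_bigr => l _.
    rewrite /w /monomial -big_split /=; apply: eq_bigr => r _.
    by rewrite mxE.
  have E r : \sum_(l < k) W r l (o beta r) * a r l ^+ gamma r =
      (gamma r == beta r)%:R by rewrite (WE r (o gamma r)).
  under eq_bigr do rewrite E.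
  have [->|gb] := eqVneq gamma beta; first by rewrite big1// => i _; rewrite eqxx.
  have /existsP[r gr] : [exists r, gamma r != beta r].
    apply: contraNT gb; rewrite negb_exists => /forallP gb.
    rewrite mpoly.bmeqP; apply/eqP/mpoly.mnmP => r.
    by have := gb r; rewrite negbK => /eqP.
  by rewrite (bigD1 r)//= (negbTE gr) mul0r.
pose C := \sum_beta \sum_l `|w beta l|.
exists C; first by apply: sumr_ge0 => b _; exact: sumr_ge0.
move=> c beta.
pose P (l : {ffun 'I_d -> 'I_k}) :=
  \sum_gamma c gamma * monomial gamma (\row_r a r (l r)).
change (`|c beta| <= C * \big[Num.max/0]_l `|P l|).
have -> : c beta = \sum_l w beta l * P l.
  rewrite /P; under eq_bigr do rewrite mulr_sumr.
  rewrite exchange_big /=.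
  transitivity (\sum_gamma c gamma * (gamma == beta)%:R).
    rewrite (bigD1 beta)//= eqxx mulr1 big1 ?addr0// => g gb.
    by rewrite (negbTE gb) mulr0.
  apply: eq_bigr => g _; rewrite -wE mulr_sumr.
  by apply: eq_bigr => l _; rewrite mulrCA.
apply: (le_trans (ler_norm_sum _ _ _)).
apply: (@le_trans _ _ (\sum_l `|w beta l| * \big[Num.max/0]_l `|P l|)).
  apply: ler_sum => l _; rewrite normrM ler_wpM2l//.
  exact: (le_bigmax _ (fun l => `|P l|)).
rewrite -mulr_suml ler_wpM2r//.
  by apply/bigmax_geP; left.
rewrite /C (bigD1 beta)//= lerDl; apply: sumr_ge0 => b _; exact: sumr_ge0.
Qed.

(** On the grid with nodes 0, ..., k - 1 on each axis, [grid_norming] bounds every coefficient by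
    values that all vanish. *)
Lemma mpoly_eq0 k p : (msize p <= k)%N ->
  (forall x, mpoly.meval (x 0) p = 0) -> p = 0.
Proof.
move=> pk p0; have [C C0 HC] := @grid_norming k (fun _ j => j%:R)
  (fun _ i j ij => ord_inj (mulrIn (oner_neq0 R) ij)).
apply/mpoly.mpolyP => m; rewrite mpoly.mcoeff0.
have [mk|km] := ltnP (mpoly.mdeg m) k; last first.
  by apply: mpoly.memN_msupp_eq0; apply: mpoly.msize_mdeg_ge; exact: leq_trans km.
have := HC (fun b => mpoly.mcoeff (mpoly.bmnm b) p) (mpoly.BMultinom mk) => /=.
under eq_bigr do rewrite -(meval_monomial _ pk) p0 normr0.
rewrite (_ : \big[_/_]_(_ | _) _ = 0) ?mulr0 ?normr_le0; last first.
  by elim/big_ind : _ => // x y -> ->; rewrite maxxx.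
by move/eqP.
Qed.

End polynomials.

Section taylor_polynomial.
Context {R : realType} {d : nat}.
Local Notation V := 'rV[R]_d.
Local Notation poly_ := (mpoly.mpoly d R).
Local Notation msize p := (mpoly.mmeasure mpoly.mdeg p).
Implicit Types (p : poly_) (u x : V).

Lemma is_derive_coord (i j : 'I_d) u :
  is_derive u (delta_mx 0 i) (fun u : V => u 0 j) (i == j)%:R.
Proof.
have E : (fun h : R => h^-1 *: (((fun u : V => u 0 j) \o shift u)
    (h *: delta_mx 0 i) - u 0 j)) @ 0^' --> ((i == j)%:R : R).
  apply: cvg_near_cst; near=> h.
  rewrite /= !mxE eqxx addrK /= eq_sym [_ *: _]mulrA mulVf ?mul1r//.
  by near: h; exact: nbhs_dnbhs_neq.
by split; [apply/cvg_ex; exists (i == j)%:R|exact: cvg_lim E].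
Unshelve. all: by end_near. Qed.

Lemma is_derive_meval p i u : is_derive u (delta_mx 0 i)
  (fun u : V => mpoly.meval (u 0) p) (mpoly.meval (u 0) (mpoly.mderiv i p)).
Proof.
elim/mpoly.mpolyind : p => [|c m p _ _ IH].
  rewrite mpoly.mderiv0 mpoly.meval0 (_ : (fun u => _) = cst 0).
    exact: is_derive_cst.
  by apply/funext => v; rewrite mpoly.meval0.
have HM p1 p2 :
    is_derive u (delta_mx 0 i)
      (fun u : V => mpoly.meval (u 0) p1) (mpoly.meval (u 0) (mpoly.mderiv i p1)) ->
    is_derive u (delta_mx 0 i)
      (fun u : V => mpoly.meval (u 0) p2) (mpoly.meval (u 0) (mpoly.mderiv i p2)) ->
    is_derive u (delta_mx 0 i) (fun u : V => mpoly.meval (u 0) (p1 * p2))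
      (mpoly.meval (u 0) (mpoly.mderiv i (p1 * p2))).
  move=> H1 H2.
  rewrite (_ : (fun u : V => mpoly.meval (u 0) (p1 * p2)) =
    (fun u : V => mpoly.meval (u 0) p1) * (fun u : V => mpoly.meval (u 0) p2)).
    apply: is_derive_eq (is_deriveM H1 H2) _.
    rewrite mpoly.mderivM mpoly.mevalD !mpoly.mevalM [RHS]addrC.
    by congr (_ + _); exact: mulrC.
  by apply/funext => v; rewrite mpoly.mevalM.
have H1 : is_derive u (delta_mx 0 i) (fun u : V => mpoly.meval (u 0) (1 : poly_))
    (mpoly.meval (u 0) (mpoly.mderiv i (1 : poly_))).
  rewrite -mpoly.mpolyC1 mpoly.mderivC mpoly.meval0 (_ : (fun u => _) = cst 1).
    exact: is_derive_cst.
  by apply/funext => v; rewrite mpoly.mevalC.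
have HX : is_derive u (delta_mx 0 i)
    (fun u : V => mpoly.meval (u 0) (mpoly.mpolyX R m))
    (mpoly.meval (u 0) (mpoly.mderiv i (mpoly.mpolyX R m))).
  rewrite mpoly.mpolyXE_id; elim/big_ind : _ => // j _.
  elim: (m j) => [|n IHn]; first by rewrite expr0.
  rewrite exprS; apply: HM => //.
  rewrite mpoly.mderivX mpoly.mnm1E.
  rewrite (_ : (fun u => _) = (fun u : V => u 0 j)); last first.
    by apply/funext => v; rewrite mpoly.mevalXU.
  apply: is_derive_eq (is_derive_coord _ _ _) _.
  rewrite mpoly.mevalZ eq_sym; case: eqP => [->|_]; last by rewrite !mul0r.
  rewrite (_ : mpoly.mnm_sub _ _ = mpoly.mnm0); last first.
    by apply/mpoly.mnmP => r; rewrite mpoly.mnmBE subnn mpoly.mnm0E.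
  rewrite mpoly.mpolyX0 mpoly.meval1.
  by rewrite mulr1.
rewrite mpoly.mderivD mpoly.mderivZ mpoly.mevalD mpoly.mevalZ.
rewrite (_ : (fun u => _) = (c *: (fun u : V => mpoly.meval (u 0) (mpoly.mpolyX R m)))
    + (fun u : V => mpoly.meval (u 0) p)).
  by apply: is_deriveD.
by apply/funext => v; rewrite mpoly.mevalD mpoly.mevalZ.
Qed.

Lemma continuous_meval p : continuous (fun u : V => mpoly.meval (u 0) p).
Proof.
rewrite (_ : (fun u => _) = (fun u : V => \sum_(beta : mpoly.bmultinom d (msize p))
    mpoly.mcoeff (mpoly.bmnm beta) p * monomial beta u)); last first.
  by apply/funext => u; rewrite (meval_monomial _ (leqnn _)).
apply: continuous_big => [|b _]; first exact: add_continuous.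
move=> u; apply: continuousM; first exact: cst_continuous.
apply: continuous_big => [|i _]; first exact: mul_continuous.
move=> v; apply: (@continuous_comp _ _ _ (fun v : V => v 0 i) (fun r => r ^+ b i)).
  exact: coord_continuous.
exact: exprn_continuous.
Qed.

Definition shift_eval (x0 : V) p x : R := mpoly.meval ((x - x0) 0) p.

Lemma is_derive_shift_eval x0 p i x :
  is_derive x (delta_mx 0 i) (shift_eval x0 p) (shift_eval x0 (mpoly.mderiv i p) x).
Proof.
have [dp dE] := is_derive_meval p i (1 *: (x - x0)).
have := is_derive_affine dp; rewrite dE scale1r mul1r.
by rewrite (_ : (fun y => _) = shift_eval x0 p)//;
  apply/funext => y; rewrite scale1r.
Qed.

Lemma partial_shift_eval x0 p i :
  partial i (shift_eval x0 p) = shift_eval x0 (mpoly.mderiv i p).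
Proof. by apply/funext => x; have [_] := is_derive_shift_eval x0 p i x. Qed.

Lemma mpartial_shift_eval x0 p alpha :
  mpartial alpha (shift_eval x0 p) = shift_eval x0 (mpoly.mderivm alpha p).
Proof.
rewrite /mpartial /mpoly.mderivm; elim: (enum 'I_d) => //= i l ->.
by elim: (alpha i) => //= n ->; rewrite partial_shift_eval.
Qed.

Lemma shift_eval_self x0 p : shift_eval x0 p x0 = mpoly.mcoeff (mpoly.mnm0) p.
Proof.
(* The bound exceeds the size by one so that the zero multi-index is available even when [p = 0]. *)
rewrite /shift_eval subrr (meval_monomial _ (leqnSn (msize p))).
rewrite (bigD1 (mpoly.bm0))//= big1 ?addr0.
  by rewrite /monomial big1 ?mulr1// => i _; rewrite mpoly.mnm0E expr0.
move=> b; rewrite mpoly.bmeqP /= => b0.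
have /existsP[r br] : [exists r, b r != 0%N].
  apply: contraNT b0; rewrite negb_exists => /forallP b0.
  apply/eqP/mpoly.mnmP => r; rewrite mpoly.mnm0E.
  by have := b0 r; rewrite negbK => /eqP.
by rewrite /monomial (bigD1 r)//= mxE expr0n (negbTE br) mul0r mulr0.
Qed.

Lemma continuous_shift_eval x0 p : continuous (shift_eval x0 p).
Proof.
move=> x.
have cB : {for x, continuous (fun x : V => x - x0)}.
  by apply: (@continuousB _ _ _ id (cst x0)) => //; exact: cst_continuous.
exact: (@continuous_comp _ _ _ _ (fun u : V => mpoly.meval (u 0) p) x cB
  (@continuous_meval p _)).
Qed.

Lemma Ck_shift_eval k x0 p : Ck k (shift_eval x0 p).
Proof.
elim: k p => [|k IH] p; (split; [|by []] || split).
- exact: continuous_shift_eval.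
- exact: continuous_shift_eval.
- move=> i; split; first by move=> x; have [] := is_derive_shift_eval x0 p i x.
  by rewrite partial_shift_eval.
Qed.

Lemma CkD k (f g : V -> R) : Ck k f -> Ck k g -> Ck k (fun x => f x + g x).
Proof.
elim: k f g => [|k IH] f g [cf Hf] [cg Hg]; (split; [|by []] || split).
- by move=> x; apply: continuousD; [exact: cf|exact: cg].
- by move=> x; apply: continuousD; [exact: cf|exact: cg].
- move=> i; have [df Cf] := Hf i; have [dg Cg] := Hg i; split.
    by move=> x; exact: (@derivableD _ _ _ f g).
  rewrite (_ : partial _ _ = (fun x => partial i f x + partial i g x)).
    exact: IH.
  by apply/funext => x; exact: (@deriveD _ _ _ f g).
Qed.

Lemma taylor_polynomial k (f : V -> R) (x0 : V) : Ck k f -> exists p,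
  [/\ (msize p <= k)%N,
    forall alpha, (mpoly.mdeg alpha < k)%N ->
      mpartial alpha (shift_eval x0 p) x0 = mpartial alpha f x0 &
    exists2 C, 0 <= C & forall x, `|x - x0| <= 1 ->
      `|f x - shift_eval x0 p x| <= C * `|x - x0| ^+ k].
Proof.
move=> fC.
have [p [pk pc _]] := mpoly_of_coeff (fun beta : mpoly.bmultinom d k =>
  mpartial beta f x0 / (\prod_i (beta i)`!)%:R).
have Dp alpha : (mpoly.mdeg alpha < k)%N ->
    mpartial alpha (shift_eval x0 p) x0 = mpartial alpha f x0.
  move=> ak; rewrite mpartial_shift_eval shift_eval_self mpoly.mcoeff_mderivm.
  rewrite (_ : mpoly.mnm_add _ _ = alpha); last first.
    by apply/mpoly.mnmP => r; rewrite mpoly.mnmDE mpoly.mnm0E addn0.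
  have E : (\prod_(i < d) alpha i ^_ alpha i = \prod_(i < d) (alpha i)`!)%N.
    by apply: eq_bigr => i _; exact: ffactnn.
  rewrite (pc (mpoly.BMultinom ak)) /= E -[LHS]mulr_natr.
  rewrite divfK// pnatr_eq0 -lt0n prodn_cond_gt0// => i _; exact: fact_gt0.
exists p; split => //.
(* The remainder has vanishing derivatives below order [k] at [x0], so [taylor_vanish_mpartial]
   gives its decay. *)
have gC : Ck k (fun x => f x + shift_eval x0 (- p) x).
  by apply: CkD => //; exact: Ck_shift_eval.
have [|C C0 HC] := taylor_vanish_mpartial (x0 := x0) gC.
  move=> alpha ak.
  have [Mf _ HMf] := Ck_deriv_bound `|x0| fC.
  have [Mp _ HMp] := Ck_deriv_bound `|x0| (Ck_shift_eval k x0 (- p)).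
  rewrite (mpartialD (ltnW ak) (HMf _ _) (HMp _ _))// -Dp// !mpartial_shift_eval.
  by rewrite /shift_eval mpoly.mderivmN mpoly.mevalN subrr.
exists C => // x /HC; by rewrite /shift_eval mpoly.mevalN.
Qed.

End taylor_polynomial.

(** * Linear systems with smooth coefficients *)

Section linear_systems.
Context {R : realType} {d : nat} {I : finType}.
Local Notation V := 'rV[R]_d.
Variables (tau : R) (x0 : V).
Hypothesis tau_gt0 : 0 < tau.
Local Notation DB := (deriv_bound tau x0).

(** [kappa] is the ratio of the bound on the matrix to its stability constant. The recursion solves
    the differentiated system: 1 accounts for the derivative of the right-hand side, and
    [2 ^+ j' * (#|I|%:R * kappa * K)] for the derivative of the matrix times the solution. The
    leading 1 keeps the constant at least 1. *)
Fixpoint solve_const (kappa : R) (j : nat) : R :=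
  if j is j'.+1 then
    let K := solve_const kappa j' in
    1 + K * (1 + 2 ^+ j' * (#|I|%:R * kappa * K))
  else 1.

Lemma solve_const_ge1 kappa j : 0 <= kappa -> 1 <= solve_const kappa j.
Proof.
move=> k0; elim: j => //= j IH; rewrite lerDl.
have K0 : 0 <= solve_const kappa j by exact: le_trans IH.
by rewrite mulr_ge0// addr_ge0// ?mulr_ge0.
Qed.

Lemma near_forall (Q : I -> V -> Prop) :
  (forall i, \forall x \near x0, Q i x) -> \forall x \near x0, forall i, Q i x.
Proof. by move=> H; exact: (@filter_forall _ _ Q (nbhs x0) _ H). Qed.

(* Differentiating [G e = eps] gives [G (partial i e) = partial i eps - (partial i
   G) e], a system with the same matrix: the order of differentiation can be
   raised step by step from the stability of the system alone. *)
Lemma linear_solve_bound (G : I -> I -> V -> R) (g lam : R) (j : nat) :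
  0 < lam -> 0 <= g ->
  (\forall xi \near x0, forall (c : I -> R) A,
    (forall b, `|\sum_a G b a xi * c a| <= A) -> forall b, `|c b| <= A / lam) ->
  (forall b a, DB j g (G b a)) ->
  forall (e eps : I -> V -> R) A,
  (forall b, DB j A (eps b)) -> (forall b, exists B, DB j B (e b)) ->
  (\forall xi \near x0, forall b, \sum_a G b a xi * e a xi = eps b xi) ->
  forall b, DB j (solve_const (g / lam) j * (A / lam)) (e b).
Proof.
move=> lam0 g0 stab.
have kap0 : 0 <= g / lam by rewrite divr_ge0// ltW.
elim: j => [|j IH] HG e eps A Heps He Ge b.
  split => //=; rewrite mul1r.
  have eA : \forall xi \near x0, forall b, `|eps b xi| <= A.
    by apply: (@near_forall (fun b xi => `|eps b xi| <= A)) => b'; exact: deriv_bound0 (Heps b').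
  apply: filterS3 stab Ge eA => xi stab Ge eA.
  by apply: (stab (e ^~ xi)) => b'; rewrite Ge.
have A0 : 0 <= A := deriv_bound_ge0 (Heps b).
set K := solve_const (g / lam) j.
have K0 : 0 <= K by apply: le_trans (solve_const_ge1 j kap0).
set Q := K * (1 + 2 ^+ j * (#|I|%:R * (g / lam) * K)).
have KS : solve_const (g / lam) j.+1 = 1 + Q by [].
have KQ : K <= Q.
  by rewrite /Q mulrDr mulr1 lerDl mulr_ge0// mulr_ge0 ?exprn_ge0// mulr_ge0// mulr_ge0.
have Al0 : 0 <= A / lam by rewrite divr_ge0// ltW.
have eb : forall b, DB j (K * (A / lam)) (e b).
  apply: (IH _ e eps) => //.
  - by move=> b' a; exact/deriv_bound_pred/HG.
  - by move=> b'; exact/deriv_bound_pred/Heps.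
  - by move=> b'; have [B /deriv_bound_pred HB] := He b'; exists B.
split.
  apply: filterS (deriv_bound0 (eb b)) => x /le_trans; apply.
  by rewrite ler_wpM2r// KS (le_trans KQ)// lerDr.
move=> i; split.
  by have [B [_ /(_ i) []]] := He b.
pose eps' b' xi := partial i (eps b') xi - \sum_a partial i (G b' a) xi * e a xi.
have dG b' a : \forall xi \near x0, derivable (G b' a) xi (delta_mx 0 i).
  by have [_ /(_ i) []] := HG b' a.
have de a : \forall xi \near x0, derivable (e a) xi (delta_mx 0 i).
  by have [B [_ /(_ i) []]] := He a.
have dE : \forall xi \near x0, forall b', \sum_a G b' a xi * partial i (e a) xi = eps' b' xi.
  apply: (@near_forall (fun b' xi =>
    \sum_a G b' a xi * partial i (e a) xi = eps' b' xi)) => b'.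
  have Gb : \forall xi \near x0, \sum_a G b' a xi * e a xi = eps b' xi.
    by apply: filterS Ge => xi; exact.
  have dGa : \forall xi \near x0, forall a, derivable (G b' a) xi (delta_mx 0 i).
    exact: (@near_forall (fun a xi => derivable (G b' a) xi (delta_mx 0 i)) (dG b')).
  have dea : \forall xi \near x0, forall a, derivable (e a) xi (delta_mx 0 i).
    exact: (@near_forall (fun a xi => derivable (e a) xi (delta_mx 0 i)) de).
  apply: filterS3 (near_eq_partial i Gb) dGa dea => xi + dGx dex; rewrite /eps' => <-.
  have E : is_derive xi (delta_mx 0 i) (fun xi => \sum_a G b' a xi * e a xi)
      (\sum_a (G b' a xi * partial i (e a) xi + e a xi * partial i (G b' a) xi)).
    rewrite (_ : (fun xi => _) = \sum_a (G b' a * e a)).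
      apply: (big_ind2 (fun F dF => is_derive xi (delta_mx 0 i) F dF)).
      - exact: (@is_derive_cst _ _ _ (0 : R)).
      - by move=> F1 d1 F2 d2 H1 H2; exact: is_deriveD.
      - by move=> a _; apply: is_deriveM; apply: DeriveDef.
    by apply/funext => y; rewrite fct_sumE.
  rewrite [X in _ = X - _](@derive_val _ _ _ _ _ _ _ E) big_split /=.
  apply/esym/eqP; rewrite subr_eq; apply/eqP; congr (_ + _).
  by apply: eq_bigr => a _; rewrite mulrC.
(* The new right-hand side has size [A / tau] from [eps], plus [#|I|] products of a derivative of
   [G], of size [g / tau], with [e], of size [K * (A / lam)]. *)
have := IH (fun b' a => deriv_bound_pred (HG b' a)) (fun a => partial i (e a)) eps'
  (A / tau + \sum_(a : I) (2 ^+ j * (g / tau * (K * (A / lam))))) _ _ dE b.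
rewrite (_ : _ + _ = A / tau * (1 + 2 ^+ j * (#|I|%:R * (g / lam) * K))); last first.
  by rewrite sumr_const -mulr_natr; ring.
have -> : K * (A / tau * (1 + 2 ^+ j * (#|I|%:R * (g / lam) * K)) / lam) =
   (K * (1 + 2 ^+ j * (#|I|%:R * (g / lam) * K))) * (A / lam) / tau by ring.
move=> H; apply: deriv_bound_le (H _ _) => //.
- by rewrite ler_pM2r ?invr_gt0// ler_wpM2r// KS lerDr.
- move=> b'; rewrite (_ : A / tau * _ = A / tau +
    \sum_(a : I) (2 ^+ j * (g / tau * (K * (A / lam))))); last first.
    by rewrite sumr_const -mulr_natr; ring.
  apply: deriv_boundB => //; first by have [_ /(_ i) []] := Heps b'.
  apply: deriv_bound_sum => // a _; apply: deriv_boundM => //.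
  by have [_ /(_ i) []] := HG b' a.
- by move=> b'; have [B [_ /(_ i) [_ HB]]] := He b'; exists (B / tau).
Qed.

End linear_systems.

(** * Norming cells and the normal equations *)

Section norming.
Context {R : realType} {d : nat}.
Local Notation V := 'rV[R]_d.
Local Notation msize p := (mpoly.mmeasure mpoly.mdeg p).

Lemma monomialE (beta : mpoly.multinom d) :
  monomial beta = shift_eval 0 (mpoly.mpolyX R beta).
Proof. by apply/funext => u; rewrite /shift_eval mpoly.mevalX subr0. Qed.

Lemma continuous_monomial (beta : mpoly.multinom d) :
  continuous (monomial beta : V -> R).
Proof. rewrite monomialE; exact: continuous_shift_eval. Qed.

Lemma Ck_monomial k (beta : mpoly.multinom d) : Ck k (monomial beta : V -> R).
Proof. rewrite monomialE; exact: Ck_shift_eval. Qed.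

(** For given coefficients, the node where the polynomial is largest controls them all by
    [grid_norming]. By continuity every point of the cell around that node does so too, hence each
    sample point in the cell will contribute to the quadratic form. *)
Lemma norming_cells k (a : 'I_d -> 'I_k -> R) : (0 < k)%N ->
  (forall r, injective (a r)) ->
  exists2 C, 0 < C & \forall eps \near (0 : R)^'+,
    forall c : mpoly.bmultinom d k -> R, exists l : {ffun 'I_d -> 'I_k},
    forall u : V, `|u - \row_r a r (l r)| <= eps ->
    forall beta, `|c beta| <= C * `|\sum_gamma c gamma * monomial gamma u|.
Proof.
move=> k0 a_inj; have [C0 C00 HC0] := grid_norming a_inj.
pose D : R := #|{: mpoly.bmultinom d k}|%:R.
(* This gives [C0 * D * del <= 1 / 2]: replacing a node by a point of its cell costs at most half of
   the largest coefficient, which is absorbed on the left. *)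
pose del : R := (2 * (C0 + 1) * (D + 1))^-1.
have D0 : 0 <= D by [].
have del0 : 0 < del by rewrite invr_gt0 !mulr_gt0// ltr_wpDl.
exists (2 * C0 + 1); first by rewrite ltr_wpDl// mulr_ge0.
pose z (l : {ffun 'I_d -> 'I_k}) : V := \row_r a r (l r).
have cz l : \forall eps \near (0 : R)^'+, forall u, `|u - z l| <= eps ->
    forall beta : mpoly.bmultinom d k, `|monomial beta u - monomial beta (z l)| <= del.
  have : \forall u \near z l, forall beta : mpoly.bmultinom d k,
      `|monomial beta u - monomial beta (z l)| <= del.
    suff H (beta : mpoly.bmultinom d k) : \forall u \near z l,
        `|monomial beta u - monomial beta (z l)| <= del.
      exact: (@filter_forall _ _ (fun (beta : mpoly.bmultinom d k) (u : V) =>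
        `|monomial beta u - monomial beta (z l)| <= del) (nbhs (z l)) _ H).
    have /cvgrPdist_le/(_ _ del0) := @continuous_monomial beta (z l).
    by apply: filterS => u; rewrite distrC.
  move=> /nbhs_normP[e /= e0 eH].
  near=> eps => u ue; apply: eH => /=.
  rewrite distrC (le_lt_trans ue)//; near: eps; exact: nbhs_right_lt.
have : \forall eps \near (0 : R)^'+, forall l u, `|u - z l| <= eps ->
    forall beta : mpoly.bmultinom d k, `|monomial beta u - monomial beta (z l)| <= del.
  exact: (@filter_forall _ _ (fun l eps => forall u, `|u - z l| <= eps ->
    forall beta : mpoly.bmultinom d k,
      `|monomial beta u - monomial beta (z l)| <= del) _ _ cz).
apply: filterS => eps cze c.
pose N := \big[Num.max/0]_beta `|c beta|.
have cN beta : `|c beta| <= N by exact: (le_bigmax _ (fun b => `|c b|)).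
have N0 : 0 <= N by apply/bigmax_geP; left.
pose l0 : {ffun 'I_d -> 'I_k} := [ffun=> Ordinal k0].
pose P l := \sum_gamma c gamma * monomial gamma (z l).
have [l _ lE] := @eq_bigmax _ _ _ 0 l0 xpredT (fun l => `|P l|) isT (fun _ _ => normr_ge0 _).
exists l => u uz beta.
have NP : N <= C0 * `|P l|.
  apply/bigmax_leP; split; first by rewrite mulr_ge0.
  by move=> b _; rewrite -lE; exact: HC0.
set Q := \sum_gamma _.
have PQ : `|P l| <= `|Q| + D * N * del.
  rewrite -lerBlDl (le_trans (lerB_dist _ _))// /P /Q -sumrB.
  apply: (le_trans (ler_norm_sum _ _ _)).
  apply: (@le_trans _ _ (\sum_(b : mpoly.bmultinom d k) N * del)); last first.
    by rewrite sumr_const -mulr_natl mulrA.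
  apply: ler_sum => b _; rewrite -mulrBr normrM ler_pM// distrC.
  exact: cze.
apply: (le_trans (cN beta)).
have : C0 * (D * N * del) <= N / 2.
  rewrite (_ : C0 * (D * N * del) = N * (C0 * D * del)); last by ring.
  apply: ler_wpM2l => //; rewrite /del ler_pdivrMr ?mulr_gt0 ?ltr_wpDl//.
  rewrite [X in _ <= X](_ : _ = (C0 + 1) * (D + 1)); last by field.
  by rewrite ler_pM// lerDl.
have : C0 * `|P l| <= C0 * (`|Q| + D * N * del) by rewrite ler_wpM2l.
rewrite mulrDr => H1 H2; have := normr_ge0 Q; lra.
Unshelve. all: by end_near. Qed.

End norming.

(** * Normal equations and uniqueness of the minimizer *)

Section minimizer.
Context {R : realType} {d : nat}.
Local Notation V := 'rV[R]_d.
Local Notation msize p := (mpoly.mmeasure mpoly.mdeg p).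
Variables (k : nat) (Phi f : V -> R) (h : R) (n : nat) (X : 'I_n -> V) (xi : V).
Variables (x0 : V) (t : R).
Local Notation w i := (Phi (h^-1 *: (xi - X i))).
Local Notation lp := (local_poly x0 t).

Lemma local_polyB (c c' : mpoly.bmultinom d k -> R) x :
  lp (fun b => c b - c' b) x = lp c x - lp c' x.
Proof. by rewrite /local_poly -sumrB; apply: eq_bigr => b _; rewrite mulrBl. Qed.

(** Pythagoras: the normal equations make the residual orthogonal to all polynomials of the space,
    so the loss of a competitor is that of [p] plus the weighted square norm of the difference,
    which is positive unless the difference is zero. *)
Lemma mls_minimizer_unique p (c : mpoly.bmultinom d k -> R) : t != 0 ->
  (msize p <= k)%N -> (forall x : V, mpoly.meval (x 0) p = lp c x) ->
  (forall beta : mpoly.bmultinom d k,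
    \sum_i (lp c (X i) - f (X i)) * monomial beta (t^-1 *: (X i - x0)) * w i = 0) ->
  (forall c' : mpoly.bmultinom d k -> R, 0 <= \sum_i lp c' (X i) ^+ 2 * w i /\
    (\sum_i lp c' (X i) ^+ 2 * w i = 0 -> forall beta, c' beta = 0)) ->
  mls_minimizer k Phi f h X xi p /\
  forall p', mls_minimizer k Phi f h X xi p' -> p = p'.
Proof.
move=> t0 pk pE orth pos.
have lossE p' c' : (forall x : V, mpoly.meval (x 0) p' = lp c' x) ->
    mls_loss Phi f h X xi p' = mls_loss Phi f h X xi p +
      \sum_i lp (fun b => c' b - c b) (X i) ^+ 2 * w i.
  move=> p'E.
  have cross : \sum_i (lp c (X i) - f (X i)) * lp (fun b => c' b - c b) (X i) * w i = 0.
    transitivity (\sum_beta (c' beta - c beta) *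
      \sum_i (lp c (X i) - f (X i)) * monomial beta (t^-1 *: (X i - x0)) * w i).
      under [RHS]eq_bigr do rewrite mulr_sumr.
      rewrite exchange_big /=; apply: eq_bigr => i _.
      rewrite {2}/local_poly mulr_sumr mulr_suml; apply: eq_bigr => b _; ring.
    by rewrite big1// => b _; rewrite orth mulr0.
  transitivity (mls_loss Phi f h X xi p +
      \sum_i lp (fun b => c' b - c b) (X i) ^+ 2 * w i +
      2 * \sum_i (lp c (X i) - f (X i)) * lp (fun b => c' b - c b) (X i) * w i).
    rewrite /mls_loss mulr_sumr -!big_split /=; apply: eq_bigr => i _.
    by rewrite p'E pE local_polyB; ring.
  by rewrite cross mulr0 addr0.
split; last first.
  move=> p' [p'k p'min].
  have [c' p'E] := local_poly_of_mpoly x0 t0 p'k.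
  have := p'min _ pk; rewrite (lossE _ _ p'E) gerDl => S0.
  have [S0' S0eq] := pos (fun b => c' b - c b).
  have {}S0eq := S0eq (le_anti (introT andP (conj S0 S0'))).
  apply/eqP; rewrite -subr_eq0; apply/eqP.
  apply: (@mpoly_eq0 _ _ k).
    rewrite (leq_trans (mpoly.mmeasureD_le _ _ _))//.
    by rewrite mpoly.mmeasureN geq_max pk p'k.
  move=> x; rewrite mpoly.mevalB pE p'E -local_polyB /local_poly big1// => b _.
  by rewrite -opprB S0eq oppr0 mul0r.
split => // p' p'k.
have [c' p'E] := local_poly_of_mpoly x0 t0 p'k.
by rewrite (lossE _ _ p'E) lerDl; case: (pos (fun b => c' b - c b)).
Qed.

End minimizer.

(** * Cramer's rule with smooth coefficients *)

Section smooth_solution.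
Context {R : realType} {d : nat}.
Local Notation V := 'rV[R]_d.
Variables (tau : R) (x0 : V).
Hypothesis tau_gt0 : 0 < tau.
Local Notation DB := (deriv_bound tau x0).

Lemma deriv_bound_det n j (M : 'I_n -> 'I_n -> V -> R) :
  (forall i i', exists A, DB j A (M i i')) ->
  exists A, DB j A (fun xi => \det (\matrix_(i, i') M i i' xi)).
Proof.
move=> HM.
have HP (s : {perm 'I_n}) : exists A, DB j A (fun xi => \prod_i M i (s i) xi).
  by apply: deriv_bound_prod => // i; exact: HM.
have [A HA] := choice HP.
exists (\sum_(s : {perm 'I_n}) `|(-1) ^+ s| * A s).
rewrite (_ : (fun xi => _) =
    (fun xi => \sum_(s : {perm 'I_n}) (-1) ^+ s * \prod_i M i (s i) xi)).
  by apply: deriv_bound_sum => // s _; exact: deriv_boundZ.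
apply/funext => xi; apply: eq_bigr => s _; congr (_ * _).
by apply: eq_bigr => i _; rewrite mxE.
Qed.

Lemma continuous_det n (M : 'I_n -> 'I_n -> V -> R) :
  (forall i i', continuous (M i i')) ->
  continuous (fun xi => \det (\matrix_(i, i') M i i' xi)).
Proof.
move=> HM.
rewrite (_ : (fun xi => _) =
    (fun xi => \sum_(s : {perm 'I_n}) (-1) ^+ s * \prod_i M i (s i) xi)).
  apply: continuous_big => [|s _]; first exact: add_continuous.
  have cP : continuous (fun xi => \prod_i M i (s i) xi).
    by apply: continuous_big => [|i _]; [exact: mul_continuous|exact: HM].
  move=> u; exact: (continuousM (@cst_continuous _ _ ((-1) ^+ s : R) u) (cP u)).
apply/funext => xi; apply: eq_bigr => s _; congr (_ * _).
by apply: eq_bigr => i _; rewrite mxE.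
Qed.

(** Cramer's rule supplies a differentiable solution, with bounds that depend on the determinant at
    [x0] and thus on the sample. It only provides the existence of bounds that [linear_solve_bound]
    asks for before making them uniform. *)
Lemma smooth_linear_solution (I : finType) (G : I -> I -> V -> R) (lam : R) j
    (eps : I -> V -> R) :
  (\forall xi \near x0, forall (c : I -> R) A,
    (forall b, `|\sum_a G b a xi * c a| <= A) -> forall b, `|c b| <= A / lam) ->
  (forall b a, continuous (G b a)) ->
  (forall b a, exists g, DB j g (G b a)) -> (forall b, exists A, DB j A (eps b)) ->
  exists e : I -> V -> R, (forall b, exists B, DB j B (e b)) /\
    \forall xi \near x0, forall b, \sum_a G b a xi * e a xi = eps b xi.
Proof.
move=> stab cG HG Heps.
pose M i i' xi := G (@enum_val I xpredT i) (@enum_val I xpredT i') xi.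
pose A xi := \matrix_(i, i') M i i' xi.
(* Stability with right-hand side 0 says that the kernel is trivial; the transpose turns this into a
   statement on row vectors. *)
have detA0 : \forall xi \near x0, \det (A xi) != 0.
  apply: filterS stab => xi stab.
  rewrite -det_tr -unitfE -unitmxE -row_free_unit; apply: inj_row_free => v vA.
  apply/rowP => i; rewrite mxE.
  have := stab (fun b => v 0 (enum_rank b)) 0.
  rewrite mul0r => /(_ _ (enum_val i)); rewrite enum_valK normr_le0 => H.
  apply/eqP; apply: H => b; rewrite normr_le0.
  move/rowP : vA => /(_ (enum_rank b)); rewrite !mxE => vA; apply/eqP.
  rewrite -[RHS]vA (reindex (@enum_rank I)) /=; last first.
    by apply: onW_bij; exact: enum_rank_bij.
  apply: eq_bigr => a _.
  by rewrite mulrC !mxE /M !enum_rankK.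
have cA : continuous (fun xi => \det (A xi)) by apply: continuous_det => i i'; exact: cG.
pose c := `|\det (A x0)| / 2.
have c0 : 0 < c by rewrite divr_gt0// normr_gt0 (nbhs_singleton detA0).
have cle : \forall xi \near x0, c <= `|\det (A xi)|.
  have /cvgrPdist_lt/(_ _ c0) := cA x0; apply: filterS => xi dist.
  have := ler_distD (\det (A xi)) (\det (A x0)) 0; rewrite !subr0 => H.
  rewrite -lerBlDl in H; rewrite /c in dist *.
  have := normr_ge0 (\det (A x0)); lra.
have [Ad HAd] : exists B, DB j B (fun xi => \det (A xi)).
  by apply: deriv_bound_det => i i'; exact: HG.
have [Bd HBd] := deriv_boundV tau_gt0 c0 cle HAd.
have Hadj i i' : exists B, DB j B (fun xi => (\adj (A xi)) i i').
  have [B HB] : exists B, DB j B (fun xi =>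
      \det (\matrix_(r, r') M (lift i' r) (lift i r') xi)).
    by apply: deriv_bound_det => r r'; exact: HG.
  exists (`|(-1) ^+ (i' + i)| * B).
  rewrite (_ : (fun xi => _) = (fun xi => (-1) ^+ (i' + i) *
      \det (\matrix_(r, r') M (lift i' r) (lift i r') xi))).
    exact: deriv_boundZ.
  apply/funext => xi; rewrite mxE /cofactor; congr (_ * \det _).
  by apply/matrixP => r r'; rewrite !mxE.
exists (fun b xi => (\det (A xi))^-1 *
  \sum_i (\adj (A xi)) (enum_rank b) i * eps (enum_val i) xi); split.
  move=> b; have H i : exists B, DB j B (fun xi =>
      (\adj (A xi)) (enum_rank b) i * eps (enum_val i) xi).
    have [B HB] := Hadj (enum_rank b) i; have [B' HB'] := Heps (enum_val i).
    by eexists; exact: (deriv_boundM HB HB').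
  have [B HB] := choice H.
  by eexists; apply: deriv_boundM HBd _ => //; apply: deriv_bound_sum => // i _;
    exact: HB.
apply: filterS detA0 => xi detA0 b.
pose v := \col_i eps (@enum_val I xpredT i) xi.
transitivity ((\det (A xi))^-1 * (A xi *m (\adj (A xi) *m v)) (enum_rank b) 0).
  rewrite mxE mulr_sumr [RHS](reindex (@enum_rank I)) /=; last first.
    by apply: onW_bij; exact: enum_rank_bij.
  apply: eq_bigr => a _; rewrite [A xi _ _]mxE /M !enum_rankK mulrCA.
  congr (_ * (_ * _)); rewrite mxE; apply: eq_bigr => i _.
  by rewrite [v _ _]mxE.
rewrite mulmxA mul_mx_adj mul_scalar_mx !mxE mulrA mulVf// mul1r.
by rewrite enum_rankK.
Qed.

End smooth_solution.

(** * Size and support of the rescaled weights *)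

Section weights.
Context {R : realType} {d : nat}.
Local Notation V := 'rV[R]_d.

Lemma le_norm2 (x : V) : `|x| <= norm2 x.
Proof.
apply: norm_rV_le; first exact: sqrtr_ge0.
move=> j; rewrite -sqrtr_sqr ler_wsqrtr// (bigD1 j)//= lerDl.
by apply: sumr_ge0 => i _; exact: sqr_ge0.
Qed.

Lemma norm2_le (x : V) : norm2 x <= d%:R * `|x|.
Proof.
rewrite -[leRHS]ger0_norm ?mulr_ge0// -sqrtr_sqr ler_wsqrtr//.
apply: (@le_trans _ _ (\sum_(j < d) `|x| ^+ 2)).
  by apply: ler_sum => j _; rewrite -real_normK ?num_real// lerXn2r ?nnegrE// norm_coord.
rewrite sumr_const card_ord exprMn -[leLHS]mulr_natl ler_wpM2r ?sqr_ge0//.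
by rewrite -natrX ler_nat; case: (d) => // e; rewrite leq_pmulr.
Qed.

(** A sample point farther than [s * C0 * t >= s * h] has weight zero on a neighbourhood of [x0], so
    that sums over the sample are bounded by counting points in one fixed ball. For the others
    [t <= h] keeps the rescaled argument in a fixed ball, whence a single [M]. *)
Lemma weight_deriv_bound k (s C0 : R) (Phi : V -> R) (x0 : V) : 0 < s ->
  0 <= C0 -> mls_weight k s Phi ->
  exists2 M, 0 <= M & forall t h X, 0 < t -> t <= h -> h <= C0 * t ->
    deriv_bound t x0 k (if `|X - x0| <= s * C0 * t then M else 0)
      (fun xi => Phi (h^-1 *: (xi - X))).
Proof.
move=> s0 C00 [PhiC _ supp _]; have [M M0 HM] := Ck_deriv_bound (s * C0) PhiC.
have sC0 : 0 <= s * C0 by rewrite mulr_ge0// ltW.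
exists M => // t h X t0 th hC; have h0 : 0 < h := lt_le_trans t0 th.
case: leP => [Xle|Xgt].
  apply: deriv_bound_affine => //; apply: HM.
  rewrite normrZ normfV (gtr0_norm h0) ler_pdivrMl// distrC (le_trans Xle)//.
  by rewrite mulrC ler_wpM2r.
have sh : s < `|h^-1 *: (x0 - X)|.
  rewrite normrZ normfV (gtr0_norm h0) ltr_pdivlMl// distrC (le_lt_trans _ Xgt)//.
  by rewrite mulrC -mulrA ler_wpM2l// ltW.
have c0 : {for x0, continuous (fun x : V => h^-1 *: (x - X))}.
  apply: continuousZl_tmp; apply: (@continuousB _ _ _ id (cst X)) => //.
  exact: cst_continuous.
have near_s : \forall u \near h^-1 *: (x0 - X), s < `|u|.
  exact: (cvgr_gt _ (@norm_continuous _ _ _) _ sh).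
apply: deriv_bound_near (deriv_bound_cst _ _ k (_ : `|0| <= 0)); last first.
- by rewrite normr0.
- exact: t0.
have near_x : \forall x \near x0, s < `|h^-1 *: (x - X)| := c0 _ near_s.
apply: filterS near_x => x /= sx.
apply/esym/eqP; apply: contraT => Phi0.
have /supp : closure [set x | Phi x != 0] (h^-1 *: (x - X)) by exact: subset_closure.
by move=> /= /(lt_le_trans (lt_le_trans sx (le_norm2 _))); rewrite ltxx.
Qed.

(** The compact sup ball of radius [sig] lies in the open Euclidean ball of radius [s], and [Phi]
    attains a positive minimum on it. *)
Lemma weight_lower_bound k (s sig : R) (Phi : V -> R) : 0 <= sig ->
  d%:R * sig < s -> mls_weight k s Phi ->
  exists2 phi0, 0 < phi0 & forall v, `|v| <= sig -> phi0 <= Phi v.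
Proof.
move=> sig0 dsig [PhiC _ _ Phi_gt0].
have cPhi : continuous Phi by case: k PhiC => [|k] [].
pose B := closed_ball_ (fun x : V => `|x|) 0 sig.
have cB : compact B.
  apply: bounded_closed_compact; last exact: closed_closed_ball_.
  exists sig; split; first exact: num_real.
  by move=> M Mx x /= ; rewrite /B /closed_ball_ /= sub0r normrN => /le_trans; apply; exact: ltW.
have B0 : B 0 by rewrite /B /closed_ball_ /= subrr normr0.
have [c cB' cmin] := @EVT_min_rV _ _ Phi B (ex_intro _ _ B0) cB
  (continuous_subspaceT cPhi).
exists (Phi c).
  apply: Phi_gt0; apply: (le_lt_trans (norm2_le _)); apply: (le_lt_trans _ dsig).
  rewrite ler_wpM2l//; move: cB'; rewrite inE /B /closed_ball_ /=.
  by rewrite sub0r normrN.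
by move=> v vs; apply: cmin; rewrite inE /B /closed_ball_ /= sub0r normrN.
Qed.

End weights.

(** * The error bound for well-distributed samples *)

Section deterministic_error.
Context {R : realType} {d : nat}.
Local Notation V := 'rV[R]_d.
Local Notation msize p := (mpoly.mmeasure mpoly.mdeg p).

Lemma monomial_bound k (rho : R) : 0 <= rho ->
  exists2 B, 0 <= B & forall (beta : mpoly.bmultinom d k) (u : V), `|u| <= rho ->
    `|monomial beta u| <= B.
Proof.
move=> rho0.
have /choice[B HB] (beta : mpoly.bmultinom d k) : exists B, forall u : V,
    `|u| <= rho -> `|monomial beta u| <= B.
  have [B _ HB] := continuous_bounded_ball 0 rho (@continuous_monomial _ _ beta).
  by exists B => u ur; apply: HB; rewrite subr0.
exists (\sum_beta `|B beta|); first exact: sumr_ge0.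
move=> beta u /(HB beta) /le_trans; apply.
by rewrite (bigD1 beta)//= (le_trans (ler_norm _))// lerDl sumr_ge0.
Qed.

(* Testing the system against [c] gives [lam * N ^+ 2 <= #|I| * N * A]. *)
Lemma quadratic_form_stability (I : finType) (n : nat) (w : 'I_n -> R)
    (b : I -> 'I_n -> R) (lam : R) : 0 < lam ->
  (forall c : I -> R, exists2 N, (forall a, `|c a| <= N) &
    lam * N ^+ 2 <= \sum_i (\sum_a c a * b a i) ^+ 2 * w i) ->
  forall (c : I -> R) A,
    (forall a', `|\sum_a (\sum_i w i * b a' i * b a i) * c a| <= A) ->
    forall a, `|c a| <= A / (lam / #|I|%:R).
Proof.
move=> lam0 Hlam c A HA a.
have [N cN lamN] := Hlam c.
have D0 : 0 < #|I|%:R :> R by rewrite ltr0n; apply/card_gt0P; exists a.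
have A0 : 0 <= A by exact: le_trans (HA a).
have N0 : 0 <= N by exact: le_trans (cN a).
have QE : \sum_i (\sum_a c a * b a i) ^+ 2 * w i =
    \sum_a' c a' * (\sum_a (\sum_i w i * b a' i * b a i) * c a).
  under [RHS]eq_bigr do rewrite mulr_sumr.
  transitivity (\sum_a' \sum_a \sum_i c a' * (w i * b a' i * b a i * c a)).
    under [RHS]eq_bigr do rewrite exchange_big.
    rewrite exchange_big /=; apply: eq_bigr => i _.
    rewrite expr2 mulr_suml mulr_suml; apply: eq_bigr => a' _.
    rewrite mulr_sumr mulr_suml; apply: eq_bigr => a'' _; ring.
  apply: eq_bigr => a' _; apply: eq_bigr => a'' _.
  by rewrite mulr_suml mulr_sumr.
have QN : \sum_i (\sum_a c a * b a i) ^+ 2 * w i <= #|I|%:R * (N * A).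
  rewrite QE (le_trans (ler_norm _))// (le_trans (ler_norm_sum _ _ _))//.
  apply: (@le_trans _ _ (\sum_(a' : I) N * A)).
    by apply: ler_sum => a' _; rewrite normrM ler_pM.
  by rewrite sumr_const -[leLHS]mulr_natl.
apply: (le_trans (cN a)).
rewrite (_ : A / (lam / #|I|%:R) = A * #|I|%:R / lam); last first.
  by rewrite invfM invrK mulrA mulrAC.
rewrite ler_pdivlMr//.
have [->|N1] := eqVneq N 0; first by rewrite mul0r mulr_ge0// ler0n.
have {N1}N0 : 0 < N by rewrite lt_def N1.
rewrite -(ler_pM2l N0) (_ : N * (N * lam) = lam * N ^+ 2); last by ring.
apply: (le_trans lamN); apply: (le_trans QN).
by rewrite (_ : #|I|%:R * (N * A) = N * (A * #|I|%:R))//; ring.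
Qed.

Lemma sum_if_card (n : nat) (Q : pred 'I_n) (M : R) :
  \sum_(i < n) (if Q i then M else 0) = #|Q|%:R * M.
Proof. by rewrite -big_mkcond /= sumr_const mulr_natl. Qed.

(** [K] is chosen before [t], [h], [n], [X] and [L]: the Gram matrix, its lower bound and the
    residual side are all proportional to [L], which cancels. The condition [s * C0 * t <= 1] keeps
    active points where the Taylor estimate holds, and [t <= 1] lets the term of order [m] dominate
    those of lower order. *)
Theorem mls_deterministic (k m : nat) (Phi f : V -> R) (s : R)
    (q : mpoly.multinom d -> R) (x0 : V) (a : 'I_d -> 'I_k -> R)
    (eps sig C C0 c1 C1 : R) :
  (m < k)%N -> Ck k f -> 0 < s -> mls_weight k s Phi ->
  0 < sig -> d%:R * (2 * sig) < s -> 0 < C0 -> 0 < c1 -> 0 < C1 -> 0 < C ->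
  (forall (l : {ffun 'I_d -> 'I_k}) (u : V),
    `|u - \row_r a r (l r)| <= eps -> `|u| <= sig) ->
  (forall c : mpoly.bmultinom d k -> R, exists l : {ffun 'I_d -> 'I_k},
    forall u : V, `|u - \row_r a r (l r)| <= eps ->
    forall beta, `|c beta| <= C * `|\sum_gamma c gamma * monomial gamma u|) ->
  exists2 K, 0 < K & forall (t h : R) (n : nat) (X : 'I_n -> V) (L : R),
    0 < t -> t <= 1 -> t <= h -> h <= C0 * t -> s * C0 * t <= 1 -> 0 < L ->
    (forall l : {ffun 'I_d -> 'I_k}, c1 * L <=
      #|[pred i | `|X i - (x0 + t *: \row_r a r (l r))| <= eps * t]|%:R) ->
    #|[pred i | `|X i - x0| <= s * C0 * t]|%:R <= C1 * L ->
    mls_defined_near k Phi f h X x0 /\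
    `|diffop m q (mls k Phi f h X) x0 - diffop m q f x0| <= K * t ^+ (k - m).
Proof.
move=> mk fC s0 PhiW sig0 dsig C00 c10 C10 Cpos cells norming.
have PhiC : Ck k Phi by case: PhiW.
have cPhi : continuous Phi by case: (k) PhiC => [|k'] [].
have Phi0 u : 0 <= Phi u by case: PhiW.
have rho0 : 0 <= s * C0 by rewrite mulr_ge0// ltW.
set rho := s * C0 in rho0 *.
have [M M0 HM] := weight_deriv_bound x0 s0 (ltW C00) PhiW.
have [B B0 HB] := monomial_bound k rho0.
have [p [pk pD [Ct Ct0 HT]]] := taylor_polynomial x0 fC.
have [phi0 phi00 Hphi] := weight_lower_bound (mulr_ge0 (ler0n _ 2) (ltW sig0)) dsig PhiW.
have /choice[Bm HBm] (beta : mpoly.bmultinom d k) : exists Bb,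
    deriv_bound 1 (0 : V) m Bb (monomial beta).
  have [Bb _ H] := Ck_deriv_bound (0 : R) (@Ck_monomial R d m beta).
  by exists Bb; apply: H; rewrite normr0.
have Bm0 beta : 0 <= Bm beta := deriv_bound_ge0 (HBm beta).
pose I := mpoly.bmultinom d k.
pose D : R := #|{: I}|%:R.
have D0 : 0 < D.
  rewrite /D ltr0n; apply/card_gt0P.
  have k0 : (0 < k)%N by exact: leq_ltn_trans mk.
  have m0k : (mpoly.mdeg (mpoly.mnm0 : mpoly.multinom d) < k)%N.
    by rewrite mpoly.mdeg0.
  by exists (mpoly.BMultinom m0k).
(* At least [c1 * L] points lie in the norming cell, each with weight at least [phi0] and polynomial
   value at least N / C. *)
pose lamK := phi0 * c1 / C ^+ 2.
have lamK0 : 0 < lamK by rewrite divr_gt0 ?mulr_gt0 ?exprn_gt0.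
(* At most [C1 * L] active points, each with weight of size [M] and two monomials of size [B]; in
   [eK] one monomial is replaced by the Taylor remainder. *)
pose gK := C1 * (M * B * B).
have gK0 : 0 <= gK by rewrite !mulr_ge0// ltW.
pose eK := C1 * (M * B * (Ct * rho ^+ k)).
have eK0 : 0 <= eK by rewrite !mulr_ge0 ?exprn_ge0// ltW.
pose S := solve_const (I := I) (gK / (lamK / D)) m.
pose K1 := \sum_(b : I) 2 ^+ m * (S * (eK / (lamK / D)) * Bm b).
have lamD0 : 0 < lamK / D by exact: divr_gt0.
have kap0 : 0 <= gK / (lamK / D) by exact: divr_ge0 (ltW lamD0).
have S0 : 0 <= S := le_trans ler01 (solve_const_ge1 m kap0).
have K10 : 0 <= K1.
  apply: sumr_ge0 => b _; rewrite mulr_ge0 ?exprn_ge0// mulr_ge0// mulr_ge0//.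
  exact: divr_ge0 (ltW lamD0).
exists (1 + \sum_(al : mpoly.bmultinom d m.+1) `|q al| * K1).
  by rewrite ltr_pwDl// sumr_ge0// => al _; rewrite mulr_ge0.
move=> t h n X L t0 t1 th hC rhot L0 Hcell Hball.
have h0 : 0 < h := lt_le_trans t0 th.
have tn0 : t != 0 by rewrite gt_eqF.
pose w i xi := Phi (h^-1 *: (xi - X i)).
pose act i := `|X i - x0| <= rho * t.
have Hw i : deriv_bound t x0 m (if act i then M else 0) (w i).
  exact: deriv_bound_leq (ltnW mk) (HM _ _ _ t0 th hC).
pose U i : V := t^-1 *: (X i - x0).
pose b (be : I) i := monomial be (U i).
have bB be i : act i -> `|b be i| <= B.
  move=> ai; apply: HB; rewrite /U normrZ normfV (gtr0_norm t0).
  by rewrite ler_pdivrMl// mulrC.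
pose r i := f (X i) - shift_eval x0 p (X i).
have rB i : act i -> `|r i| <= Ct * rho ^+ k * t ^+ k.
  move=> ai; apply: (le_trans (HT _ _)); first exact: le_trans ai rhot.
  by rewrite -mulrA ler_wpM2l// -exprMn lerXn2r// nnegrE ?mulr_ge0// ltW.
have cardact : #|act|%:R <= C1 * L by [].
pose G (be ga : I) xi := \sum_i w i xi * b be i * b ga i.
pose ep (be : I) xi := \sum_i w i xi * b be i * r i.
have cw i : continuous (w i).
  move=> xi; apply: (@continuous_comp _ _ _ (fun x : V => h^-1 *: (x - X i)) Phi).
    apply: continuousZl_tmp; apply: (@continuousB _ _ _ id (cst (X i))) => //.
    exact: cst_continuous.
  exact: cPhi.
have weighted (v : 'I_n -> R) (N : R) : (forall i, act i -> `|v i| <= N) -> 0 <= N ->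
    deriv_bound t x0 m (C1 * L * (M * N)) (fun xi => \sum_i w i xi * v i).
  move=> vN N0.
  have H i : true -> deriv_bound t x0 m (if act i then M * N else 0)
      (fun xi => w i xi * v i).
    move=> _; have := deriv_boundZ (v i) (Hw i).
    rewrite (_ : (fun x => v i * w i x) = (fun xi => w i xi * v i)); last first.
      by apply/funext => x; rewrite mulrC.
    apply: deriv_bound_le => //; rewrite /act; case: ifP => ai; last by rewrite mulr0.
    by rewrite mulrC ler_wpM2l// vN.
  apply: (deriv_bound_le t0 _ (deriv_bound_sum t0 (index_enum _) H)).
  by rewrite sum_if_card ler_wpM2r// mulr_ge0.
have HG be ga : deriv_bound t x0 m (gK * L) (G be ga).
  rewrite (_ : G be ga = (fun xi => \sum_i w i xi * (b be i * b ga i))).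
    rewrite (_ : gK * L = C1 * L * (M * (B * B))); last by rewrite /gK; ring.
    apply: weighted; last exact: mulr_ge0.
    by move=> i ai; rewrite normrM ler_pM// bB.
  by apply/funext => xi; apply: eq_bigr => i _; rewrite mulrA.
have Hep be : deriv_bound t x0 m (eK * L * t ^+ k) (ep be).
  rewrite (_ : ep be = (fun xi => \sum_i w i xi * (b be i * r i))).
    rewrite (_ : eK * L * t ^+ k = C1 * L * (M * (B * (Ct * rho ^+ k * t ^+ k))));
      last by rewrite /eK; ring.
    apply: weighted; last first.
      by rewrite !mulr_ge0 ?exprn_ge0// ltW.
    by move=> i ai; rewrite normrM ler_pM ?bB ?rB.
  by apply/funext => xi; apply: eq_bigr => i _; rewrite mulrA.
have pos : \forall xi \near x0, forall c : I -> R, exists2 N, (forall be, `|c be| <= N) &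
    (lamK * L) * N ^+ 2 <= \sum_i (\sum_be c be * b be i) ^+ 2 * w i xi.
  (* The displacement [h * sig] of [xi] and the distance [t * sig <= h * sig] from the cell to [x0]
     add up to the radius [2 * sig], in units of [h], on which the weight is bounded below. *)
  have near1 : \forall xi \near x0, `|xi - x0| <= h * sig.
    apply/nbhs_normP; exists (h * sig) => /=; first exact: mulr_gt0.
    by move=> xi /=; rewrite distrC => /ltW.
  apply: filterS near1 => xi xix c; have [l Hl] := norming c.
  pose N := \big[Num.max/0]_be `|c be|.
  have N0 : 0 <= N by apply/bigmax_geP; left.
  exists N; first by move=> be; exact: (le_bigmax _ (fun be => `|c be|)).
  pose cell : pred 'I_n :=
    [pred i | `|X i - (x0 + t *: \row_r a r (l r))| <= eps * t].
  have cellU i : cell i -> `|U i - \row_r a r (l r)| <= eps.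
    rewrite /cell /= => Xi; rewrite -[\row_r _](scalerK tn0) -scalerBr normrZ.
    by rewrite normfV (gtr0_norm t0) ler_pdivrMl// mulrC -addrA -opprD.
  have Ncell i : cell i -> N <= C * `|\sum_be c be * b be i|.
    move=> /cellU Ui; apply/bigmax_leP; split; first by rewrite mulr_ge0// ltW.
    by move=> be _; exact: Hl.
  have wcell i : cell i -> phi0 <= w i xi.
    move=> /cellU /cells Ui; apply: Hphi.
    rewrite (_ : xi - X i = (xi - x0) - t *: U i); last first.
      by rewrite /U scalerA divff// scale1r opprB addrA subrK.
    rewrite normrZ normfV (gtr0_norm h0) ler_pdivrMl//.
    have tU : `|t *: U i| <= h * sig.
      by rewrite normrZ (gtr0_norm t0) ler_pM// ltW.
    rewrite (le_trans (ler_normB _ _))// (_ : h * (2 * sig) = h * sig + h * sig).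
      exact: lerD.
    by ring.
  apply: (@le_trans _ _ (#|cell|%:R * (N ^+ 2 / C ^+ 2 * phi0))).
    rewrite (_ : lamK * L * N ^+ 2 = (c1 * L) * (N ^+ 2 / C ^+ 2 * phi0)).
      by rewrite ler_wpM2r ?Hcell// !mulr_ge0 ?invr_ge0 ?exprn_ge0// ltW.
    by rewrite /lamK; field; rewrite gt_eqF.
  rewrite -sum_if_card; apply: ler_sum => i _; case: ifP => [ci|_]; last first.
    by rewrite mulr_ge0 ?sqr_ge0 ?Phi0.
  apply: ler_pM; rewrite ?wcell// ?mulr_ge0 ?invr_ge0 ?sqr_ge0 ?(ltW phi00)//.
  rewrite ler_pdivrMr ?exprn_gt0// mulrC -[leRHS]ger0_norm; last first.
    by rewrite mulr_ge0 ?sqr_ge0// exprn_ge0// ltW.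
  rewrite normrM !normrX (gtr0_norm Cpos) -exprMn lerXn2r ?nnegrE ?Ncell//.
  by rewrite mulr_ge0// ltW.
have stab : \forall xi \near x0, forall (c : I -> R) A,
    (forall be, `|\sum_ga G be ga xi * c ga| <= A) ->
    forall be, `|c be| <= A / (lamK * L / D).
  apply: filterS pos => xi pos; apply: quadratic_form_stability => //.
  exact: mulr_gt0.
have cG be ga : continuous (G be ga).
  apply: continuous_big => [|i _]; first exact: add_continuous.
  move=> xi; apply: (continuousM (continuousM (cw i xi) _)).
    exact: (@cst_continuous _ _ (b be i) xi).
  exact: (@cst_continuous _ _ (b ga i) xi).
have [||e [He Ge]] := smooth_linear_solution (j := m) (eps := ep) t0 stab cG.
- by move=> be ga; eexists; exact: HG.
- by move=> be; eexists; exact: Hep.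
have lamL0 : 0 < lamK * L / D by rewrite divr_gt0// mulr_gt0.
have eB be : deriv_bound t x0 m (S * (eK / (lamK / D)) * t ^+ k) (e be).
  have := linear_solve_bound t0 lamL0 (mulr_ge0 gK0 (ltW L0)) stab HG Hep He Ge be.
  rewrite (_ : gK * L / (lamK * L / D) = gK / (lamK / D)); last first.
    by field; rewrite !gt_eqF.
  rewrite (_ : eK * L * t ^+ k / (lamK * L / D) = eK / (lamK / D) * t ^+ k).
    by rewrite mulrA.
  by field; rewrite !gt_eqF.
have aff be : deriv_bound t x0 m (Bm be) (fun xi => monomial be (t^-1 *: (xi - x0))).
  by apply: deriv_bound_affine; rewrite // subrr scaler0.
have [p2 [p2k p2E]] := meval_affine (- x0) 1 pk.
have [cT cTE] := local_poly_of_mpoly x0 tn0 p2k.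
have TE x : shift_eval x0 p x = local_poly x0 t cT x.
  by rewrite -cTE p2E scale1r addrC.
(* The evaluation point moves together with the minimizer: both [e] and the monomials vary with
   [xi], and the product rule combines their bounds. *)
pose u xi := \sum_be e be xi * monomial be (t^-1 *: (xi - x0)).
have Hu : deriv_bound t x0 m (K1 * t ^+ k) u.
  rewrite /K1 mulr_suml; apply: deriv_bound_sum => // be _.
  rewrite (_ : _ * _ = 2 ^+ m * (S * (eK / (lamK / D)) * t ^+ k * Bm be)).
    exact: deriv_boundM.
  by ring.
have [AT HAT] : exists A, deriv_bound t x0 m A (shift_eval x0 p).
  eexists; rewrite (_ : shift_eval x0 p = (fun x => \sum_be cT be *
    monomial be (t^-1 *: (x - x0)))); last by apply/funext.
  by apply: deriv_bound_sum => // be _; apply: deriv_boundZ.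
have uniq : \forall xi \near x0, exists P,
    [/\ mls_minimizer k Phi f h X xi P,
      forall P', mls_minimizer k Phi f h X xi P' -> P = P' &
      mpoly.meval (xi 0) P = shift_eval x0 p xi + u xi].
  apply: filterS2 pos Ge => xi pos Ge.
  pose cs be := cT be + e be xi.
  have csE x : local_poly x0 t cs x = shift_eval x0 p x +
      \sum_be e be xi * monomial be (t^-1 *: (x - x0)).
    by rewrite TE /local_poly -big_split /=; apply: eq_bigr => be _; rewrite mulrDl.
  have [P [Pk PE]] := mpoly_of_local_poly x0 t cs.
  have [||Pmin Puniq] := mls_minimizer_unique (Phi := Phi) (f := f) (h := h) (X := X)
      (xi := xi) tn0 Pk PE.
  (* The normal equations for the coefficients [cT + e] are the system [G e = ep], because the
     Taylor part only leaves the residuals [r]. *)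
  - move=> be; rewrite -/(b be _).
    transitivity (\sum_ga G be ga xi * e ga xi - ep be xi); last first.
      by rewrite Ge subrr.
    under [in RHS]eq_bigr do rewrite mulr_suml.
    rewrite exchange_big /= /ep -sumrB; apply: eq_bigr => i _.
    rewrite csE -/(b be i) -/(w i xi).
    rewrite (_ : shift_eval x0 p (X i) + _ - f (X i) =
      \sum_ga e ga xi * b ga i - r i); last by rewrite /r /b /U; ring.
    rewrite mulrBl mulrBl; congr (_ - _); last by ring.
    rewrite !mulr_suml; apply: eq_bigr => ga _; ring.
  - move=> c'; have [N c'N lamN] := pos c'.
    have lN : 0 <= lamK * L * N ^+ 2 by rewrite mulr_ge0 ?sqr_ge0// mulr_ge0// ltW.
    split; first exact: le_trans lamN.
    move=> S0eq be; have : lamK * L * N ^+ 2 <= 0 by rewrite -S0eq.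
    rewrite (pmulr_rle0 _ (mulr_gt0 lamK0 L0)) => N2.
    have : N ^+ 2 == 0 by rewrite eq_le N2 sqr_ge0.
    rewrite sqrf_eq0 => /eqP NE; have := c'N be.
    by rewrite NE normr_le0 => /eqP.
  exists P; split => //.
  by rewrite PE csE.
(* Uniqueness of the minimizer makes the choice in [mls] harmless, and equality on a neighbourhood
   passes to all derivatives at [x0]. *)
have mlsE : \forall xi \near x0, shift_eval x0 p xi + u xi = mls k Phi f h X xi.
  apply: filterS uniq => xi [P [Pmin Puniq <-]].
  rewrite /mls (xget_subset1 _ (x := P))//.
  by move=> P1 P2 /= /Puniq <- /Puniq <-.
split; first by apply: filterS uniq => xi [P [Pmin Puniq _]]; exists P.
rewrite /diffop -sumrB (le_trans (ler_norm_sum _ _ _))//.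
rewrite mulrDl mul1r -[leLHS]add0r lerD ?exprn_ge0 ?(ltW t0)//.
rewrite mulr_suml; apply: ler_sum => al _.
have alm : (mpoly.mdeg al <= m)%N by rewrite -ltnS mpoly.bmdeg.
rewrite -mulrBr -(mpartial_near _ mlsE) (mpartialD alm HAT Hu).
rewrite pD ?(leq_ltn_trans alm)// addrAC subrr add0r normrM -mulrA ler_wpM2l//.
apply: (le_trans (mpartial_le alm Hu)).
rewrite -mulrA ler_wpM2l// -expfB ?(leq_ltn_trans alm mk)//.
by rewrite ler_wiXn2l// ?ltW// leq_sub2l.
Qed.

End deterministic_error.

(** * Tail bounds for independent samples *)

Section indicator_sums.
Context {disp : measure_display} {T : measurableType disp} {R : realType}.
Variable P : probability T R.

Lemma mu_ext_bigsetU (I : Type) (r : seq I) (Q : pred I) (F : I -> set T) :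
  (mu_ext P (\big[setU/set0]_(i <- r | Q i) F i) <=
   \sum_(i <- r | Q i) mu_ext P (F i))%E.
Proof.
elim/big_ind2 : _ => //; first by rewrite outer_measure0.
move=> x a A b xa Ab; apply: (le_trans (outer_measureU2 (mu_ext P) _ _)).
exact: leeD.
Qed.

Lemma probability_fine (A : set T) : measurable A -> P A = (fine (P A))%:E.
Proof. by move=> mA; rewrite fineK// fin_num_measure. Qed.

Lemma integral_indic_sum (J : finType) (c : J -> R) (F : J -> set T) :
  (forall j, 0 <= c j) -> (forall j, measurable (F j)) ->
  (\int[P]_w (\sum_j c j * \1_(F j) w)%:E)%E = (\sum_j c j * fine (P (F j)))%:E.
Proof.
move=> c0 mF; under eq_integral do rewrite -sumEFin.
rewrite ge0_integral_sum//; last 2 first.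
- move=> j; apply/measurable_EFinP; apply: measurable_funM.
    exact: measurable_cst.
  exact/measurable_indic/mF.
- by move=> j w _; rewrite lee_fin mulr_ge0.
rewrite -sumEFin; apply: eq_bigr => j _.
under eq_integral do rewrite EFinM.
rewrite ge0_integralZl_EFin//; last first.
  exact/measurable_EFinP/measurable_indic/mF.
by rewrite integral_indic// setIT EFinM -probability_fine.
Qed.

Lemma le_indic_sum (J J' : finType) (c : J -> R) (F : J -> set T)
    (c' : J' -> R) (F' : J' -> set T) :
  (forall j, 0 <= c j) -> (forall j, measurable (F j)) ->
  (forall j, 0 <= c' j) -> (forall j, measurable (F' j)) ->
  (forall w, \sum_j c j * \1_(F j) w <= \sum_j c' j * \1_(F' j) w) ->
  \sum_j c j * fine (P (F j)) <= \sum_j c' j * fine (P (F' j)).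
Proof.
move=> c0 mF c'0 mF' le; rewrite -lee_fin -!integral_indic_sum//.
have mS (I : finType) (a : I -> R) (A : I -> set T) : (forall j, measurable (A j)) ->
    measurable_fun setT (fun w => (\sum_j a j * \1_(A j) w)%:E).
  move=> mA; apply/measurable_EFinP; apply: measurable_sum => j.
  by apply: measurable_funM; [exact: measurable_cst|exact/measurable_indic/mA].
apply: ge0_le_integral => //.
- by move=> w _; rewrite lee_fin sumr_ge0// => j _; rewrite mulr_ge0.
- exact: mS.
- exact: mS.
- by move=> w _; rewrite lee_fin.
Qed.

(* Second moment method, in the form [1_(N = 0) <= (N / M - 1) ^ 2] for the
   number [N] of events that occur and its mean [M]. *)
Lemma second_moment (I : finType) (E : I -> set T) : (forall i, measurable (E i)) ->
  (forall i j, i != j ->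
    fine (P (E i `&` E j)) <= fine (P (E i)) * fine (P (E j))) ->
  0 < \sum_i fine (P (E i)) ->
  (mu_ext P (\bigcap_i ~` E i) <= (\sum_i fine (P (E i)))^-1%:E)%E.
Proof.
move=> mE neg; set M := \sum_i _ => M0.
pose H := \bigcap_(i in [set: I]) ~` E i.
have mH : measurable H.
  by apply: fin_bigcap_measurable => // i _; exact: measurableC.
have -> : mu_ext P (\bigcap_i ~` E i) = (fine (P H))%:E.
  by rewrite measurable_mu_extE//; exact: probability_fine.
rewrite lee_fin.
(* The inequality is rearranged to [M ^+ 2 * 1_H + 2 * M * N <= M ^+ 2 + N ^+ 2], so that both sides
   are combinations of indicators with nonnegative coefficients. The index [None] carries the
   [M ^+ 2] terms. *)
pose c (o : option I) := if o is Some i then 2 * M else M ^+ 2.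
pose F (o : option I) := if o is Some i then E i else H.
pose c' (o : option (I * I)) := if o is Some _ then 1 else M ^+ 2.
pose F' (o : option (I * I)) := if o is Some ij then E ij.1 `&` E ij.2 else setT.
have sumO (J : finType) (g : option J -> R) : \sum_o g o = g None + \sum_j g (Some j).
  rewrite (bigD1 None)//=; congr (_ + _).
  rewrite (reindex_omap Some id)//=; last by case.
  by apply: eq_bigl => j; rewrite eqxx.
have := @le_indic_sum _ _ c F c' F'.
rewrite !sumO /= => /(_ _ _ _ _ _) Hle.
have {}Hle : M ^+ 2 * fine (P H) + \sum_i 2 * M * fine (P (E i)) <=
    M ^+ 2 * fine (P setT) + \sum_ij 1 * fine (P (E ij.1 `&` E ij.2)).
  apply: Hle.
  - by case=> [i|]; rewrite /c ?sqr_ge0// mulr_ge0// ltW.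
  - by case.
  - by case=> [i|]; rewrite /c' ?sqr_ge0.
  - by case=> [i|] //=; exact: measurableI.
  move=> w; rewrite !sumO /= indicT mulr1.
  pose N := \sum_i \1_(E i) w : R.
  have -> : \sum_(ij : I * I) 1 * \1_(E ij.1 `&` E ij.2) w = N ^+ 2.
    rewrite -(pair_bigA _ (fun i j => 1 * \1_(E i `&` E j) w)) /= expr2 mulr_suml.
    apply: eq_bigr => i _; rewrite mulr_sumr; apply: eq_bigr => j _.
    by rewrite mul1r indicI.
  rewrite -mulr_sumr -/N.
  have [Hw|nHw] := pselect (H w).
    have -> : N = 0.
      by rewrite /N big1// => i _; rewrite indicE memNset//; exact: Hw.
    by rewrite mulr0 expr0n addr0 addr0 ler_piMr// ?sqr_ge0// indicE; case: (_ \in _).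
  rewrite indicE memNset// mulr0 add0r.
  have := sqr_ge0 (N - M); rewrite sqrrB; lra.
move: Hle; rewrite probability_setT /= mulr1 -mulr_sumr -/M.
(* Off the diagonal the correlation hypothesis gives at most [M ^+ 2]; the diagonal adds [M]. *)
have : \sum_(ij : I * I) 1 * fine (P (E ij.1 `&` E ij.2)) <= M ^+ 2 + M.
  rewrite -(pair_bigA _ (fun i j => 1 * fine (P (E i `&` E j)))) /=.
  have -> : M ^+ 2 + M = \sum_i (fine (P (E i)) * M + fine (P (E i))).
    by rewrite big_split /= -mulr_suml expr2.
  apply: ler_sum => i _; rewrite (bigD1 i)//= mul1r setIid addrC lerD2r.
  rewrite /M mulr_sumr [leRHS](bigD1 i)//= -[leLHS]add0r lerD//.
    by rewrite mulr_ge0// fine_ge0.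
  by apply: ler_sum => j ji; rewrite mul1r neg// eq_sym.
move=> H1 H2; rewrite -(ler_pM2l (exprn_gt0 2 M0)).
rewrite [leRHS](_ : _ = M); last by rewrite expr2 mulfK ?gt_eqF.
by have := le_trans H2 (lerD (lexx _) H1); lra.
Qed.

End indicator_sums.

(** * Miss, occupancy and Chernoff bounds *)

Section iid_bounds.
Context {R : realType} {d : nat}.
Local Notation V := 'rV[R]_d.
Context {disp : measure_display} {T : measurableType disp}.
Variables (P : probability T R) (mu : probability V R).
Variables (n : nat) (X : 'I_n -> {RV P >-> V}).
Hypothesis X_iid : iid_sample mu X.
Implicit Types A : set V.
Local Notation pr A := (fine (mu A)).

Lemma pr_ge0 A : 0 <= pr A.
Proof. by rewrite fine_ge0. Qed.

Lemma pr_setC A : measurable A -> pr (~` A) = 1 - pr A.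
Proof.
by move=> mA; rewrite probability_setC// fineB ?fin_num_measure.
Qed.

Lemma pr_le1 A : measurable A -> pr A <= 1.
Proof. by move=> mA; rewrite -subr_ge0 -pr_setC// pr_ge0. Qed.

Lemma measurable_sample (A : 'I_n -> set V) : (forall i, measurable (A i)) ->
  measurable (\bigcap_(i in [set: 'I_n]) X i @^-1` A i).
Proof.
move=> mA; apply: fin_bigcap_measurable => // i _.
by rewrite -[X in measurable X]setTI; exact: measurable_funP.
Qed.

Lemma sample_prob (A : 'I_n -> set V) : (forall i, measurable (A i)) ->
  P (\bigcap_(i in [set: 'I_n]) X i @^-1` A i) = (\prod_i pr (A i))%:E.
Proof.
move=> mA; case: X_iid => indep dist.
rewrite indep// -prodEFin; apply: eq_bigr => i _.
rewrite -probability_fine//; have := dist i _ (mA i); exact.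
Qed.

Lemma miss_prob A : measurable A ->
  P (\bigcap_(i in [set: 'I_n]) X i @^-1` ~` A) = ((1 - pr A) ^+ n)%:E.
Proof.
move=> mA; rewrite (sample_prob (fun=> measurableC mA)).
by rewrite pr_setC// prodr_const card_ord.
Qed.

Lemma onem_exp_le (p : R) : p <= 1 -> (1 - p) ^+ n <= expR (- (n%:R * p)).
Proof.
move=> p1; rewrite -mulrN mulr_natl -[X in expR X]mulr_natr mulrC expRM_natl.
by rewrite lerXn2r ?nnegrE ?subr_ge0 ?expR_ge0// expR_ge1Dx.
Qed.

Lemma miss_le A : measurable A ->
  (mu_ext P [set w | forall i, ~ A (X i w)] <= (expR (- (n%:R * pr A)))%:E)%E.
Proof.
move=> mA; rewrite (_ : [set w | _] = \bigcap_(i in [set: 'I_n]) X i @^-1` ~` A).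
  rewrite measurable_mu_extE; last exact: (measurable_sample (fun=> measurableC mA)).
  by rewrite [leLHS](miss_prob mA) lee_fin onem_exp_le// pr_le1.
by apply/seteqP; split => w /= H i; [move=> _; exact: H|exact: H].
Qed.

(** Disjoint cells of masses a and b are both missed with probability (1 - a - b) ^ n <= ((1 - a) (1
    - b)) ^ n. Misses are thus negatively correlated, and [second_moment] applies to them. *)
Lemma occupancy_le (I : finType) (A : I -> set V) : (forall z, measurable (A z)) ->
  (forall z z', z != z' -> A z `&` A z' = set0) ->
  0 < \sum_z (1 - pr (A z)) ^+ n ->
  (mu_ext P [set w | forall z, exists i, A z (X i w)] <=
   (\sum_z (1 - pr (A z)) ^+ n)^-1%:E)%E.
Proof.
move=> mA dA sum0.
pose E z := \bigcap_(i in [set: 'I_n]) X i @^-1` ~` A z.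
have PE z : fine (P (E z)) = (1 - pr (A z)) ^+ n by rewrite [P _](miss_prob (mA z)).
have mE z : measurable (E z) by exact: (measurable_sample (fun=> measurableC (mA z))).
have sumE : \sum_z fine (P (E z)) = \sum_z (1 - pr (A z)) ^+ n.
  by apply: eq_bigr.
have := @second_moment _ _ _ P I E mE; rewrite sumE => /(_ _ sum0) H.
apply: (le_trans _ (H _)).
  apply: le_outer_measure => w /= Hw z _ Ez.
  have [i Ai] := Hw z; exact: (Ez i).
move=> z z' zz'; rewrite !PE.
have mU : measurable (A z `|` A z') by exact: measurableU.
have -> : E z `&` E z' = \bigcap_(i in [set: 'I_n]) X i @^-1` ~` (A z `|` A z').
  rewrite /E -bigcapI; apply: eq_bigcapr => i _.
  by rewrite -preimage_setI setCU.
rewrite [P _](miss_prob mU) /= -exprMn lerXn2r// ?nnegrE ?mulr_ge0 ?subr_ge0 ?pr_le1//.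
rewrite measureU//; last exact: dA.
rewrite fineD ?fin_num_measure//.
have := mulr_ge0 (pr_ge0 (A z)) (pr_ge0 (A z')); lra.
Qed.

(** The event is split according to the finite pattern of memberships in the set, whose probability
    factorizes by independence. *)
Lemma count_event_le (a : V -> bool) (Q : pred {ffun 'I_n -> bool}) :
  measurable [set x | a x] ->
  (mu_ext P [set w | Q [ffun i => a (X i w)]] <=
    (\sum_(b | Q b) \prod_i (if b i then pr [set x | a x] else 1 - pr [set x | a x]))%:E)%E.
Proof.
move=> mA; set A := [set x | a x] in mA *.
pose B (b : {ffun 'I_n -> bool}) i : set V := if b i then A else ~` A.
have mB b i : measurable (B b i) by rewrite /B; case: ifP => _ //; exact: measurableC.
pose E b := \bigcap_(i in [set: 'I_n]) X i @^-1` B b i.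
apply: (@le_trans _ _ (mu_ext P (\big[setU/set0]_(b | Q b) E b))).
  apply: le_outer_measure => w /= Qw; rewrite (bigD1 _ Qw); left => i _ /=.
  by rewrite /B ffunE; case: ifP => // /negP.
apply: (le_trans (mu_ext_bigsetU _ _ _ _)); rewrite -sumEFin; apply: lee_sum => b _.
rewrite measurable_mu_extE; last exact: measurable_sample.
rewrite [leLHS](sample_prob (mB b)) lee_fin le_eqVlt; apply/orP; left; apply/eqP.
by apply: eq_bigr => i _; rewrite /B; case: ifP => // _; rewrite pr_setC.
Qed.

(** Chernoff's bound, with the exponential moment computed as a finite sum over patterns. The sign
    of [theta] selects the tail, so one lemma covers both. *)
Lemma count_tail_le (a : V -> bool) (theta r : R) : measurable [set x | a x] ->
  (mu_ext P [set w | (0 <= theta * (#|[pred i | a (X i w)]|%:R - r))%R] <=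
   (expR (n%:R * (pr [set x | a x] * (expR theta - 1)) - theta * r))%:E)%E.
Proof.
move=> mA; set p := pr _.
have p0 : 0 <= p by exact: pr_ge0.
have p1 : p <= 1 by exact: pr_le1.
pose Q (b : {ffun 'I_n -> bool}) := 0 <= theta * (#|[pred i | b i]|%:R - r).
rewrite (_ : [set w | _] = [set w | Q [ffun i => a (X i w)]]); last first.
  apply/seteqP; split => w /=; rewrite /Q.
    by rewrite (eq_card (B := [pred i | [ffun i => a (X i w)] i]))// => i;
      rewrite !inE ffunE.
  by rewrite (eq_card (B := [pred i | a (X i w)]))// => i; rewrite !inE ffunE.
apply: (le_trans (count_event_le _ mA)); rewrite lee_fin -/p.
pose W (b : {ffun 'I_n -> bool}) := \prod_i (if b i then p else 1 - p).
have W0 b : 0 <= W b by apply: prodr_ge0 => i _; case: ifP => _; rewrite ?subr_ge0.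
apply: (@le_trans _ _ (\sum_b W b * expR (theta * (#|[pred i | b i]|%:R - r)))).
  rewrite big_mkcond /=; apply: ler_sum => b _; case: ifPn => Qb.
    have e1 : 1 <= expR (theta * (#|[pred i | b i]|%:R - r)).
      by rewrite -[leLHS]expR0 ler_expR.
    exact: (ler_peMr (W0 b) e1).
  by rewrite mulr_ge0 ?expR_ge0.
have -> : \sum_b W b * expR (theta * (#|[pred i | b i]|%:R - r)) =
    expR (- (theta * r)) * (p * expR theta + (1 - p)) ^+ n.
  transitivity (expR (- (theta * r)) * \prod_(i < n) \sum_(c : bool)
      (if c then p * expR theta else 1 - p)); last first.
    by congr (_ * _); rewrite prodr_const card_ord big_bool.
  rewrite bigA_distr_bigA mulr_sumr; apply: eq_bigr => b _ /=.
  rewrite mulrBr expRD mulrA mulrC; congr (_ * _).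
  rewrite [theta * _]mulrC expRM_natl -prodr_const big_mkcond /= -big_split /=.
  by apply: eq_bigr => i _; rewrite inE; case: ifP => _; rewrite ?mulr1.
rewrite [X in _ <= expR X]addrC expRD ler_wpM2l ?expR_ge0// expRM_natl.
rewrite lerXn2r ?nnegrE ?expR_ge0//.
  by rewrite addr_ge0 ?subr_ge0// mulr_ge0 ?expR_ge0.
apply: le_trans (expR_ge1Dx _); lra.
Qed.

End iid_bounds.

(** * Geometry of the domain *)

Section cone_geometry.
Context {R : realType} {d : nat}.
Local Notation V := 'rV[R]_d.
Implicit Types (Omega : set V) (x y z xi : V).

Lemma norm2_sqr x : norm2 x ^+ 2 = \sum_j x 0 j ^+ 2.
Proof. by rewrite sqr_sqrtr// sumr_ge0// => j _; exact: sqr_ge0. Qed.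

(** A vector close to [rho *: xi] has nearly the length [rho] and nearly the direction [xi], hence
    stays in the cone. Sup balls in [Omega] replace cones because their Lebesgue measure is
    explicit. *)
Lemma cone_ball Omega : interior_cone_condition Omega ->
  exists kappa r0 : R, [/\ 0 < kappa <= 1, 0 < r0 &
    forall x, Omega x -> exists2 xi : V, `|xi| <= 1 &
      forall rho z, 0 < rho <= r0 -> `|z - (x + rho *: xi)| <= kappa * rho ->
        Omega z].
Proof.
move=> [th [r [/andP[th0 thpi] r0 cones]]].
pose c := cos th.
have pihalf : pi / 2 < pi :> R by rewrite ltr_pdivrMr// ltr_pMr ?pi_gt0// ltr1n.
have s0 : 0 < sin th by rewrite sin_gt0_pi// th0 (lt_trans thpi).
have c0 : 0 < c.
  by rewrite /c cos_gt0_pihalf// thpi andbT (lt_trans _ th0)// oppr_lt0 divr_gt0// pi_gt0.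
have c1 : c < 1.
  have := cos2Dsin2 th; rewrite -/c => cs.
  have : 0 < sin th ^+ 2 by rewrite exprn_gt0.
  rewrite ltNge => /negP H; rewrite ltNge; apply/negP => c1; apply: H.
  have : 1 <= c ^+ 2 by rewrite exprn_ege1.
  lra.
(* Small enough for [c * (1 + ka) <= 1 - ka], which is the angle condition once length and inner
   product are known up to [ka * rho]. *)
pose ka : R := (1 - c) / 4.
have ka0 : 0 < ka by rewrite divr_gt0// subr_gt0.
(* The denominator absorbs the factor [d] lost between the sup norm and both the Euclidean norm and
   the inner product with [xi]. *)
pose kappa : R := ka / (d%:R + 1).
have d1 : 0 < d%:R + 1 :> R by rewrite ltr_wpDl.
have dka : d%:R * kappa <= ka.
  rewrite mulrCA ger_pMr// ler_pdivrMr// mul1r lerDl//.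
exists kappa, (r / 2); split; first last.
- move=> x Ox; have [xi xi1 Hcone] := cones x Ox.
  exists xi; first by rewrite (le_trans (le_norm2 _))// xi1.
  move=> rho z /andP[rho0 rhor] zle.
  pose e := z - (x + rho *: xi).
  have zE : z - x = rho *: xi + e by apply/rowP => j; rewrite !mxE; ring.
  have xij j : `|xi 0 j| <= 1.
    by rewrite (le_trans (norm_coord _ _))// (le_trans (le_norm2 _))// xi1.
  have dot_e : `|dotrv e xi| <= ka * rho.
    apply: (le_trans (ler_norm_sum _ _ _)).
    apply: (@le_trans _ _ (\sum_(j < d) kappa * rho)); last first.
      by rewrite sumr_const card_ord -[leLHS]mulr_natl mulrA ler_wpM2r// ltW.
    apply: ler_sum => j _; rewrite normrM -[leRHS]mulr1 ler_pM//.
    exact: le_trans (norm_coord _ _) zle.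
  have e2 : norm2 e <= ka * rho.
    apply: (le_trans (norm2_le _)); apply: (@le_trans _ _ (d%:R * (kappa * rho))).
      by rewrite ler_wpM2l.
    by rewrite mulrA ler_wpM2r// ltW.
  have xixi : dotrv xi xi = 1.
    have := norm2_sqr xi; rewrite xi1 expr1n => ->.
    by apply: eq_bigr => j _; rewrite expr2.
  pose v := rho *: xi + e.
  have v2 : norm2 v ^+ 2 = rho ^+ 2 + 2 * rho * dotrv e xi + norm2 e ^+ 2.
    rewrite (_ : rho ^+ 2 = rho ^+ 2 * dotrv xi xi); last by rewrite xixi mulr1.
    rewrite !norm2_sqr /dotrv !mulr_sumr -!big_split /=.
    by apply: eq_bigr => j _; rewrite /v !mxE; ring.
  have vxi : dotrv v xi = rho + dotrv e xi.
    rewrite (_ : rho + _ = rho * dotrv xi xi + dotrv e xi); last first.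
      by rewrite xixi mulr1.
    rewrite /dotrv mulr_sumr -big_split /=.
    by apply: eq_bigr => j _; rewrite /v !mxE; ring.
  have nv0 : 0 <= norm2 v by exact: sqrtr_ge0.
  have ne0 : 0 <= norm2 e by exact: sqrtr_ge0.
  have karho0 : 0 < ka * rho by exact: mulr_gt0.
  have /andP[de1 de2] : - (ka * rho) <= dotrv e xi <= ka * rho by rewrite -ler_norml.
  have v_le : norm2 v <= (1 + ka) * rho.
    have k1 : 0 <= (1 + ka) * rho by apply: ltW; rewrite mulr_gt0// addr_gt0.
    rewrite -(@ler_pXn2r _ 2)// ?nnegrE//.
    have : norm2 e ^+ 2 <= (ka * rho) ^+ 2 by rewrite lerXn2r// nnegrE ltW.
    have : rho * dotrv e xi <= rho * (ka * rho) by rewrite ler_wpM2l// ltW.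
    rewrite v2 => H1 H2.
    rewrite [leRHS](_ : _ = rho ^+ 2 + 2 * (rho * (ka * rho)) + (ka * rho) ^+ 2).
      by rewrite lerD// -mulrA lerD2l ler_wpM2l.
    by ring.
  have ka14 : ka <= 1 / 4 by rewrite /ka; lra.
  have vxi_ge : (1 - ka) * rho <= dotrv v xi by rewrite vxi; lra.
  have v_gt0 : 0 < norm2 v.
    rewrite lt_def nv0 andbT -sqrf_eq0 gt_eqF// v2.
    have : rho * - (ka * rho) <= rho * dotrv e xi by rewrite ler_wpM2l// ltW.
    have : 0 < rho ^+ 2 by rewrite exprn_gt0.
    have : 0 <= norm2 e ^+ 2 by exact: sqr_ge0.
    have : ka * rho ^+ 2 <= 1 / 4 * rho ^+ 2 by rewrite ler_wpM2r// sqr_ge0.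
    move=> H1 H2 H3 H4.
    have -> : rho ^+ 2 + 2 * rho * dotrv e xi + norm2 e ^+ 2 =
      rho ^+ 2 + 2 * (rho * dotrv e xi) + norm2 e ^+ 2 by ring.
    have H5 : rho * - (ka * rho) = - (ka * rho ^+ 2) by ring.
    rewrite H5 in H4; lra.
  apply: Hcone; exists ((norm2 v)^-1 *: v), (norm2 v); split.
  + rewrite /norm2 (_ : \sum_j _ = (norm2 v)^-1 ^+ 2 * norm2 v ^+ 2).
      by rewrite -exprMn mulVf ?gt_eqF// expr1n sqrtr1.
    rewrite [norm2 v ^+ 2]norm2_sqr mulr_sumr; apply: eq_bigr => j _.
    by rewrite mxE exprMn.
  + rewrite (_ : dotrv _ _ = dotrv v xi / norm2 v); last first.
      by rewrite /dotrv mulr_suml; apply: eq_bigr => j _; rewrite mxE; ring.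
    rewrite ler_pdivlMr// -/c (le_trans _ vxi_ge)//.
    apply: (@le_trans _ _ (c * ((1 + ka) * rho))); first by rewrite ler_wpM2l// ltW.
    rewrite mulrA ler_wpM2r// ?ltW//; rewrite /ka; nra.
  + rewrite nv0 (le_trans v_le)//.
    apply: (@le_trans _ _ (2 * rho)); first by rewrite ler_wpM2r ?ltW//; lra.
    by rewrite mulrC -ler_pdivlMr.
  + by rewrite scalerA divff ?gt_eqF// scale1r /v -zE addrC subrK.
- by rewrite divr_gt0.
- rewrite divr_gt0//= ler_pdivrMr// mul1r.
  have : 0 <= d%:R :> R by []. 
  by rewrite /ka; lra.
Qed.

End cone_geometry.

Section fill_distance_bounds.
Context {R : realType} {d : nat}.
Local Notation V := 'rV[R]_d.
Variables (Omega : set V) (n : nat) (X : 'I_n -> V) (b : R).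
Hypothesis n_gt0 : (0 < n)%N.
Hypothesis near_sample : forall x, Omega x -> exists i, norm2 (x - X i) <= b.

Let dist x := inf [set norm2 (x - X i) | i in [set: 'I_n]].

Let dist_lb x : has_lbound [set norm2 (x - X i) | i in [set: 'I_n]].
Proof. by exists 0 => _ [i _ <-]; exact: sqrtr_ge0. Qed.

Let dist_le x : Omega x -> dist x <= b.
Proof.
by move=> /near_sample[i]; apply: le_trans; apply: ge_inf => //; exists i.
Qed.

Lemma fill_distance_le : Omega !=set0 -> fill_distance Omega X <= b.
Proof.
move=> [x Ox]; apply: ge_sup; first by exists (dist x), x.
by move=> _ [y Oy <-]; exact: dist_le.
Qed.

(** The covering hypothesis matters here too: it bounds the set of distances above, without which
    [sup] could take a default value. *)
Lemma fill_distance_ge (y : V) (t : R) : Omega y ->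
  (forall i, t <= norm2 (y - X i)) -> t <= fill_distance Omega X.
Proof.
move=> Oy ty; apply: (@le_trans _ _ (dist y)).
  apply: lb_le_inf; first by exists (norm2 (y - X (Ordinal n_gt0))), (Ordinal n_gt0).
  by move=> _ [i _ <-].
apply: ub_le_sup; last by exists y.
by exists b => _ [x Ox <-]; exact: dist_le.
Qed.

End fill_distance_bounds.

Section ball_measure.
Context {R : realType} {d : nat}.
Local Notation V := 'rV[R]_d.

Definition sup_ball (y : V) (r : R) : set V := [set x | `|x - y| <= r].

Lemma sup_ballE y r : 0 <= r -> sup_ball y r =
  [set x | forall j, (y - const_mx r) 0 j <= x 0 j <= (y + const_mx r) 0 j].
Proof.
move=> r0; apply/seteqP; split => x /= H.
  move=> j; have := le_trans (norm_coord (x - y) j) H.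
  by rewrite !mxE ler_norml => /andP[H1 H2]; apply/andP; split; lra.
apply: norm_rV_le => // j; have := H j; rewrite !mxE ler_norml => /andP[H1 H2].
by apply/andP; split; lra.
Qed.

Lemma measurable_sup_ball y r : 0 <= r -> measurable (sup_ball y r).
Proof.
move=> r0; rewrite (_ : sup_ball y r =
    \bigcap_(j in [set: 'I_d]) (fun x : V => x 0 j) @^-1`
      `[(y - const_mx r) 0 j, (y + const_mx r) 0 j]%classic).
  apply: fin_bigcap_measurable => // j _; rewrite -[X in measurable X]setTI.
  by apply: measurable_rV_coord => //; exact: measurable_itv.
rewrite sup_ballE//.
apply/seteqP; split => x /= Bx j; first by move=> _; rewrite set_itvcc; exact: Bx.
by have := Bx j I; rewrite set_itvcc.
Qed.

Lemma lebesgue_sup_ball y r : 0 <= r ->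
  lebesgue_rV d (sup_ball y r) = ((2 * r) ^+ d)%:E.
Proof.
move=> r0; rewrite sup_ballE// lebesgue_rV_box => [|j]; last by rewrite !mxE; lra.
congr EFin; rewrite (eq_bigr (fun=> 2 * r)); first by rewrite prodr_const card_ord.
by move=> j _; rewrite !mxE; ring.
Qed.

Lemma nicely_behaving_balls Omega (mu : probability V R) :
  Omega !=set0 -> nicely_behaving Omega mu ->
  exists a1 a2 : R, [/\ 0 < a1, 0 < a2,
    forall y r, 0 <= r -> fine (mu (sup_ball y r)) <= a2 * (2 * r) ^+ d &
    forall y r, 0 <= r -> sup_ball y r `<=` Omega ->
      a1 * (2 * r) ^+ d <= fine (mu (sup_ball y r))].
Proof.
move=> [x0 Ox0] [p [mp muE p_gt0 [cl [cu [/andP[cl0 clu] pb]]]]].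
pose vol := fine (lebesgue_rV d Omega).
have cu0 : 0 < cu by exact: lt_le_trans clu.
(* If [vol] were 0, the convention [0^-1 = 0] would make the uniform density vanish and contradict
   [p x0 > 0]. *)
have vol0 : 0 < vol.
  rewrite lt_def fine_ge0 ?measure_ge0// andbT; apply/negP => /eqP v0.
  have := p_gt0 _ Ox0; have := pb x0.
  rewrite /uniform_density -/vol v0 invr0 !mulr0 => /andP[_ H1] H2.
  by have := lt_le_trans H2 H1; rewrite ltxx.
have p_ge0 x : 0 <= p x.
  have /andP[H _] := pb x; apply: le_trans H.
  by rewrite !mulr_ge0// ?invr_ge0 ltW.
have p_le x : p x <= cu / vol.
  have /andP[_ H] := pb x; apply: (le_trans H).
  rewrite (ler_wpM2l (ltW cu0))// /uniform_density -/vol -[leRHS]mul1r.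
  by rewrite ler_wpM2r ?invr_ge0 ?(ltW vol0)//.
have p_ge x : Omega x -> cl / vol <= p x.
  move=> Ox; have /andP[H _] := pb x; apply: le_trans H.
  by rewrite /uniform_density -/vol indicE mem_set// mul1r.
have mpE D : measurable D -> measurable_fun D (EFin \o p).
  by move=> mD; apply/measurable_EFinP; exact: measurable_funS mp.
exists (cl / vol), (cu / vol); split; [exact: divr_gt0|exact: divr_gt0| |].
- move=> y r r0; have mB := measurable_sup_ball y r0.
  rewrite -lee_fin fineK ?fin_num_measure// muE// EFinM -(lebesgue_sup_ball y r0).
  rewrite -integral_cst//; apply: ge0_le_integral => //.
  + by move=> x _; rewrite lee_fin.
  + exact: mpE.
  + by move=> x _; rewrite lee_fin.
- move=> y r r0 BO; have mB := measurable_sup_ball y r0.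
  rewrite -lee_fin fineK ?fin_num_measure// muE// EFinM -(lebesgue_sup_ball y r0).
  rewrite -integral_cst//; apply: ge0_le_integral => //.
  + by move=> x _; rewrite lee_fin divr_ge0 ?ltW.
  + exact: mpE.
  + by move=> x /BO Ox; rewrite lee_fin p_ge.
Qed.

End ball_measure.

(** * The fill distance of a random sample *)

Section grids.
Context {R : realType} {d : nat}.
Local Notation V := 'rV[R]_d.

Lemma grid_cover (Lb del : R) : 0 < del -> 0 <= Lb ->
  exists2 M : nat, M%:R <= 2 * Lb / del + 1 &
  exists cen : {ffun 'I_d -> 'I_M} -> V,
    forall c : V, `|c| <= Lb -> exists z, `|c - cen z| <= del / 2.
Proof.
move=> del0 Lb0; pose M := (Num.truncn (2 * Lb / del)).+1.
have LMd : 0 <= 2 * Lb / del by rewrite divr_ge0 ?mulr_ge0// ltW.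
exists M; first by rewrite /M -natr1 lerD2r; have /andP[] := truncn_itv LMd.
exists (fun z : {ffun 'I_d -> 'I_M} => \row_j (- Lb + (z j)%:R * del + del / 2)) => c cLb.
pose q j := (c 0 j + Lb) / del.
have cj j : - Lb <= c 0 j <= Lb by rewrite -ler_norml (le_trans (norm_coord _ _)).
have q0 j : 0 <= q j.
  by rewrite divr_ge0 ?(ltW del0)//; have /andP[] := cj j; lra.
have qM j : (Num.truncn (q j) < M)%N.
  rewrite ltnS; apply: le_truncn; rewrite ler_pM2r ?invr_gt0//.
  by have /andP[] := cj j; lra.
exists [ffun j => Ordinal (qM j)]; apply: norm_rV_le; first by rewrite divr_ge0// ltW.
move=> j; rewrite !mxE ffunE /=.
have /andP[t1 t2] := truncn_itv (q0 j).
have cE : c 0 j = q j * del - Lb by rewrite /q divfK ?gt_eqF// addrK.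
have H1 : (Num.truncn (q j))%:R * del <= q j * del by rewrite ler_pM2r.
have H2 : q j * del < ((Num.truncn (q j)).+1)%:R * del by rewrite ltr_pM2r.
rewrite -natr1 mulrDl mul1r in H2.
rewrite cE ler_norml; apply/andP; split; lra.
Qed.

(** Spacing [4 * t] keeps closed balls of radius [t] apart. As [ell / (4 * t) >= 1], truncation
    loses at most a factor 2, whence [ell / (8 * t)]. *)
Lemma grid_packing (c0 : V) (t ell : R) : 0 < t -> 4 * t <= ell ->
  exists2 M : nat, ell / (8 * t) <= M%:R &
  exists2 cen : {ffun 'I_d -> 'I_M} -> V, forall z, `|cen z - c0| <= ell &
    forall z z', z != z' -> sup_ball (cen z) t `&` sup_ball (cen z') t = set0.
Proof.
move=> t0 tl; pose M := Num.truncn (ell / (4 * t)).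
have t40 : 0 < 4 * t by rewrite mulr_gt0.
have x1 : 1 <= ell / (4 * t) by rewrite ler_pdivlMr// mul1r.
have /andP[m1 m2] := truncn_itv (le_trans ler01 x1).
have xE : ell / (8 * t) = ell / (4 * t) / 2 by field; rewrite gt_eqF.
have M1 : 1 <= M%:R :> R.
  rewrite ler1n lt0n; apply/eqP => M0; move: m2; rewrite -/M M0; lra.
exists M; first by rewrite xE; move: m2; rewrite -/M -natr1; lra.
exists (fun z : {ffun 'I_d -> 'I_M} => \row_j (c0 0 j + 4 * t * (z j)%:R)) => [z|z z'].
  apply: norm_rV_le; first by apply: le_trans tl; exact: ltW.
  move=> j; rewrite !mxE (_ : _ - _ = 4 * t * (z j)%:R); last by ring.
  have zj0 : 0 <= 4 * t * (z j)%:R by rewrite mulr_ge0// ltW.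
  rewrite (ger0_norm zj0) mulrC -ler_pdivlMr//.
  by rewrite (le_trans _ m1)// ler_nat ltnW// ltn_ord.
move=> /eqP zz'; apply/seteqP; split => // x [/= xz xz']; apply: zz'.
apply/ffunP => j; apply/val_inj => /=.
have := le_trans (norm_coord _ j) xz; rewrite !mxE ler_norml => /andP[h1 h2].
have := le_trans (norm_coord _ j) xz'; rewrite !mxE ler_norml => /andP[h3 h4].
have H1 : 4 * t * (z j)%:R - 4 * t * (z' j)%:R <= 2 * t by lra.
have H2 : 4 * t * (z' j)%:R - 4 * t * (z j)%:R <= 2 * t by lra.
have small (a b : nat) : 4 * t * a%:R - 4 * t * b%:R <= 2 * t -> (a <= b)%N.
  move=> H; rewrite leqNgt; apply/negP => ba.
  have : (b.+1%:R <= a%:R :> R) by rewrite ler_nat.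
  rewrite -natr1 => ab; have : 4 * t * (b%:R + 1) <= 4 * t * a%:R.
    by rewrite ler_wpM2l// ltW.
  by rewrite mulrDr mulr1; lra.
by apply/eqP; rewrite eqn_leq; apply/andP; split; apply: small; lra.
Qed.

End grids.

Section fill_distance_events.
Context {R : realType} {d : nat}.
Local Notation V := 'rV[R]_d.
Context {disp : measure_display} {T : measurableType disp}.
Variables (P : probability T R) (mu : probability V R).
Variables (n : nat) (X : 'I_n -> {RV P >-> V}).
Hypothesis X_iid : iid_sample mu X.
Variable Omega : set V.

Lemma cover_failure_le (kappa r0 a1 Lb del : R) :
  0 < kappa -> 0 < r0 -> 0 < a1 -> 0 <= Lb -> 0 < del -> del <= kappa * r0 ->
  (forall x, Omega x -> `|x| <= Lb) ->
  (forall x, Omega x -> exists2 xi : V, `|xi| <= 1 &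
      forall rho z, 0 < rho <= r0 -> `|z - (x + rho *: xi)| <= kappa * rho ->
        Omega z) ->
  (forall y r, 0 <= r -> sup_ball y r `<=` Omega ->
      a1 * (2 * r) ^+ d <= fine (mu (sup_ball y r))) ->
  (mu_ext P [set w | ~ forall x, Omega x ->
      exists i, (norm2 (x - X i w) <= d%:R * ((kappa^-1 + 1) * del))%R] <=
   ((2 * Lb / del + 1) ^+ d * expR (- (n%:R * (a1 * del ^+ d))))%:E)%E.
Proof.
move=> k0 r00 a10 Lb0 del0 delr bOmega Hcone Hball.
have [M MLb [cen Hcen]] := @grid_cover R d _ _ del0 Lb0.
pose good z := `[< sup_ball (cen z) (del / 2) `<=` Omega >].
have del20 : 0 <= del / 2 by rewrite divr_ge0// ltW.
pose F z := [set w | forall i, ~ sup_ball (cen z) (del / 2) (X i w)].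
apply: (@le_trans _ _ (mu_ext P (\big[setU/set0]_(z | good z) F z))).
  apply: le_outer_measure => w /= /existsNP[x /not_implyP[Ox nx]].
  have [xi xi1 Hxi] := Hcone x Ox.
  pose rho := del / kappa.
  have rho0 : 0 < rho by exact: divr_gt0.
  have rhor : 0 < rho <= r0 by rewrite rho0 ler_pdivrMr// mulrC.
  have krho : kappa * rho = del by rewrite /rho mulrC divfK// gt_eqF.
  pose c := x + rho *: xi.
  have Oc : Omega c.
    by apply: (Hxi rho) => //; rewrite subrr normr0 krho ltW.
  have [z cz] := Hcen c (bOmega _ Oc).
  have gz : good z.
    apply/asboolP => y /= yz; apply: (Hxi rho) => //; rewrite krho -/c.
    rewrite -(subrK (cen z) y) -addrA (le_trans (ler_normD _ _))//.
    by rewrite [del]splitr lerD// distrC.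
  rewrite (bigD1 _ gz); left => i /= Xi; apply: nx; exists i.
  rewrite (le_trans (norm2_le _))// ler_wpM2l//.
  have -> : x - X i w = - (rho *: xi) + (c - cen z) - (X i w - cen z).
    by apply/rowP => j; rewrite /c !mxE; ring.
  rewrite (le_trans (ler_normB _ _))//.
  rewrite (_ : (kappa^-1 + 1) * del = rho + del / 2 + del / 2); last first.
    by rewrite /rho; field; rewrite gt_eqF.
  rewrite lerD// (le_trans (ler_normD _ _))// lerD// normrN normrZ gtr0_norm//.
  by rewrite ler_piMr// ltW.
apply: (le_trans (mu_ext_bigsetU _ _ _ _)).
apply: (@le_trans _ _ (\sum_(z | good z) (expR (- (n%:R * (a1 * del ^+ d))))%:E)%E).
  apply: lee_sum => z /asboolP gz.
  apply: (le_trans (miss_le X_iid (measurable_sup_ball _ del20))).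
  rewrite lee_fin ler_expR lerN2 ler_wpM2l//.
  by have := Hball _ _ del20 gz; rewrite mulrCA divff// mulr1.
rewrite sumEFin lee_fin sumr_const -[leLHS]mulr_natl ler_wpM2r ?expR_ge0//.
apply: (@le_trans _ _ (M%:R ^+ d)).
  rewrite -natrX ler_nat (leq_trans (max_card _))//.
  by rewrite card_ffun !card_ord.
by rewrite lerXn2r// ?nnegrE// addr_ge0// divr_ge0 ?mulr_ge0// ltW.
Qed.

(** The centre of a missed cell is the point [y]. By [1 - pr >= expR (- (2 * pr))], valid for
    [pr <= 1 / 2], the quantity inverted on the right bounds the expected number of missed cells
    from below. *)
Lemma packing_failure_le (c0 : V) (ell t a2 pr : R) :
  0 < t -> 4 * t <= ell -> (forall y, `|y - c0| <= ell -> Omega y) ->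
  (forall y r, 0 <= r -> fine (mu (sup_ball y r)) <= a2 * (2 * r) ^+ d) ->
  a2 * (2 * t) ^+ d <= pr -> pr <= 1 / 2 -> 0 <= pr ->
  (mu_ext P [set w | ~ exists2 y, Omega y & forall i, (t <= norm2 (y - X i w))%R] <=
   ((ell / (8 * t)) ^+ d * expR (- (2 * (n%:R * pr))))^-1%:E)%E.
Proof.
move=> t0 tl HO Hball apr pr2 pr0.
have [M Mge [cen cenO cenD]] := grid_packing c0 t0 tl.
pose A z := sup_ball (cen z) t.
have mA z : measurable (A z) by exact: (measurable_sup_ball _ (ltW t0)).
have ell0 : 0 < ell by apply: (lt_le_trans _ tl); rewrite mulr_gt0.
have base : expR (- (2 * pr)) <= 1 - pr.
  rewrite expRN -[leRHS]invrK lef_pV2 ?posrE ?invr_gt0 ?expR_gt0//; last by lra.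
  apply: le_trans (expR_ge1Dx _); rewrite -[leLHS]mul1r ler_pdivrMr; last by lra.
  nra.
have missge z : expR (- (2 * (n%:R * pr))) <= (1 - fine (mu (A z))) ^+ n.
  rewrite (_ : - _ = n%:R * - (2 * pr)); last by ring.
  have prA : fine (mu (A z)) <= pr by exact: le_trans (Hball _ _ (ltW t0)) apr.
  by rewrite expRM_natl lerXn2r// ?nnegrE ?expR_ge0//; lra.
have sumge : (ell / (8 * t)) ^+ d * expR (- (2 * (n%:R * pr))) <=
    \sum_z (1 - fine (mu (A z))) ^+ n.
  apply: (@le_trans _ _ (\sum_(z : {ffun 'I_d -> 'I_M}) expR (- (2 * (n%:R * pr))))).
    rewrite sumr_const -[leRHS]mulr_natl ler_wpM2r ?expR_ge0//.
    rewrite card_ffun !card_ord natrX lerXn2r// ?nnegrE//.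
    by rewrite divr_ge0 ?mulr_ge0// ltW.
  by apply: ler_sum => z _.
have s0 : 0 < (ell / (8 * t)) ^+ d * expR (- (2 * (n%:R * pr))).
  by rewrite mulr_gt0 ?expR_gt0// exprn_gt0// divr_gt0// mulr_gt0.
apply: (@le_trans _ _ (mu_ext P [set w | forall z, exists i, A z (X i w)])).
  apply: le_outer_measure => w /= nw z; apply: contrapT => nz; apply: nw.
  exists (cen z); first exact/HO/cenO.
  move=> i; rewrite leNgt; apply/negP => lt; apply: nz; exists i.
  by rewrite /A /sup_ball /= distrC (le_trans (le_norm2 _))// ltW.
apply: (le_trans (occupancy_le X_iid mA cenD (lt_le_trans s0 sumge))).
by rewrite lee_fin lef_pV2 ?posrE// (lt_le_trans s0).
Qed.

End fill_distance_events.

Section scale.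
Context {R : realType}.

Lemma natr_expR_ln n : (0 < n)%N -> n%:R = expR (ln n%:R) :> R.
Proof. by move=> n0; rewrite lnK// posrE ltr0n. Qed.

(* Up to constants, [tau] is the fill distance of [n] random points. *)
Lemma sample_scale d (sig : R) : (0 < d)%N -> 0 < sig ->
  exists2 Lam : R, 1 <= Lam & forall n, (0 < n)%N -> Lam <= ln n%:R ->
    exists tau : R, [/\ 0 < tau, tau <= sig & tau ^+ d = ln n%:R / n%:R].
Proof.
move=> d0 sig0; exists (Num.max 1 (4 / sig ^+ d)); first by rewrite le_max lexx.
move=> n n0; rewrite ge_max => /andP[L1 Lsig]; set L := ln _ in L1 Lsig *.
have L0 : 0 < L by exact: lt_le_trans L1.
have nR : 0 < n%:R :> R by rewrite ltr0n.
have y0 : 0 < L / n%:R by exact: divr_gt0.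
have tauE : ((L / n%:R) `^ d%:R^-1) ^+ d = L / n%:R.
  rewrite -powR_mulrn ?powR_ge0// -powRrM mulVf ?pnatr_eq0 -?lt0n//.
  by rewrite powRr1// ltW.
exists ((L / n%:R) `^ d%:R^-1); split => //; first exact: powR_gt0.
rewrite -(@ler_pXn2r _ d)// ?nnegrE ?powR_ge0// ?(ltW sig0)// tauE.
rewrite (natr_expR_ln n0) -/L ler_pdivrMr ?expR_gt0//.
have H1 : L / 2 <= expR (L / 2) by apply: le_trans (expR_ge1Dx _); lra.
have H2 : expR L = expR (L / 2) * expR (L / 2).
  by rewrite -expRD -splitr.
have H3 : 4 <= L * sig ^+ d by rewrite -ler_pdivrMr// exprn_gt0.
have s0 : 0 < sig ^+ d by rewrite exprn_gt0.
have H4 : L * L <= 4 * expR L.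
  rewrite H2 (_ : 4 * _ = (2 * expR (L / 2)) * (2 * expR (L / 2))); last by ring.
  by rewrite ler_pM ?(ltW L0)//; lra.
rewrite -(ler_pM2l L0) (le_trans H4)// (_ : L * _ = (L * sig ^+ d) * expR L).
  by rewrite ler_wpM2r// expR_ge0.
by ring.
Qed.

End scale.

Section dimension_and_nodes.
Context {R : realType} {d : nat}.
Local Notation V := 'rV[R]_d.

Lemma cone_dim_gt0 (Omega : set V) x : interior_cone_condition Omega -> Omega x ->
  (0 < d)%N.
Proof.
move=> [th [r [_ _ H]]] /H[xi xi1 _]; rewrite lt0n; apply/negP => /eqP d0.
move: xi1; rewrite /norm2 big1 ?sqrtr0 => [/eqP|j]; first by rewrite eq_sym oner_eq0.
move=> _; exfalso; have := leq_ltn_trans (leq0n j) (ltn_ord j).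
by rewrite lt0n d0.
Qed.

(* A grid of [k ^ d] nodes inside the cone at the evaluation point, scaled down
   into the part of the support where the weight is bounded below. *)
Lemma interpolation_nodes (k : nat) (kappa rho : R) (xi : V) : (0 < k)%N ->
  0 < kappa <= 1 -> 0 < rho -> `|xi| <= 1 ->
  exists (a : 'I_d -> 'I_k -> R) (eps C : R),
  [/\ 0 < eps, 0 < C,
    forall (l : {ffun 'I_d -> 'I_k}) u, `|u - \row_r a r (l r)| <= eps ->
      `|u - rho *: xi| <= kappa * rho &
    forall c : mpoly.bmultinom d k -> R, exists l : {ffun 'I_d -> 'I_k},
      forall u : V, `|u - \row_r a r (l r)| <= eps ->
      forall beta, `|c beta| <= C * `|\sum_gamma c gamma * monomial gamma u|].
Proof.
move=> k0 /andP[kappa0 kappa1] rho0 xi1.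
have kr0 : 0 < kappa * rho by exact: mulr_gt0.
have kR : 0 < k%:R :> R by rewrite ltr0n.
pose a (r : 'I_d) (j : 'I_k) : R := rho * xi 0 r + kappa * rho / 2 * (j%:R / k%:R).
have a_inj r : injective (a r).
  move=> i j /addrI /(mulfI _) H; apply/ord_inj/(mulrIn (oner_neq0 R)).
  have /H : kappa * rho / 2 != 0 by rewrite gt_eqF// divr_gt0.
  by apply: mulIf; rewrite invr_eq0 gt_eqF.
have [C C0 near_eps] := norming_cells k0 a_inj.
have [eps [[epsC eps0] eps2]] : exists eps : R, ((forall c : mpoly.bmultinom d k -> R,
    exists l : {ffun 'I_d -> 'I_k},
    forall u : V, `|u - \row_r a r (l r)| <= eps ->
    forall beta, `|c beta| <= C * `|\sum_gamma c gamma * monomial gamma u|) /\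
    0 < eps) /\ eps <= kappa * rho / 2.
  apply: (@filter_ex _ ((0 : R)^'+)).
  near=> e; split; first split.
  - near: e; exact: near_eps.
  - by near: e; exact: nbhs_right_gt.
  - by near: e; apply: nbhs_right_le; exact: divr_gt0.
exists a, eps, C; split => // l u ul.
rewrite -(subrK (\row_r a r (l r)) u) -addrA (le_trans (ler_normD _ _))//.
rewrite [leRHS]splitr lerD// ?(le_trans ul)//.
apply: norm_rV_le => [|j]; first by rewrite divr_ge0 ?ltW.
rewrite !mxE /a addrAC subrr add0r ger0_norm; last first.
  by rewrite !mulr_ge0 ?invr_ge0// ?(ltW kappa0) ?(ltW rho0).
rewrite ler_piMr ?divr_ge0 ?(ltW kr0)// ler_pdivrMr// mul1r ler_nat.
by rewrite ltnW// ltn_ord.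
Unshelve. all: by end_near. Qed.

End dimension_and_nodes.

Section failure_probability.
Context {R : realType} {d : nat}.
Local Notation V := 'rV[R]_d.

Lemma mls_failure_le (k m : nat) (Omega : set V) (mu : probability V R)
    (disp : measure_display) (T : measurableType disp) (P : probability T R)
    (X : forall n : nat, 'I_n -> {RV P >-> V})
    (f Phi : V -> R) (s : R) (q : mpoly.multinom d -> R) (xhat : V) :
  compact Omega -> interior_cone_condition Omega -> nicely_behaving Omega mu ->
  (forall n, iid_sample mu (X n)) -> Ck k f -> 0 < s -> mls_weight k s Phi ->
  (m < k)%N -> Omega xhat ->
  exists K C c Lam : R, [/\ 0 < K, 0 < C, 0 < c &
    forall n, (0 < n)%N -> Lam <= ln n%:R ->
      (mu_ext P [set w | mls_failure Omega k m Phi f q xhat K (fun i => X n i w)]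
        <= (C * expR (- (c * ln n%:R)))%:E)%E].
Proof.
move=> cOmega Ocone mu_nice X_iid fC s0 PhiW mk Ox.
have d0 := cone_dim_gt0 Ocone Ox.
have k0 : (0 < k)%N by exact: leq_ltn_trans mk.
have dR : 0 < d%:R :> R by rewrite ltr0n.
have [kappa [r0 [/andP[kappa0 kappa1] r00 Hcone]]] := cone_ball Ocone.
have [a1 [a2 [a10 a20 Hub Hlb]]] := nicely_behaving_balls (ex_intro _ _ Ox) mu_nice.
have [Lb Lb0 bOmega] : exists2 Lb, 0 <= Lb & forall x, Omega x -> `|x| <= Lb.
  have /compact_bounded[M [Mr HM]] := cOmega.
  exists (`|M| + 1) => // x Ox'; apply: HM => //.
  by rewrite (le_lt_trans (ler_norm _))// ltrDl.
have [xi xi1 Hxi] := Hcone _ Ox.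
pose rho1 : R := s / (8 * (d%:R + 1)).
have d10 : 0 < d%:R + 1 :> R by rewrite addr_gt0.
have rho10 : 0 < rho1 by rewrite divr_gt0// mulr_gt0.
have [|a [eps [C [eps0 C0 cellsK norming]]]] :=
  @interpolation_nodes R d k kappa rho1 xi k0 _ rho10 xi1; first by rewrite kappa0.
pose sig := 2 * rho1.
have sig0 : 0 < sig by exact: mulr_gt0.
have dsig : d%:R * (2 * sig) < s.
  rewrite (_ : d%:R * _ = s * (d%:R / (2 * (d%:R + 1)))); last first.
    by rewrite /sig /rho1; field; rewrite gt_eqF.
  by rewrite gtr_pMr// ltr_pdivrMr ?mulr_gt0//; lra.
have cells (l : {ffun 'I_d -> 'I_k}) (u : V) :
    `|u - \row_r a r (l r)| <= eps -> `|u| <= sig.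
  move=> /cellsK ul; rewrite -(subrK (rho1 *: xi) u) (le_trans (ler_normD _ _))//.
  rewrite /sig mulr2n mulrDl mul1r lerD//.
    by rewrite (le_trans ul)// ler_piMl// ltW.
  by rewrite normrZ gtr0_norm// ler_piMr// ltW.
pose A := 1 + 2 / a1.
have A1 : 1 <= A by rewrite lerDl divr_ge0// ltW.
have A0 : 0 < A by exact: lt_le_trans A1.
pose c0 : R := (8 * (a2 + 1))^-1.
have c00 : 0 < c0 by rewrite invr_gt0 mulr_gt0// addr_gt0.
pose C0' := d%:R * ((kappa^-1 + 1) * A) / c0.
have ka10 : 0 < kappa^-1 + 1 by rewrite addr_gt0// invr_gt0.
have C0'0 : 0 < C0' by rewrite divr_gt0// mulr_gt0// mulr_gt0.
pose b := a1 * (2 * (eps * c0)) ^+ d.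
have b0 : 0 < b by rewrite mulr_gt0// exprn_gt0// !mulr_gt0.
pose eta := 1 - expR (- 1) : R.
have eta0 : 0 < eta by rewrite subr_gt0 -[ltRHS]expR0 ltr_expR oppr_lt0.
pose c1 := b * eta / 2.
have c10 : 0 < c1 by rewrite divr_gt0// mulr_gt0.
have sCc0 : 0 < s * C0' * c0 by apply: mulr_gt0 => //; exact: mulr_gt0.
pose B2 := a2 * (2 * (s * C0' * c0)) ^+ d.
have B20 : 0 < B2 by apply: mulr_gt0 => //; apply: exprn_gt0; exact: mulr_gt0.
pose C1 := B2 * (expR 1 - 1) + 1.
have e10 : 0 < expR 1 - 1 :> R by rewrite subr_gt0 -[ltLHS]expR0 ltr_expR.
have C10 : 0 < C1 by rewrite addr_gt0// mulr_gt0.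
have [K0 K00 HK] := mls_deterministic q xhat mk fC s0 PhiW sig0 dsig C0'0 c10 C10 C0
  cells norming.
pose ell := kappa * r0.
have ell0 : 0 < ell by exact: mulr_gt0.
pose S := 1 + c0 + s * C0' * c0 + A + A / ell + 4 * c0 / ell + c0 * rho1 / r0.
have Ael : 0 < A / ell by exact: divr_gt0.
have cel : 0 < 4 * c0 / ell by rewrite divr_gt0// mulr_gt0.
have cr : 0 < c0 * rho1 / r0 by rewrite divr_gt0// mulr_gt0.
have S0 : 0 < S by do 6?[apply: addr_gt0 => //].
have Si0 : 0 < S^-1 by rewrite invr_gt0.
have [Lam Lam1 Htau] := sample_scale d0 Si0.
pose B' := (ell / (8 * c0)) ^+ d.
have B'0 : 0 < B' by rewrite exprn_gt0// divr_gt0// mulr_gt0.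
pose c := Num.min (1 / 4) c1.
have c_gt0 : 0 < c by rewrite lt_min c10 andbT divr_gt0.
pose CT := (2 * Lb + 1) ^+ d + 4 / B' + #|{ffun 'I_d -> 'I_k}|%:R + 1.
exists (K0 + 1), CT, c, Lam; split => //.
- by rewrite addr_gt0.
- by rewrite /CT ltr_wpDl// !addr_ge0// ?exprn_ge0 ?divr_ge0 ?addr_ge0 ?mulr_ge0// ltW.
move=> n n0 LamL; have [tau [tau0 tauS tauE]] := Htau n n0 LamL.
set L := ln n%:R in LamL tauE *.
have L1 : 1 <= L by exact: le_trans LamL.
have L0 : 0 < L by exact: lt_le_trans L1.
have nE : n%:R = expR L :> R by exact: natr_expR_ln.
have nR : 0 < n%:R :> R by rewrite ltr0n.
have tauX x : x <= S -> x * tau <= 1.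
  move=> xS; rewrite (le_trans (ler_wpM2r (ltW tau0) xS))//.
  by rewrite mulrC -ler_pdivlMr// div1r.
have ntau : n%:R * tau ^+ d = L by rewrite tauE mulrCA divff ?gt_eqF// mulr1.
pose t := c0 * tau.
have t0 : 0 < t by exact: mulr_gt0.
have t1 : t <= 1 by apply: tauX; rewrite /S; clear - c00 sCc0 A0 Ael cel cr; lra.
pose del := A * tau.
have del0 : 0 < del by exact: mulr_gt0.
have del1 : del <= 1 by apply: tauX; rewrite /S; clear - c00 sCc0 A0 Ael cel cr; lra.
have delr : del <= kappa * r0.
  have : A / ell * tau <= 1 by apply: tauX; rewrite /S; clear - c00 sCc0 A0 Ael cel cr; lra.
  by rewrite mulrAC ler_pdivrMr// mul1r.
have tell : 4 * t <= ell.
  have : 4 * c0 / ell * tau <= 1 by apply: tauX; rewrite /S; clear - c00 sCc0 A0 Ael cel cr; lra.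
  by rewrite mulrAC ler_pdivrMr// mul1r /t mulrA.
have rhot : s * C0' * t <= 1 by rewrite /t mulrA; apply: tauX; rewrite /S; clear - c00 sCc0 A0 Ael cel cr; lra.
have trho : t * rho1 <= r0.
  have : c0 * rho1 / r0 * tau <= 1 by apply: tauX; rewrite /S; clear - c00 sCc0 A0 Ael cel cr; lra.
  by rewrite mulrAC ler_pdivrMr// mul1r /t mulrAC.
pose ev_cover := [set w | ~ forall x, Omega x ->
  exists i, norm2 (x - X n i w) <= d%:R * ((kappa^-1 + 1) * del)].
pose ev_pack := [set w | ~ exists2 y, Omega y & forall i, t <= norm2 (y - X n i w)].
pose node (l : {ffun 'I_d -> 'I_k}) : V := xhat + t *: \row_r a r (l r).
pose ball_low l : V -> bool := fun x => `|x - node l| <= eps * t.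
pose ev_low l := [set w | 0 <= -1 * (#|[pred i | ball_low l (X n i w)]|%:R - c1 * L)].
pose ball_up : V -> bool := fun x => `|x - xhat| <= s * C0' * t.
pose ev_up := [set w | 0 <= 1 * (#|[pred i | ball_up (X n i w)]|%:R - C1 * L)].
have incl : [set w | mls_failure Omega k m Phi f q xhat (K0 + 1) (fun i => X n i w)]
    `<=` (ev_cover `|` ev_pack) `|` ((\big[setU/set0]_l ev_low l) `|` ev_up).
  move=> w fail; apply: contrapT => nw.
  have nc : forall x, Omega x ->
      exists i, norm2 (x - X n i w) <= d%:R * ((kappa^-1 + 1) * del).
    by apply: contrapT => H; apply: nw; left; left.
  have np : exists2 y, Omega y & forall i, t <= norm2 (y - X n i w).
    by apply: contrapT => H; apply: nw; left; right.
  have nl l : c1 * L <= #|[pred i | ball_low l (X n i w)]|%:R.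
    rewrite leNgt; apply/negP => H; apply: nw; right; left.
    by rewrite (bigD1 l)//=; left; rewrite /ev_low /= mulN1r oppr_ge0 subr_le0 ltW.
  have nu : #|[pred i | ball_up (X n i w)]|%:R <= C1 * L.
    rewrite leNgt; apply/negP => H; apply: nw; right; right.
    by rewrite /ev_up /= mul1r subr_ge0 ltW.
  move: fail; rewrite /= /mls_failure; set h := fill_distance _ _.
  have th : t <= h by case: np => y Oy ty; exact: (fill_distance_ge n0 nc Oy ty).
  have hC : h <= C0' * t.
    apply: (le_trans (fill_distance_le nc (ex_intro _ _ Ox))).
    rewrite le_eqVlt; apply/orP; left; apply/eqP.
    by rewrite /C0' /del /t; field; rewrite !gt_eqF.
  have [def err] := HK t h n (fun i => X n i w) L t0 t1 th hC rhot L0 nl nu.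
  case=> [//|]; rewrite leNgt => /negP; apply; apply: (le_lt_trans err).
  have h0 : 0 < h := lt_le_trans t0 th.
  have hk : 0 < h ^+ (k - m) by rewrite exprn_gt0.
  rewrite mulrDl mul1r; apply: (@le_lt_trans _ _ (K0 * h ^+ (k - m))).
    by rewrite ler_wpM2l ?(ltW K00)// lerXn2r// nnegrE ltW.
  by rewrite ltrDl.
have P_cover : (mu_ext P ev_cover <= ((2 * Lb + 1) ^+ d * expR (- L))%:E)%E.
  apply: (le_trans (cover_failure_le (X_iid n) kappa0 r00 a10 Lb0 del0 delr bOmega
    Hcone Hlb)).
  have Lb1 : 0 < 2 * Lb + 1 by rewrite ltr_wpDl// mulr_ge0.
  have step : 2 * Lb / del + 1 <= (2 * Lb + 1) / tau.
    apply: (@le_trans _ _ ((2 * Lb + 1) / del)).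
      by rewrite [leRHS]mulrDl lerD2l mul1r -[leLHS]invr1 lef_pV2 ?posrE.
    by rewrite ler_wpM2l ?(ltW Lb1)// lef_pV2 ?posrE// ler_peMl// ltW.
  have expo : 2 * L <= n%:R * (a1 * del ^+ d).
    rewrite (_ : n%:R * _ = a1 * A ^+ d * L); last by rewrite -ntau exprMn; ring.
    rewrite ler_wpM2r ?(ltW L0)//; apply: (@le_trans _ _ (a1 * A)).
      by rewrite /A mulrDr mulr1 mulrCA divff ?gt_eqF// mulr1 lerDr ltW.
    by rewrite ler_wpM2l ?(ltW a10)// -[leLHS]expr1 ler_weXn2l.
  rewrite lee_fin.
  apply: (@le_trans _ _ (((2 * Lb + 1) / tau) ^+ d * expR (- (2 * L)))).
    apply: ler_pM; rewrite ?expR_ge0 ?ler_expR ?lerN2//.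
      by rewrite exprn_ge0// addr_ge0// divr_ge0 ?mulr_ge0// ltW.
    rewrite lerXn2r// nnegrE; last by rewrite divr_ge0 ?ltW.
    by rewrite addr_ge0// divr_ge0 ?mulr_ge0// ltW.
  rewrite expr_div_n tauE invf_div -mulrA ler_wpM2l ?exprn_ge0 ?(ltW Lb1)//.
  rewrite nE mulrAC -expRD (_ : L + - (2 * L) = - L); last by ring.
  by rewrite ler_piMr ?expR_ge0// invf_le1.
have P_pack : (mu_ext P ev_pack <= (4 / B' * expR (- (1 / 4 * L)))%:E)%E.
  pose pr := L / (4 * n%:R).
  have Ln : L <= n%:R by rewrite nE; apply: le_trans (expR_ge1Dx _); rewrite lerDr.
  have n40 : 0 < 4 * n%:R :> R by exact: mulr_gt0.
  have pr0 : 0 <= pr by rewrite divr_ge0// ltW.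
  have pr2 : pr <= 1 / 2 by rewrite /pr ler_pdivrMr//; clear - Ln nR; lra.
  have c0E : c0 * (8 * (a2 + 1)) = 1.
    by rewrite mulVf// gt_eqF// mulr_gt0// addr_gt0.
  have c0a : a2 * (2 * c0) <= 1 / 4 by clear - c0E c00; lra.
  have c0a0 : 0 < a2 * c0 by exact: mulr_gt0.
  have c01 : 2 * c0 <= 1 by clear - c0E c0a0; lra.
  have apr : a2 * (2 * t) ^+ d <= pr.
    rewrite /t mulrA exprMn tauE mulrA.
    rewrite (_ : pr = 1 / 4 * (L / n%:R)); last by rewrite /pr; field; rewrite gt_eqF.
    rewrite ler_wpM2r ?divr_ge0 ?(ltW L0)//; apply: le_trans c0a.
    rewrite ler_wpM2l ?(ltW a20)// -[leRHS]expr1 ler_wiXn2l//.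
    by rewrite mulr_ge0// ltW.
  have HO y : `|y - (xhat + r0 *: xi)| <= ell -> Omega y.
    by apply: Hxi; rewrite r00 lexx.
  apply: (le_trans (packing_failure_le (X_iid n) t0 tell HO Hub apr pr2 pr0)).
  rewrite lee_fin (_ : 2 * (n%:R * pr) = L / 2); last by rewrite /pr; field; rewrite gt_eqF.
  rewrite (_ : (ell / (8 * t)) ^+ d = B' * (expR L / L)); last first.
    have -> : expR L / L = (tau ^+ d)^-1 by rewrite tauE nE invf_div.
    rewrite /B' -exprVn -exprMn; congr (_ ^+ d).
    by rewrite /t; field; rewrite !gt_eqF.
  pose u := expR (L / 4).
  have u0 : 0 < u by exact: expR_gt0.
  have Lu : L <= 4 * u by have := expR_ge1Dx (L / 4); rewrite -/u; clear; lra.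
  have E1 : expR L = u ^+ 4 by rewrite /u -expRM_natl; congr expR; field.
  have E2 : expR (- (L / 2)) = (u ^+ 2)^-1.
    by rewrite expRN /u -expRM_natl; congr (expR _)^-1; field.
  have E3 : expR (- (1 / 4 * L)) = u^-1.
    by rewrite expRN /u; congr (expR _)^-1; field.
  rewrite E1 E2 E3.
  rewrite (_ : (_ * _)^-1 = L / (B' * u ^+ 2)); last by field; rewrite !gt_eqF.
  rewrite (_ : 4 / B' / u = 4 * u / (B' * u ^+ 2)); last by field; rewrite !gt_eqF.
  have Bu : 0 < B' * u ^+ 2 by apply: mulr_gt0 => //; exact: exprn_gt0.
  by rewrite ler_wpM2r// invr_ge0 ltW.
have P_low l : (mu_ext P (ev_low l) <= (expR (- (c1 * L)))%:E)%E.
  have et0 : 0 <= eps * t by rewrite mulr_ge0// ltW.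
  have mB : measurable [set x | ball_low l x] by exact: measurable_sup_ball.
  have := count_tail_le (X_iid n) (-1) (c1 * L) mB; move=> /le_trans; apply.
  rewrite lee_fin ler_expR; set p := fine _.
  have BO : sup_ball (node l) (eps * t) `<=` Omega.
    move=> y /= yl; apply: (Hxi (t * rho1)); first by rewrite mulr_gt0.
    have yE : y - (xhat + (t * rho1) *: xi) = t *: (t^-1 *: (y - xhat) - rho1 *: xi).
      by rewrite scalerBr !scalerA divff ?gt_eqF// scale1r opprD addrA.
    rewrite yE normrZ gtr0_norm// mulrCA ler_pM2l//; apply: (cellsK l).
    have -> : t^-1 *: (y - xhat) - \row_r a r (l r) = t^-1 *: (y - node l).
      rewrite /node opprD addrA [RHS]scalerBr scalerA mulVf ?gt_eqF// scale1r//.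
    by rewrite normrZ gtr0_norm ?invr_gt0// ler_pdivrMl// mulrC.
  have pge : b * tau ^+ d <= p.
    have := Hlb _ _ et0 BO; rewrite -/p; congr (_ <= _).
    by rewrite /b /t -mulrA -exprMn; congr (_ * _ ^+ d); ring.
  have npge : b * L <= n%:R * p.
    by rewrite -ntau mulrCA ler_wpM2l.
  have : b * L * eta <= n%:R * p * eta by rewrite ler_wpM2r// ltW.
  rewrite (_ : n%:R * (p * _) = - (n%:R * p * eta)); last by rewrite /eta; ring.
  by rewrite /c1; clear; lra.
have P_up : (mu_ext P ev_up <= (expR (- L))%:E)%E.
  have st0 : 0 <= s * C0' * t by apply: mulr_ge0; [apply: mulr_ge0|]; exact: ltW.
  have mB : measurable [set x | ball_up x] by exact: measurable_sup_ball.
  apply: (le_trans (count_tail_le (X_iid n) 1 (C1 * L) mB)).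
  rewrite lee_fin ler_expR; set p := fine _.
  have ple : p <= B2 * tau ^+ d.
    rewrite (_ : B2 * tau ^+ d = a2 * (2 * (s * C0' * t)) ^+ d); first exact: Hub.
    by rewrite /B2 /t -[LHS]mulrA -exprMn; congr (_ * _ ^+ d); ring.
  have nple : n%:R * p <= B2 * L.
    by rewrite -ntau mulrCA ler_wpM2l.
  have : n%:R * p * (expR 1 - 1) <= B2 * L * (expR 1 - 1) by rewrite ler_wpM2r// ltW.
  by rewrite /C1; clear; lra.
have expc x : c <= x -> expR (- (x * L)) <= expR (- (c * L)).
  by move=> cx; rewrite ler_expR lerN2 ler_wpM2r// ltW.
have cc1 : c <= c1 by rewrite ge_min lexx orbT.
have c14 : c <= 1 / 4 by rewrite ge_min lexx.
have expL : expR (- L) <= expR (- (c * L)).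
  by rewrite -[X in expR (- X)]mul1r; apply: expc; lra.
apply: (le_trans (le_outer_measure (mu_ext P) _ _ incl)).
apply: (le_trans (outer_measureU2 _ _ _)).
apply: (@le_trans _ _ (((2 * Lb + 1) ^+ d * expR (- (c * L)))%:E +
   (4 / B' * expR (- (c * L)))%:E + ((#|{ffun 'I_d -> 'I_k}|%:R * expR (- (c * L)))%:E +
   (expR (- (c * L)))%:E))%E); last first.
  by rewrite -!EFinD lee_fin /CT; lra.
apply: leeD.
  apply: (le_trans (outer_measureU2 _ _ _)); apply: leeD.
    apply: (le_trans P_cover); rewrite lee_fin ler_wpM2l//.
    by rewrite exprn_ge0// addr_ge0// mulr_ge0.
  apply: (le_trans P_pack); rewrite lee_fin ler_wpM2l ?expc//.
  by rewrite divr_ge0// ltW.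
apply: (le_trans (outer_measureU2 _ _ _)); apply: leeD; last first.
  by apply: (le_trans P_up); rewrite lee_fin.
apply: (le_trans (mu_ext_bigsetU _ _ _ _)).
apply: (@le_trans _ _ (\sum_(l : {ffun 'I_d -> 'I_k}) (expR (- (c * L)))%:E)%E).
  by apply: lee_sum => l _; apply: (le_trans (P_low l)); rewrite lee_fin expc.
by rewrite sumEFin lee_fin sumr_const -[leLHS]mulr_natl.
Qed.

End failure_probability.

Theorem theorem2 (R : realType) (d k m : nat) (Omega : set 'rV[R]_d)
    (mu : probability 'rV[R]_d R)
    (disp : measure_display) (T : measurableType disp) (P : probability T R)
    (X : forall n : nat, 'I_n -> {RV P >-> 'rV[R]_d})
    (f Phi : 'rV[R]_d -> R) (s : R) (q : mpoly.multinom d -> R)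
    (Omega_compact : compact Omega)
    (Omega_cone : interior_cone_condition Omega)
    (k_ge1 : (1 <= k)%N)
    (mu_nice : nicely_behaving Omega mu)
    (X_iid : forall n : nat, iid_sample mu (X n))
    (f_Ck : Ck k f)
    (s_gt0 : 0 < s)
    (Phi_weight : mls_weight k s Phi)
    (Q_order : has_order m q)
    (m_lt_k : (m < k)%N)
    (xhat : 'rV[R]_d) (xhat_Omega : Omega xhat) :
  exists K C_MQ c_mu : R,
    let failure (n : nat) : set T :=
      [set w | mls_failure Omega k m Phi f q xhat K (fun i => X n i w)] in
    [/\ 0 < K, 0 < C_MQ, 0 < c_mu,
      forall n : nat, (0 < n)%N ->
        (mu_ext P (failure n) <= (C_MQ / n%:R `^ c_mu)%:E)%E &
      mu_ext P (failure n) @[n --> \oo] --> 0%E].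
Proof.
have [K [C [c [Lam [K0 C0 c0 HK]]]]] := mls_failure_le q Omega_compact Omega_cone
  mu_nice X_iid f_Ck s_gt0 Phi_weight m_lt_k xhat_Omega.
exists K, (C + expR (c * Lam)), c => failure.
have CC0 : 0 < C + expR (c * Lam) by rewrite addr_gt0// expR_gt0.
have rateE n : (0 < n)%N -> (n%:R `^ c)^-1 = expR (- (c * ln n%:R)) :> R.
  by move=> n0; rewrite /powR pnatr_eq0 gtn_eqF// expRN.
have bound n : (0 < n)%N ->
    (mu_ext P (failure n) <= ((C + expR (c * Lam)) / n%:R `^ c)%:E)%E.
  move=> n0; rewrite rateE//; have [LamL|LLam] := leP Lam (ln n%:R).
    apply: (le_trans (HK _ n0 LamL)); rewrite lee_fin ler_wpM2r ?expR_ge0//.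
    by rewrite lerDl expR_ge0.
  apply: (@le_trans _ _ (mu_ext P setT)); first exact: le_outer_measure.
  rewrite measurable_mu_extE// [leLHS]probability_setT lee_fin mulrDl -expRD.
  rewrite -[leLHS]add0r lerD ?mulr_ge0 ?expR_ge0 ?(ltW C0)//.
  by rewrite -[leLHS]expR0 ler_expR -mulrBr mulr_ge0 ?(ltW c0)// subr_ge0 ltW.
split => //.
have rate0 : ((C + expR (c * Lam)) / n%:R `^ c) @[n --> \oo] --> (0 : R).
  apply/cvgrPdist_lt => e e0.
  pose B := (C + expR (c * Lam)) / (c * e).
  near=> n.
  have n0 : (0 < n)%N by near: n; exact: nbhs_infty_gt.
  have LB : B < ln n%:R.
    rewrite -ltr_expR lnK ?posrE ?ltr0n//.
    by near: n; exact: nbhs_infty_gtr.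
  have B0 : 0 < B by rewrite divr_gt0// mulr_gt0.
  have L0 : 0 < ln n%:R :> R by exact: lt_trans LB.
  have cL0 : 0 < c * ln n%:R by exact: mulr_gt0.
  rewrite sub0r normrN ger0_norm; last by rewrite divr_ge0 ?powR_ge0 ?ltW.
  rewrite rateE// expRN ltr_pdivrMr ?expR_gt0//.
  apply: (@lt_le_trans _ _ (e * (c * ln n%:R))).
    move: LB; rewrite ltr_pdivrMr ?mulr_gt0// => LB.
    by rewrite (_ : e * _ = ln n%:R * (c * e))//; ring.
  rewrite ler_wpM2l ?(ltW e0)//; apply: le_trans (expR_ge1Dx _).
  by rewrite lerDr.
apply: (@squeeze_cvge _ _ _ _ (cst 0%E) _
  (fun n => ((C + expR (c * Lam)) / n%:R `^ c)%:E)).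
- near=> n; apply/andP; split; first exact: outer_measure_ge0.
  by apply: bound; near: n; exact: nbhs_infty_gt.
- exact: cvg_cst.
- by apply: cvg_EFin => //; near=> n.
Unshelve. all: by end_near. Qed.
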